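(* (1) If $\delta$ is a clockable ordinal and $\alpha$ is the least ordinal greater than $\delta$ that ends a gap in the clockable ordinals, then $\alpha$ is one-tape clockable. (2) More generally, if $\delta$ and $\beta$ are clockable ordinals and $\alpha$ is the least ordinal greater than $\delta$ that ends a gap in the clockable ordinals of length at least $\beta+\omega$, then $\alpha$ is one-tape clockable.
   Context: An infinite time Turing machine (ITTM) has three tapes (input, scratch, output) of cells indexed by $\omega$ with values in $\{0,1\}$, one head scanning a column of all three tapes, and a program with finitely many states including start, halt and a limit state. Successor steps are as for ordinary Turing machines (moving left from the leftmost cell leaves the head in place); at limit stages the head returns to the leftmost cell, the state becomes the limit state, and each cell takes the $\limsup$ of its earlier values. A one-tape ITTM is the same with a single tape. An ordinal $\alpha$ is clockable (resp. one-tape clockable) if some ITTM (resp. one-tape ITTM) program on input $0=\langle000\cdots\rangle$ reaches the halt state for the first time at exactly stage $\alpha$. A clockable ordinal $\alpha$ ends a gap if there is $\beta'<\alpha$ such that no ordinal in $[\beta',\alpha)$ is clockable; the least such $\beta'$ is the gap-starting ordinal, and the length of the gap is the unique $\gamma$ with $\beta'+\gamma=\alpha$. *)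

(* Defs.v *)
(* ordinals are represented by
   well-ordered types, compared via order embeddings / isomorphisms. *)
From mathcomp Require Import all_boot.
Set Implicit Arguments. Unset Strict Implicit. Unset Printing Implicit Defensive.

(* Machines with k tapes (k = 3: ITTM, k = 1: one-tape ITTM).          *)
(* state -> column read -> (column written, move right?, new state).   *)
Record program (k : nat) := Program {
  nstates : nat;
  start_st : 'I_nstates;
  halt_st : 'I_nstates;
  limit_st : 'I_nstates;
  st_distinct : [&& start_st != halt_st, start_st != limit_st & halt_st != limit_st];
  delta : 'I_nstates -> {ffun 'I_k -> bool} ->
          {ffun 'I_k -> bool} * bool * 'I_nstates }.

Record config (k : nat) (p : program k) := Config {
  cstate : 'I_(nstates p);
  chead : nat;
  ctape : 'I_k -> nat -> bool }.

Definition init_config k (p : program k) : config p :=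
  @Config k p (start_st p) 0 (fun _ _ => false).

(* one successor step; moving left from cell 0 stays at 0 (n.-1);
   the halt state has no transitions (the configuration is frozen) *)
Definition step k (p : program k) (c : config p) : config p :=
  if cstate c == halt_st p then c else
  let r := [ffun i => ctape c i (chead c)] in
  let: (w, mv, q) := @delta k p (cstate c) r in
  @Config k p q (if mv then (chead c).+1 else (chead c).-1)
    (fun i j => if j == chead c then w i else ctape c i j).

(* A run of p along a (strict, total, well-founded) order R on T:
   c t is the configuration at stage t. *)
Definition is_run k (p : program k) (T : Type) (R : T -> T -> Prop)
    (c : T -> config p) : Prop :=
  (forall t, (forall s, ~ R s t) -> c t = init_config p) /\
  (forall s t, R s t -> (forall u, ~ (R s u /\ R u t)) -> c t = step (c s)) /\
  (* limit stages: limit state, head on cell 0, each cell = limsup *)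
  (forall t, (exists s, R s t) -> (forall s, R s t -> exists u, R s u /\ R u t) ->
     [/\ cstate (c t) = limit_st p, chead (c t) = 0 &
         forall i j, ctape (c t) i j = true <->
           (forall s, R s t -> exists u, (u = s \/ R s u) /\ R u t /\
                                         ctape (c u) i j = true)]).

(* adding a top element (stage alpha) to a well order of type alpha *)
Definition opt_rel (T : Type) (R : T -> T -> Prop) (x y : option T) : Prop :=
  match x, y with
  | Some a, Some b => R a b
  | Some _, None => True
  | _, _ => False
  end.

(* p reaches the halt state for the first time at stage alpha, where
   alpha is the order type of (T, R) *)
Definition clocks k (p : program k) (T : Type) (R : T -> T -> Prop) : Prop :=
  exists c : option T -> config p,
    [/\ @is_run k p _ (opt_rel R) c, cstate (c None) = halt_st p &
        forall t, cstate (c (Some t)) <> halt_st p].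

Record wo := WO {
  wcar : Type;
  wlt : wcar -> wcar -> Prop;
  wlt_irrefl : forall x, ~ wlt x x;
  wlt_trans : forall x y z, wlt x y -> wlt y z -> wlt x z;
  wlt_total : forall x y, wlt x y \/ x = y \/ wlt y x;
  wlt_wf : well_founded wlt }.

Definition order_emb (A B : Type) (RA : A -> A -> Prop) (RB : B -> B -> Prop)
  (f : A -> B) : Prop := forall x y, RA x y <-> RB (f x) (f y).

Definition ord_iso (A B : Type) (RA : A -> A -> Prop) (RB : B -> B -> Prop) : Prop :=
  exists f : A -> B, order_emb RA RB f /\ forall b, exists a, f a = b.

Definition ord_le (A B : Type) (RA : A -> A -> Prop) (RB : B -> B -> Prop) : Prop :=
  exists f : A -> B, order_emb RA RB f /\
    forall a b, RB b (f a) -> exists a', f a' = b.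

Definition ord_lt (A B : Type) (RA : A -> A -> Prop) (RB : B -> B -> Prop) : Prop :=
  exists (b0 : B) (f : A -> B), order_emb RA RB f /\
    forall b, RB b b0 <-> exists a, f a = b.

Definition sum_rel (A B : Type) (RA : A -> A -> Prop) (RB : B -> B -> Prop)
  (x y : A + B) : Prop :=
  match x, y with
  | inl a, inl a' => RA a a'
  | inr b, inr b' => RB b b'
  | inl _, inr _ => True
  | inr _, inl _ => False
  end.

Definition nat_lt (m n : nat) : Prop := m < n.

Definition wle (a b : wo) := ord_le (@wlt a) (@wlt b).
Definition wltO (a b : wo) := ord_lt (@wlt a) (@wlt b).

Definition clockable_k (k : nat) (a : wo) : Prop :=
  exists p : program k, clocks p (@wlt a).
Definition clockable (a : wo) : Prop := clockable_k 3 a.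
Definition one_tape_clockable (a : wo) : Prop := clockable_k 1 a.

Definition gap_free (b' a : wo) : Prop :=
  forall z : wo, wle b' z -> wltO z a -> ~ clockable z.

Definition ends_gap (a : wo) : Prop :=
  clockable a /\ exists b' : wo, wltO b' a /\ gap_free b' a.

Definition is_gap_start (a b' : wo) : Prop :=
  [/\ wltO b' a, gap_free b' a &
      forall b'' : wo, wltO b'' a -> gap_free b'' a -> wle b' b''].

Definition is_gap_length (a g : wo) : Prop :=
  exists b' : wo, is_gap_start a b' /\ ord_iso (sum_rel (@wlt b') (@wlt g)) (@wlt a).

Definition ends_gap_len_ge (a : wo) (L : Type) (RL : L -> L -> Prop) : Prop :=
  ends_gap a /\ exists g : wo, is_gap_length a g /\ ord_le RL (@wlt g).

(* Main.v *)
Require Import Defs.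
From mathcomp Require Import all_boot.
From mathcomp Require Import boolp zify.
From Stdlib Require Import Wellfounded.
Set Implicit Arguments. Unset Strict Implicit. Unset Printing Implicit Defensive.

(** A machine is in its limit state at every limit stage, so it never halts there:
    clockable ordinals are successors, and they are closed under successor.  Hence a
    gap ends at some [lambda + 1] with [lambda] a limit, and in part (1) the ordinal
    [alpha] is [delta + omega + 1].  A one-tape machine simulates several tapes with
    finitely many steps per step, so both runs agree at all limits; at a limit it can
    inspect one bit and halt one step later.  For (1), simulate the clock of [delta],
    and when it halts write a flag on the way back to cell 0; the flag is first seen at
    [delta + omega].

    For (2), a one-tape machine simulates all one-tape programs in parallel, [omega]
    steps of each per block [[l, l + omega)].  Every block that follows a halting (or
    a limit of haltings) restarts a simulation of the clock of [beta].  Cell 0 is set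
    to 1 in each block and lowered when the [beta]-clock halts while [delta] has been
    reached and no program halts in the block; so the first limit [t] at which cell 0
    reads 0 ends a gap of length at least [beta + omega] beyond [delta], and [t + 1] is
    one-tape clocked.  Conversely a gap of this length forces such a limit by
    [s + beta + omega], where [s] is the start of the gap, whence [alpha = t + 1]. *)

(** * Stages and transfinite runs *)

(** A limit stage forgets the state and the head and keeps only the limsup of each cell. So a
    simulation that spends finitely many steps per step is faithful only if, in between, each data
    cell holds its value before or after the simulated step: a transient 1 could recur cofinally and
    survive the limit. Every simulation below obeys this constraint; registers, queues and head
    positions are rebuilt after each limit.

    Such a simulation halts in the same block as its original. Hence a block contains a three-tape
    clockable stage iff some one-tape program first halts in it, and the searcher need only watch
    one-tape programs.

    The searcher is written as a transition function on a countable state set with a bit memory, and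
    brought down in three layers: a counter program, a multi-track machine, one tape.

    All ordinals are read as stages or intervals of one well-order, long enough to hold alpha and a
    copy of beta started at any stage below alpha; it has no maximum, so that successors always
    exist. *)

Record stages := Stages {
  st_wo :> wo;
  st_zero : wcar st_wo;
  st_nomax : forall x : wcar st_wo, exists y, wlt x y }.

Reserved Notation "x <! y" (at level 70).
Reserved Notation "x <=! y" (at level 70).

Section Order.
Variable T : stages.
Notation TT := (wcar T).
Local Notation "x <! y" := (@wlt T x y).
Definition sle (x y : TT) := x <! y \/ x = y.
Local Notation "x <=! y" := (sle x y).

Lemma slt_irr x : ~ x <! x. Proof. exact: wlt_irrefl. Qed.
Lemma slt_trans y x z : x <! y -> y <! z -> x <! z. Proof. exact: wlt_trans. Qed.
Lemma slexx x : x <=! x. Proof. by right. Qed.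
Lemma sltW x y : x <! y -> x <=! y. Proof. by left. Qed.
Lemma sle_lt_trans y x z : x <=! y -> y <! z -> x <! z.
Proof. by case=> [|->//]; apply: slt_trans. Qed.
Lemma slt_le_trans y x z : x <! y -> y <=! z -> x <! z.
Proof. by move=> xy [|<-//]; apply: slt_trans. Qed.
Lemma sle_trans y x z : x <=! y -> y <=! z -> x <=! z.
Proof. by case=> [xy yz|-> //]; left; apply: slt_le_trans yz. Qed.
Lemma slt_or x y : x <! y \/ y <=! x.
Proof. by case: (wlt_total x y) => [|[->|]]; [left|right; right|right; left]. Qed.
Lemma sle_nlt x y : x <=! y -> ~ y <! x.
Proof. by move=> xy yx; apply: (@slt_irr x); apply: sle_lt_trans yx. Qed.
Lemma nlt_sle x y : ~ y <! x -> x <=! y.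
Proof. by case: (slt_or y x). Qed.
Lemma sle_anti x y : x <=! y -> y <=! x -> x = y.
Proof. by case=> // xy /sle_nlt. Qed.

Lemma wmin (P : TT -> Prop) :
  (exists x, P x) -> exists2 x, P x & forall y, P y -> x <=! y.
Proof.
case=> x0; elim/(well_founded_ind (@wlt_wf T)): x0 => x IH Px.
have [[y [yx Py]]|nex] := pselect (exists y, y <! x /\ P y); first exact: IH y yx Py.
by exists x => // y Py; apply: nlt_sle => yx; apply: nex; exists y.
Qed.

Lemma sc_ex x : exists y, x <! y /\ forall z, x <! z -> y <=! z.
Proof. by have [y ? ?] := wmin (st_nomax x); exists y. Qed.
Definition sc x := projT1 (cid (sc_ex x)).
Lemma sc_gt x : x <! sc x. Proof. by have [] := projT2 (cid (sc_ex x)). Qed.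
Lemma sc_min x y : x <! y -> sc x <=! y.
Proof. by have [_ h] := projT2 (cid (sc_ex x)); apply: h. Qed.
Lemma sc_lt x y : y <! sc x -> y <=! x.
Proof. by move=> h; apply: nlt_sle => /sc_min /sle_nlt. Qed.
Lemma sc_mono x y : x <! y -> sc x <! sc y.
Proof. by move=> h; apply: (sle_lt_trans (sc_min h)); apply: sc_gt. Qed.
Lemma sc_inj : injective sc.
Proof.
move=> x y e; case: (wlt_total x y) => [|[//|]] /sc_mono; rewrite e => /slt_irr //.
Qed.

(* Zero or a limit.  Every stage is [add l n] for unique [l], [n] with [lz l]. *)
Definition lz x := forall y, y <! x -> sc y <! x.
Lemma nlz x : ~ lz x -> exists y, x = sc y.
Proof.
move=> h; apply: contrapT => hn; apply: h => y yx.
by have [//|e] := sc_min yx; case: hn; exists y.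
Qed.
Lemma lz_sc x : ~ lz (sc x).
Proof. by move=> /(_ _ (sc_gt x)) /slt_irr. Qed.

Definition add x n := iter n sc x.
Lemma addS x n : add x n.+1 = sc (add x n). Proof. by []. Qed.
Lemma add_add x m n : add (add x m) n = add x (n + m).
Proof. by rewrite /add iterD. Qed.
Lemma add_lt x m n : m < n -> add x m <! add x n.
Proof.
elim: n => // n IH; rewrite ltnS leq_eqVlt => /orP[/eqP->|/IH h]; first exact: sc_gt.
by apply: slt_trans h (sc_gt _).
Qed.
Lemma add_le x m n : m <= n -> add x m <=! add x n.
Proof. by rewrite leq_eqVlt => /orP[/eqP->|/add_lt ?]; [right|left]. Qed.
Lemma add_ge x n : x <=! add x n. Proof. exact: (@add_le x 0 n). Qed.
Lemma add_lt_inv x m n : add x m <! add x n -> m < n.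
Proof. by case: (ltnP m n) => // /(@add_le x) /sle_nlt. Qed.
Lemma lz_add l x n : lz l -> x <! l -> add x n <! l.
Proof. by move=> hl xl; elim: n => //= n IH; apply: hl. Qed.
Lemma decomp x : exists l n, lz l /\ x = add l n.
Proof.
elim/(well_founded_ind (@wlt_wf T)): x => x IH.
have [h|/nlz[y e]] := pselect (lz x); first by exists x, 0.
have [l [n [hl ey]]] := IH y (ltac:(rewrite e; apply: sc_gt)).
by exists l, n.+1; rewrite e ey.
Qed.
(** No limit lies strictly inside a block: below a limit, finitely many successors stay below it. *)
Lemma blk_le l l' n : lz l -> l <=! add l' n -> l <=! l'.
Proof. by move=> hl h; apply: nlt_sle => /(lz_add n hl) /sle_nlt. Qed.
Lemma blk_lt l t n : lz t -> l <! t -> add l n <! t.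
Proof. exact: lz_add. Qed.
Lemma blk_uniq l l' n n' : lz l -> lz l' -> add l n = add l' n' -> l = l' /\ n = n'.
Proof.
move=> hl hl' e.
have e1 : l = l'.
  apply: sle_anti; [apply: (@blk_le _ _ n')|apply: (@blk_le _ _ n)] => //.
    by rewrite -e; apply: add_ge.
  by rewrite e; apply: add_ge.
subst l'; split=> //; apply/eqP; rewrite eqn_leq; apply/andP; split; rewrite leqNgt;
  apply/negP => /(@add_lt l); rewrite e => /slt_irr //.
Qed.
Lemma blk_le_lt l s u n m : s = add l n -> lz l -> s <=! u -> u <! add l m ->
  exists2 j, u = add l j & n <= j < m.
Proof.
move=> -> hl; case: (decomp u) => l' [j [hl' ->]] h1 h2.
have a : l <=! l' by apply: (@blk_le _ _ j) => //; apply: sle_trans h1; apply: add_ge.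
have b : l' <=! l.
  by apply: (@blk_le _ _ m) => //; left; apply: (sle_lt_trans _ h2); apply: add_ge.
have e := sle_anti a b; subst l'; exists j => //; rewrite (add_lt_inv h2) andbT leqNgt.
by apply/negP => /(@add_lt l); apply: sle_nlt.
Qed.

(** The stage [w] is [l + omega], taken as the least stage above all [add l n]; it is a limit
    because everything below it is bounded by some [add l n]. *)
Lemma nxt_lim_ex l t : l <! t -> (forall n, add l n <! t) ->
  exists2 w, lz w & l <! w /\ (forall n, add l n <! w) /\ w <=! t /\
     (forall x, x <! w -> exists n, x <=! add l n).
Proof.
move=> lt h; have [w Pw mw] := wmin (ex_intro (fun w => forall n, add l n <! w) t h).
have Hx x : x <! w -> exists n, x <=! add l n.
  move=> xw; apply: contrapT => hn; case/sle_nlt: (xw); apply: mw => n.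
  by case: (slt_or (add l n) x) => // h'; case: hn; exists n.
exists w.
  move=> y /Hx[n hn]; apply: sle_lt_trans (Pw n.+1).
  by rewrite addS; case: hn => [/sc_mono|->]; [left|right].
by split; [apply: (Pw 0)|split=> //; split=> //; apply: mw].
Qed.

Definition pr x := if pselect (exists u, sc u = x) is left e then projT1 (cid e) else x.
Lemma pr_sc x : pr (sc x) = x.
Proof.
rewrite /pr; case: pselect => [e|]; last by case; exists x.
by case: cid => u /= /sc_inj.
Qed.

Definition limsup A (f : TT -> A -> bool) (t : TT) (a : A) : bool :=
  `[< forall s, s <! t -> exists u, s <=! u /\ u <! t /\ f u a >].

Lemma limsup_eq A (f g : TT -> A -> bool) t :
  (forall u, u <! t -> f u = g u) -> limsup f t = limsup g t.
Proof.
move=> h; apply: funext => a; apply/asboolP/asboolP => H s st;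
  case: (H s st) => u [su [ut fu]]; exists u; split=> //; split=> //; first by rewrite -h.
by rewrite h.
Qed.
Lemma limsup_eq_from A1 A2 (f : TT -> A1 -> bool) (g : TT -> A2 -> bool) z t a c :
  z <! t -> (forall u, z <=! u -> u <! t -> f u a = g u c) -> limsup f t a = limsup g t c.
Proof.
move=> zt h; apply/asboolP/asboolP => H s st;
  (case: (slt_or s z) => [sz|zs]; [have [u [su [ut fu]]] := H z zt|have [u [su [ut fu]]] := H s st]);
  exists u; (split; [by [|apply: sle_trans su; left]|split=> //]); rewrite -?h // ?h //;
  exact: sle_trans zs su.
Qed.
Lemma limsup1 A (f : TT -> A -> bool) t a :
  (forall s, s <! t -> exists u, s <=! u /\ u <! t /\ f u a) -> limsup f t a.
Proof. by move=> h; apply/asboolP. Qed.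
Lemma limsup0 A (f : TT -> A -> bool) t a s :
  s <! t -> (forall u, s <=! u -> u <! t -> f u a = false) -> limsup f t a = false.
Proof.
move=> st h; apply/negP => /asboolP /(_ s st)[u [su [ut]]]; by rewrite h.
Qed.
Lemma limsup0_ex A (f : TT -> A -> bool) t a :
  limsup f t a = false ->
  exists2 s, s <! t & forall u, s <=! u -> u <! t -> f u a = false.
Proof.
move=> h; apply: contrapT => hn.
suff : limsup f t a by rewrite h.
apply: limsup1 => s st; apply: contrapT => hu; apply: hn; exists s => // u su ut.
by apply/negP => fu; apply: hu; exists u.
Qed.

(* The same values up to a finite delay: enough for equal limsups over a block. *)
Definition bsim (x y : nat -> bool) :=
  (forall n, exists2 m, n <= m & y m = x n) /\
  (forall n, exists M, forall m, M <= m -> exists2 n', n <= n' & y m = x n').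

Lemma limsup_sim A1 A2 (f1 : TT -> A1 -> bool) (f2 : TT -> A2 -> bool) z t a c :
  lz z -> lz t -> z <! t ->
  (forall l, lz l -> z <=! l -> l <! t ->
     bsim (fun n => f1 (add l n) a) (fun n => f2 (add l n) c)) ->
  (forall l m, lz l -> z <! l -> l <! t ->
     exists n, f2 (add l m) c = f1 (add l n) a) ->
  limsup f1 t a = limsup f2 t c.
Proof.
move=> hz ht zt H1 H2.
have H s : s <! t -> exists l n, [/\ lz l, z <=! l, l <! t & s <=! add l n].
  move=> st; case: (slt_or s z) => [sz|zs].
    by exists z, 0; split=> //; [right|left].
  case: (decomp s) => l [n [hl es]]; exists l, n; rewrite -es; split=> //; last by right.
    by apply: (@blk_le _ _ n) => //; rewrite -es.
  by apply: sle_lt_trans st; rewrite es; apply: add_ge.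
apply/asboolP/asboolP => G s /H[l [n [hl zl lt sl]]].
  have [u [su [ut fu]]] := G _ (lz_add n ht lt).
  case: (decomp u) => l' [j [hl' eu]].
  have ll' : l <=! l'.
    by apply: (@blk_le _ _ j) => //; rewrite -eu; apply: sle_trans su; apply: add_ge.
  have l't : l' <! t by apply: sle_lt_trans ut; rewrite eu; apply: add_ge.
  have [G1 _] := H1 l' hl' (sle_trans zl ll') l't.
  have [m jm em] := G1 j; exists (add l' m); split; last first.
    by split; [apply: lz_add|rewrite em -eu].
  by apply: (sle_trans sl); apply: (sle_trans su); rewrite eu; apply: add_le.
have [_ /(_ n)[M HM]] := H1 l hl zl lt.
have [u [su [ut fu]]] := G _ (lz_add (maxn n M) ht lt).
case: (decomp u) => l' [j [hl' eu]].
have ll' : l <=! l'.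
  by apply: (@blk_le _ _ j) => //; rewrite -eu; apply: sle_trans su; apply: add_ge.
have l't : l' <! t by apply: sle_lt_trans ut; rewrite eu; apply: add_ge.
case: (ll') => [llt|e].
  have [n' e] := H2 l' j hl' (sle_lt_trans zl llt) l't.
  exists (add l' n'); split; last by split; [apply: lz_add|rewrite -e -eu].
  apply: (sle_trans sl); left; apply: (slt_le_trans (lz_add n hl' llt)); apply: add_ge.
subst l'; have /HM[n' nn' e] : M <= j.
  rewrite leqNgt; apply/negP => jM; move: su; rewrite eu => /sle_nlt; apply.
  by apply: add_lt; rewrite leq_max jM orbT.
exists (add l n'); split; last by split; [apply: lz_add|rewrite -e -eu].
by apply: (sle_trans sl); apply: add_le.
Qed.

(** The common shape of machines and of the abstract searcher: a limit sees only the memory cells,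
    so [tlim] rebuilds a whole configuration from their limsups. *)
Record tsys := TSys {
  tC : Type; tA : Type; tinit : tC; tstep : tC -> tC;
  tlim : (tA -> bool) -> tC; tmem : tC -> tA -> bool;
  tlimK : forall X a, tmem (tlim X) a = X a }.

Section Run.
Variables (S : tsys) (z : TT).

Definition run_gen (t : TT) (g : TT -> tC S) : tC S :=
  if pselect (z <! t) is left _ then
    if pselect (lz t) is left _ then tlim (limsup (fun u => tmem (g u)) t)
    else tstep (g (pr t))
  else tinit S.

(** Stages up to [z] carry the initial configuration, so a run can be started at any stage; the
    replay of the beta-clock needs this. *)
Definition run : TT -> tC S :=
  Fix (@wlt_wf T) (fun=> tC S) (fun t rec =>
    run_gen t (fun u => if pselect (u <! t) is left h then rec u h else tinit S)).

Lemma runE t : run t = run_gen t run.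
Proof.
rewrite /run Fix_eq; last first.
  move=> x f g fg; congr run_gen; apply: funext => u; case: pselect => // h; exact: fg.
rewrite -/run /run_gen; case: pselect => // zt; case: pselect => [ht|hn].
  congr tlim; apply: limsup_eq => u ut; case: pselect => //.
have [y e] := nlz hn; rewrite e pr_sc; case: pselect => // []; case; exact: sc_gt.
Qed.

Lemma run_init t : t <=! z -> run t = tinit S.
Proof. by move=> /sle_nlt h; rewrite runE /run_gen; case: pselect. Qed.
Lemma run_z : run z = tinit S. Proof. by apply: run_init; right. Qed.
Lemma run_sc t : z <=! t -> run (sc t) = tstep (run t).
Proof.
move=> zt; rewrite runE /run_gen; case: pselect => [_|[]]; last first.
  exact: sle_lt_trans zt (sc_gt t).
by case: pselect => [/lz_sc//|_]; rewrite pr_sc.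
Qed.
Lemma run_lim t : z <! t -> lz t -> run t = tlim (limsup (fun u => tmem (run u)) t).
Proof. by move=> zt ht; rewrite runE /run_gen; case: pselect => // _; case: pselect. Qed.
Lemma run_add l n : z <=! l -> run (add l n) = iter n (@tstep S) (run l).
Proof.
move=> zl; elim: n => //= n <-; rewrite run_sc //; apply: sle_trans zl (add_ge _ _).
Qed.
Lemma mem_lim t a : z <! t -> lz t -> tmem (run t) a = limsup (fun u => tmem (run u)) t a.
Proof. by move=> zt ht; rewrite run_lim // tlimK. Qed.

Lemma run_ind (P : TT -> Prop) :
  P z -> (forall t, z <=! t -> P t -> P (sc t)) ->
  (forall t, z <! t -> lz t -> (forall u, z <=! u -> u <! t -> P u) -> P t) ->
  forall t, z <=! t -> P t.
Proof.
move=> Pz Ps Pl t; elim/(well_founded_ind (@wlt_wf T)): t => t IH [zt|<-//].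
have [ht|/nlz[y e]] := pselect (lz t); first by apply: Pl => // u zu ut; apply: IH.
subst t; apply: Ps; first exact: sc_lt.
by apply: IH; [exact: sc_gt|exact: sc_lt].
Qed.
End Run.

(** Simulation step for step. [e] locates the cells of [S1] among those of [S2], [J] collects cells
    that [S2] keeps at 0 (an added tape), and [guard] lets the relation break from [t0] on, for
    instance after a halt. *)
Lemma lockstep (S1 S2 : tsys) (e : tA S1 -> tA S2) (J : tA S2 -> Prop)
  (guard : tC S1 -> Prop) (Rl : tC S1 -> tC S2 -> Prop) z t0 :
  Rl (tinit S1) (tinit S2) ->
  (forall c1 c2, guard c1 -> Rl c1 c2 -> Rl (tstep c1) (tstep c2)) ->
  (forall X1 X2, (forall a, X1 a = X2 (e a)) -> (forall c, J c -> X2 c = false) ->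
     Rl (tlim X1) (tlim X2)) ->
  (forall c1 c2, Rl c1 c2 -> (forall a, tmem c1 a = tmem c2 (e a)) /\
     (forall c, J c -> tmem c2 c = false)) ->
  (forall s, z <=! s -> s <! t0 -> guard (run S1 z s)) ->
  forall t, z <=! t -> t <=! t0 -> Rl (run S1 z t) (run S2 z t).
Proof.
move=> h0 hs hl hm hg; apply: run_ind => [_|t zt IH tt0|t zt ht IH tt0].
- by rewrite !run_z.
- have tt0' : t <! t0 by apply: slt_le_trans (sc_gt _) tt0.
  by rewrite !run_sc //; apply: hs; [apply: hg|apply: IH; left].
- rewrite !run_lim //; apply: hl => [a|c Jc].
    apply: limsup_eq_from zt _ => u zu ut.
    by apply: (proj1 (hm _ _ (IH u zu ut _))); left; apply: slt_le_trans ut tt0.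
  apply: (limsup0 zt) => u zu ut.
  by apply: (proj2 (hm _ _ (IH u zu ut _))) => //; left; exact: slt_le_trans ut tt0.
Qed.

(** Simulation with several steps per step; [tau n] is the time at which step [n] is done. Each
    duration depends on the configuration reached, so [tau] is chosen by a recursion that carries
    the relation in a subset type. [Ph] records what holds in between. *)
Lemma iter_msim (C1 C2 : Type) (f1 : C1 -> C1) (f2 : C2 -> C2)
  (Rl : C1 -> C2 -> Prop) (Ph : C1 -> C2 -> Prop) c1 c2 :
  (forall c1 c2, Rl c1 c2 -> exists n, [/\ 0 < n, Rl (f1 c1) (iter n f2 c2) &
      forall m, m < n -> Ph c1 (iter m f2 c2)]) ->
  Rl c1 c2 -> exists tau : nat -> nat, [/\ forall n, n <= tau n,
    forall n, Rl (iter n f1 c1) (iter (tau n) f2 c2) &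
    forall m, exists2 n, tau n <= m < tau n.+1 & Ph (iter n f1 c1) (iter m f2 c2)].
Proof.
move=> H R0.
have step n c : Rl (iter n f1 c1) c -> exists k, [/\ 0 < k, Rl (iter n.+1 f1 c1) (iter k f2 c) &
      forall m, m < k -> Ph (iter n f1 c1) (iter m f2 c)] by exact: H.
pose F n (c : {c | Rl (iter n f1 c1) c}) := projT1 (cid (step n _ (svalP c))).
have FP n c := projT2 (cid (step n _ (svalP c))).
pose st n : {c | Rl (iter n f1 c1) c} * nat :=
  nat_rect (fun n => {c | Rl (iter n f1 c1) c} * nat)%type
    (exist _ c2 R0 : {c | Rl (iter 0 f1 c1) c}, 0)
    (fun n p => (exist _ (iter (F n p.1) f2 (sval p.1)) (let: And3 _ h _ := FP n p.1 in h),
                 F n p.1 + p.2)) n.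
pose tau n := (st n).2.
have tauS n : tau n.+1 = F n (st n).1 + tau n by [].
have stE n : sval (st n).1 = iter (tau n) f2 c2.
  by elim: n => //= n ->; rewrite -iterD.
have Fp n : 0 < F n (st n).1 by case: (FP n (st n).1).
have tmon n : tau n < tau n.+1 by rewrite tauS -[X in X < _]add0n ltn_add2r.
have tge n : n <= tau n by elim: n => // n IH; apply: leq_ltn_trans IH (tmon n).
exists tau; split=> // [n|m].
  by rewrite -stE; apply: svalP.
have hex : exists n, m < tau n.+1 by exists m; apply: tge.
case: (ex_minnP hex) => n mn hmin; exists n.
  rewrite mn andbT; case: n mn hmin => [//|n] mn hmin; rewrite leqNgt; apply/negP => /hmin.
  by rewrite ltnn.
have tm : tau n <= m.
  case: n mn hmin => [//|n] mn hmin; rewrite leqNgt; apply/negP => /hmin; by rewrite ltnn.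
rewrite -(subnK tm) iterD -stE; case: (FP n (st n).1) => _ _; apply.
by rewrite ltn_subLR // addnC -tauS.
Qed.

Lemma tau_bsim (x y : nat -> bool) (tau : nat -> nat) :
  (forall n, n <= tau n) -> (forall n, y (tau n) = x n) ->
  (forall m, exists2 n, tau n <= m < tau n.+1 & (y m = x n \/ y m = x n.+1)) ->
  bsim x y /\ forall m, exists n, y m = x n.
Proof.
move=> h1 h2 h3; split; last first.
  by move=> m; case: (h3 m) => n _ [->|->]; [exists n|exists n.+1].
split=> n; first by exists (tau n).
(* Past all of [tau 0, ..., tau n], the simulated step that encloses time [m] has index at least
   [n]; monotonicity of [tau] is not assumed. *)
exists (\max_(i < n.+1) tau i) => m hm; case: (h3 m) => n' /andP[_ a] b.
have nn' : n <= n'.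
  rewrite leqNgt; apply/negP => n'n; move: a; rewrite ltnNge => /negP; apply.
  apply: leq_trans hm; exact: (@leq_bigmax _ (fun i : 'I_n.+1 => tau i) (@Ordinal n.+1 n'.+1 n'n)).
by case: b => ->; [exists n'|exists n'.+1 => //; apply: leqW].
Qed.
End Order.

Arguments lockstep {T S1 S2}.

(** * Machines and clocked stages *)

Notation "x <! y" := (wlt x y).
Notation "x <=! y" := (sle x y).

Notation col k := {ffun 'I_k -> bool}.

(** Machines over an arbitrary finite type of states, so that states can be built from sums,
    products and options; [am_of] and [prog_of] translate from and to programs. *)
Record amach (k : nat) := AMach {
  ast : finType;
  a0 : ast; ah : ast; al : ast;
  adist : [&& a0 != ah, a0 != al & ah != al];
  adl : ast -> col k -> col k * bool * ast }.

Section Amach.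
Variables (k : nat) (M : amach k).
Definition aconf := (ast M * nat * ('I_k -> nat -> bool))%type.
Definition rdc (tp : 'I_k -> nat -> bool) (h : nat) : col k := [ffun i => tp i h].
Definition wrc (tp : 'I_k -> nat -> bool) (h : nat) (w : col k) : 'I_k -> nat -> bool :=
  fun i j => if j == h then w i else tp i j.
Definition mvh (mv : bool) h := if mv then h.+1 else h.-1.
Definition astep1 (c : aconf) : aconf :=
  let: (w, mv, q) := adl c.1.1 (rdc c.2 c.1.2) in (q, mvh mv c.1.2, wrc c.2 c.1.2 w).
Definition astep (c : aconf) : aconf := if c.1.1 == ah M then c else astep1 c.
Definition amem (c : aconf) (a : 'I_k * nat) : bool := c.2 a.1 a.2.
Definition alimc (X : 'I_k * nat -> bool) : aconf := (al M, 0, fun i j => X (i, j)).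
Definition ainit : aconf := (a0 M, 0, fun _ _ => false).
Lemma alimK X a : amem (alimc X) a = X a. Proof. by case: a. Qed.
Definition asys := TSys ainit astep alimK.
Lemma amem_lim (T : stages) (z t : wcar T) a : z <! t -> lz t ->
  amem (run asys z t) a = limsup (fun u => amem (run asys z u)) t a.
Proof. by move=> zt ht; apply: (@mem_lim _ asys). Qed.
End Amach.

Lemma wrc_id k (tp : 'I_k -> nat -> bool) h : wrc tp h (rdc tp h) = tp.
Proof. by apply: funext => i; apply: funext => j; rewrite /wrc; case: eqP => // ->; rewrite ffunE. Qed.

Section Halts.
Variables (T : stages) (k : nat) (M : amach k).
Definition stt z (t : wcar T) : ast M := (run (asys M) z t).1.1.
Definition halts z (t : wcar T) :=
  z <=! t /\ stt z t = ah M /\ forall s, z <=! s -> s <! t -> stt z s <> ah M.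

Lemma halts_uniq z t t' : halts z t -> halts z t' -> t = t'.
Proof.
move=> [a [b c]] [a' [b' c']]; case: (wlt_total t t') => [h|[//|h]].
  by case: (c' t).
by case: (c t').
Qed.

Lemma halts_sc z t : halts z t -> exists2 u, z <=! u & t = sc u.
Proof.
case=> zt [h _]; case: zt => [zt|e]; last first.
  move: h; rewrite -e /stt run_z /= => e'; move: (adist M).
  by rewrite e' eqxx.
have [ht|/nlz[u e]] := pselect (lz t).
  move: h; rewrite /stt run_lim //= => e'; by move: (adist M); rewrite e' eqxx !andbF.
by exists u => //; apply: sc_lt; rewrite -e.
Qed.
Lemma ahl : (al M == ah M) = false.
Proof. by apply/negbTE; rewrite eq_sym; case/and3P: (adist M). Qed.
Lemma ah0 : (a0 M == ah M) = false.
Proof. by apply/negbTE; case/and3P: (adist M). Qed.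

End Halts.

Section OfProg.
Variables (k : nat) (p : program k).
Lemma am_of_dist : [&& start_st p != halt_st p, start_st p != limit_st p & halt_st p != limit_st p].
Proof. exact: st_distinct. Qed.
Definition am_of : amach k := AMach am_of_dist (@delta k p).
Definition conv (c : config p) : aconf am_of := (cstate c, chead c, ctape c).
Definition unconv (c : aconf am_of) : config p := @Config k p c.1.1 c.1.2 c.2.
Lemma convK c : unconv (conv c) = c. Proof. by case: c. Qed.
Lemma unconvK c : conv (unconv c) = c. Proof. by case: c => [[]]. Qed.
Lemma conv_init : conv (init_config p) = ainit am_of. Proof. by []. Qed.
Lemma conv_step c : conv (step c) = astep (conv c).
Proof.
rewrite /astep /step /astep1 /conv /= /rdc; case: eqP => //= _.
by case: delta => [[w mv] q].
Qed.
End OfProg.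

Section Bridge.
Variables (T : stages) (k : nat) (p : program k) (z t : wcar T) (b : wo) (f : wcar b -> wcar T).
Hypothesis (zt : z <=! t) (femb : order_emb (@wlt b) (@wlt T) f).
Hypothesis (fim : forall x, (z <=! x /\ x <! t) <-> exists y, f y = x).

Definition fo (x : option (wcar b)) : wcar T := if x is Some y then f y else t.
Notation R := (opt_rel (@wlt b)).

Lemma fo_emb x y : R x y <-> fo x <! fo y.
Proof.
have ft y' : f y' <! t by case: ((fim (f y')).2) => //; exists y'.
case: x y => [x|] [y|] //=; do ?by [exact: femb|split].
  by split=> // /(slt_trans (ft y)) /slt_irr.
by split=> // /slt_irr.
Qed.
Lemma fo_ge x : z <=! fo x.
Proof. by case: x => [x|] //=; case: ((fim (f x)).2) => //; exists x. Qed.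
Lemma fo_down x u : z <=! u -> u <! fo x -> exists2 y, R y x & fo y = u.
Proof.
move=> zu ux; have ut : u <! t.
  apply: (slt_le_trans ux); case: x ux => [x|] //= _; last by right.
  by left; case: ((fim (f x)).2) => //; exists x.
have [y e] := (fim u).1 (conj zu ut); exists (Some y) => //.
by apply/fo_emb; rewrite /= e.
Qed.
Lemma fo_min x : (forall s, ~ R s x) -> fo x = z.
Proof.
move=> h; have [//|h'] := slt_or z (fo x); last by apply: sle_anti h' (fo_ge x).
by move=> zx; have [y /h] := fo_down (slexx z) zx.
Qed.

Lemma fo_wf : well_founded R.
Proof.
have h : well_founded (fun x y => fo x <! fo y) by apply: wf_inverse_image; apply: wlt_wf.
move=> x; elim/(well_founded_ind h): x => x IH; constructor => y /fo_emb; exact: IH.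
Qed.

(** The clauses of [is_run] determine every configuration, so well-founded induction identifies the
    run with the transported [run]. One mismatch has to be repaired: [limsup] also quantifies over
    bounds before [z], and these are replaced by a stage of the run. *)
Lemma run_is_run (c : option (wcar b) -> config p) :
  is_run R c <-> forall x, conv (c x) = run (asys (am_of p)) z (fo x).
Proof.
split.
  case=> [h0 [hs hl]]; apply: (well_founded_ind fo_wf) => x IH.
  case: (fo_ge x) => [zx|e]; last first.
    rewrite -e run_z h0 ?conv_init //= => s /fo_emb; rewrite -e => /sle_nlt; apply; exact: fo_ge.
  have [hx|/nlz[u e]] := pselect (lz (fo x)).
    have [] := hl x.
    - by have [y yx _] := fo_down (slexx z) zx; exists y.
    - move=> s /fo_emb sx; have [] := @fo_down x (sc (fo s)).
      + by apply: sle_trans (fo_ge s) (sltW (sc_gt _)).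
      + exact: hx.
      by move=> y yx e; exists y; split=> //; apply/fo_emb; rewrite e; apply: sc_gt.
    move=> e1 e2 e3; rewrite run_lim // /conv e1 e2 /= /alimc; congr (_, _, _).
    apply: funext => i; apply: funext => j; apply/idP/asboolP.
      move=> /e3 H s sx; case: (slt_or s z) => [sz|zs].
        have [y yx _] := fo_down (slexx z) zx; have [u [uy [ux cu]]] := H _ yx.
        exists (fo u); split; first exact: sle_trans (sltW sz) (fo_ge u).
        by split; [apply/fo_emb|rewrite -IH].
      have [y yx es] := fo_down zs sx; have [u [uy [ux cu]]] := H _ yx.
      exists (fo u); split; first by case: uy => [->|/fo_emb]; rewrite es; [right|left].
      by split; [apply/fo_emb|rewrite -IH].
    move=> H; apply/e3 => s /fo_emb sx; have [u [su [ux cu]]] := H _ sx.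
    have [y yx es] := fo_down (sle_trans (fo_ge s) su) ux; exists y; split.
      case: su => [su|su]; first by right; apply/fo_emb; rewrite es.
      left; case: (pselect (y = s)) => // ns; exfalso.
      case: y s es su ns {H sx yx} => [y|] [s|] //= es su ns.
      - apply: ns; congr Some; case: (wlt_total y s) => [/femb|[//|/femb]]; rewrite es su => /slt_irr //.
      - have := ((fim (f y)).2 (ex_intro _ y erefl)).2; rewrite es -su => /slt_irr //.
      - have := ((fim (f s)).2 (ex_intro _ s erefl)).2; rewrite es su => /slt_irr //.
    by split=> //; move: cu; rewrite -es -IH.
  have zu : z <=! u by apply: sc_lt; rewrite -e.
  have [y yx ey] := @fo_down x u zu (ltac:(rewrite e; apply: sc_gt)).
  rewrite (hs y x) //; last first.
    move=> v [/fo_emb yv /fo_emb]; rewrite e => /sc_lt; rewrite -ey => /sle_nlt; exact.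
  by rewrite e run_sc // conv_step IH // ey.
move=> H; have H' x : c x = unconv (run (asys (am_of p)) z (fo x)) by rewrite -H convK.
split=> [x /fo_min e|].
  by rewrite H' e run_z.
split=> [s x /fo_emb sx hn|x [s sx] hx].
  have e : fo x = sc (fo s).
    apply: sle_anti; last exact: sc_min.
    apply: nlt_sle => h; have [y yx ey] := @fo_down x (sc (fo s)) (sle_trans (fo_ge s) (sltW (sc_gt _))) h.
    by apply: (hn y); split=> //; apply/fo_emb; rewrite ey; apply: sc_gt.
  rewrite -[c x]convK H e run_sc; last exact: fo_ge.
  rewrite -H; change (unconv (astep (conv (c s))) = step (c s)).
  by rewrite -conv_step convK.
have zx : z <! fo x by move/fo_emb: sx; apply: sle_lt_trans; apply: fo_ge.
have lx : lz (fo x).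
  move=> y yx; case: (slt_or y z) => [yz|zy].
    case: (slt_or (sc y) (fo x)) => // h; case: (@slt_irr T z).
    by apply: (slt_le_trans zx); apply: (sle_trans h); apply: sc_min.
  have [y' y'x ey] := fo_down zy yx; have [u [yu ux]] := hx _ y'x.
  by apply: sle_lt_trans ((fo_emb u x).1 ux); apply: sc_min; rewrite -ey; apply/fo_emb.
rewrite H' run_lim //=; split=> // i j; rewrite /limsup; split.
  move/asboolP => G y yx; have [u [su [ux fu]]] := G _ ((fo_emb _ _).1 yx).
  have [y' y'x ey] := fo_down (sle_trans (fo_ge y) su) ux.
  exists y'; split.
    case: su => [su|su]; first by right; apply/fo_emb; rewrite ey.
    left; case: (pselect (y' = y)) => // ns; exfalso.
    case: y y' ey su ns {G yx y'x} => [y|] [y'|] //= es su ns.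
    - apply: ns; congr Some; case: (wlt_total y' y) => [/femb|[//|/femb]]; rewrite es su => /slt_irr //.
    - have := ((fim (f y)).2 (ex_intro _ y erefl)).2; rewrite su -es => /slt_irr //.
    - have := ((fim (f y')).2 (ex_intro _ y' erefl)).2; rewrite es -su => /slt_irr //.
  by split=> //; rewrite H' ey.
move=> G; apply/asboolP => y yx; case: (slt_or y z) => [yz|zy].
  have [u [su [ux cu]]] := G _ sx; exists (fo u); split; first exact: sle_trans (sltW yz) (fo_ge u).
  by split; [apply/fo_emb|move: cu; rewrite H'].
have [y' y'x ey] := fo_down zy yx; have [u [su [ux cu]]] := G _ y'x; exists (fo u); split.
  by rewrite -ey; case: su => [->|/fo_emb]; [right|left].
by split; [apply/fo_emb|move: cu; rewrite H'].
Qed.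

Lemma clocks_halts : clocks p (@wlt b) <-> halts (am_of p) z t.
Proof.
split=> [[c [/run_is_run H e0 e1]]|[_ [e0 e1]]].
  split=> //; split; first by rewrite /stt -(H None).
  by move=> s zs st; have [y e] := (fim s).1 (conj zs st); rewrite /stt -e -(H (Some y)); apply: e1.
exists (fun x => unconv (run (asys (am_of p)) z (fo x))); split=> //.
  by apply/run_is_run => x; rewrite unconvK.
move=> y; case: ((fim (f y)).2); [by exists y|exact: e1].
Qed.
End Bridge.

Section ProgOf.
Variables (k : nat) (M : amach k).
Lemma prog_dist : [&& enum_rank (a0 M) != enum_rank (ah M), enum_rank (a0 M) != enum_rank (al M)
  & enum_rank (ah M) != enum_rank (al M)].
Proof. by rewrite !(inj_eq enum_rank_inj); apply: adist. Qed.
Definition prog_of : program k := Program prog_dist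
  (fun s r => let: (w, mv, q) := adl (enum_val s) r in (w, mv, enum_rank q)).
Lemma prog_of_halts (T : stages) (z t : wcar T) : halts (am_of prog_of) z t <-> halts M z t.
Proof.
pose Rl (c1 : aconf M) (c2 : aconf (am_of prog_of)) := c2 = (enum_rank c1.1.1, c1.1.2, c1.2).
have L : forall t, z <=! t -> Rl (run (asys M) z t) (run (asys (am_of prog_of)) z t).
  move=> t' zt'; apply: (lockstep (S1 := asys M) (S2 := asys (am_of prog_of)) id (fun=> False)
     (fun=> True) Rl z t') => //; last by right.
  - move=> [[s h] tp] c2 _ ->; rewrite /Rl /= /astep /= (inj_eq enum_rank_inj); case: eqP => //= _.
    by rewrite /astep1 /= enum_rankK; case: adl => [[w mv] q].
  - by move=> X1 X2 e _; rewrite /Rl /= /alimc; congr (_, _, _); apply: funext => i; apply: funext => j; rewrite e.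
  - by move=> [[s h] tp] c2 ->.
have E t' : z <=! t' -> (stt (am_of prog_of) z t' = ah (am_of prog_of)) <-> (stt M z t' = ah M).
  by move=> /L; rewrite /stt => -> /=; split=> [/enum_rank_inj|->].
split=> -[a [b c]]; split=> //; (split; first by apply/(E t a)) => s zs st.
  by move=> /(E s zs); apply: c.
by move=> /(E s zs); apply: c.
Qed.
End ProgOf.

(** * From several tapes to one *)

Section Lift.
Variables (k : nat) (M : amach 1).
Definition lift_mach : amach k.+1 := AMach (adist M) (fun s r =>
  let: (w, mv, q) := adl s [ffun=> r ord0] in
  ([ffun i => if i == ord0 then w ord0 else r i], mv, q)).
Lemma lift_halts (T : stages) (z t : wcar T) : halts M z t -> halts lift_mach z t.
Proof.
pose Rl (c1 : aconf M) (c2 : aconf lift_mach) := c2.1 = c1.1 /\ c2.2 ord0 = c1.2 ord0.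
have L : forall t, z <=! t -> Rl (run (asys M) z t) (run (asys lift_mach) z t).
  move=> t' zt'; apply: (lockstep (S1 := asys M) (S2 := asys lift_mach)
     (fun a => (ord0, a.2)) (fun=> False) (fun=> True) Rl z t') => //; last by right.
  - move=> [[s h] tp] [[s2 h2] tp2] _ [/= [-> ->] et]; rewrite /Rl /= /astep /=; case: ifP => //= _.
    rewrite /astep1 /=; have -> : [ffun=> rdc tp2 h ord0] = rdc tp h.
      by apply/ffunP => i; rewrite !ffunE et (ord1 i).
    case: adl => [[w mv] q] /=; split=> //; apply: funext => j; rewrite /wrc ffunE eqxx.
    by rewrite et.
  - move=> X1 X2 e _; split=> //=; apply: funext => j; by rewrite -(e (ord0, j)).
  - by move=> [[s h] tp] [[s2 h2] tp2] [_ /= et]; split=> // -[i j]; rewrite /amem /= et (ord1 i).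
have E t' : z <=! t' -> stt lift_mach z t' = stt M z t'.
  by move=> /L [e _]; rewrite /stt e.
case=> a [b c]; split=> //; split; first by rewrite E.
by move=> s zs st; rewrite E //; apply: c.
Qed.
End Lift.

Section Delay.
Variables (k : nat) (M : amach k).
Lemma delay_dist : [&& Some (a0 M) != None, Some (a0 M) != Some (al M) & None != Some (al M)].
Proof. by have /and3P[h1 h2 h3] := adist M; apply/and3P; split. Qed.
(** The old halting state becomes an ordinary one that passes to the new halting state [None]: this
    gives closure of the clockable ordinals under successor. *)
Definition delay : amach k := @AMach k (option (ast M)) _ _ _ delay_dist (fun s r =>
  if s is Some s then
    if s == ah M then (r, false, None) else let: (w, mv, q) := adl s r in (w, mv, Some q)
  else (r, false, None)).
Lemma delay_halts (T : stages) (z t : wcar T) : halts M z t -> halts delay z (sc t).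
Proof.
pose Rl (c1 : aconf M) (c2 : aconf delay) := c2 = (Some c1.1.1, c1.1.2, c1.2).
case=> a [b c].
have L : forall t', z <=! t' -> t' <=! t -> Rl (run (asys M) z t') (run (asys delay) z t').
  apply: (lockstep (S1 := asys M) (S2 := asys delay)
     id (fun=> False) (fun c => c.1.1 <> ah M) Rl z t) => //.
  - move=> [[s h] tp] c2 /= sh ->; rewrite /Rl /= /astep /=; case: eqP => //= _.
    rewrite /astep1 /=; case: eqP => //= _; by case: adl => [[w mv] q].
  - by move=> X1 X2 e _; rewrite /Rl /= /alimc; congr (_, _, _); apply: funext => i; apply: funext => j; rewrite e.
  - by move=> [[s h] tp] c2 ->.
split; first exact: sle_trans a (sltW (sc_gt t)).
split; last by move=> s zs /sc_lt st; rewrite /stt (L s zs st).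
rewrite /stt run_sc // (L t a (slexx t)) /= /astep /= /astep1 /=.
by move: b; rewrite /stt => ->; rewrite eqxx.
Qed.
End Delay.

(* After halting, [M] is replaced by a walk to the left that sets the new tape 0. *)
Section Flag.
Variables (k : nat) (M : amach k).
Definition flagm : amach k.+1 := @AMach k.+1 (option (ast M)) _ _ _ (delay_dist M) (fun s r =>
  if s is Some s then
    if s == ah M then ([ffun i => (i == ord0) || r i], false, Some (ah M)) else
      let: (w, mv, q) := adl s [ffun i => r (lift ord0 i)] in
      ([ffun i => if unlift ord0 i is Some j then w j else r i], mv, Some q)
  else (r, false, None)).
(** Here [t] is [l + omega]. After [D] the head reaches cell 0 in as many steps as its position and
    stays there, so cell 0 of the new tape is 1 on a final segment of the block, hence at [t]. A
    limit below [t] is at most [l], where the new tape is still blank. *)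
Lemma flagm_halts (T : stages) (z D l t : wcar T) n :
  lz z -> halts M z D -> lz l -> z <=! l -> D = add l n -> lz t -> l <! t ->
  (forall x, x <! t -> exists n, x <=! add l n) ->
  [/\ forall u, z <=! u -> u <! t -> stt flagm z u <> ah flagm,
      forall u, lz u -> z <! u -> u <! t -> amem (run (asys flagm) z u) (ord0, 0) = false &
      amem (run (asys flagm) z t) (ord0, 0)].
Proof.
move=> hz [a [b c]] hl zl eD ht lt hx.
pose Rl (c1 : aconf M) (c2 : aconf flagm) :=
  [/\ c2.1.1 = Some c1.1.1, c2.1.2 = c1.1.2, forall i j, c2.2 (lift ord0 i) j = c1.2 i j &
     forall j, c2.2 ord0 j = false].
have L : forall t', z <=! t' -> t' <=! D -> Rl (run (asys M) z t') (run (asys flagm) z t').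
  apply: (lockstep (S1 := asys M) (S2 := asys flagm)
     (fun a => (lift ord0 a.1, a.2)) (fun a => a.1 == ord0) (fun c => c.1.1 <> ah M) Rl z D) => //.
  - move=> [[s h] tp] [[s2 h2] tp2] /= sh [/= -> -> e1 e2]; rewrite /Rl /= /astep /=.
    case: eqP => //= _; rewrite /astep1 /=; case: eqP => //= _.
    have -> : [ffun i => rdc tp2 h (lift ord0 i)] = rdc tp h.
      by apply/ffunP => i; rewrite !ffunE e1.
    case: adl => [[w mv] q] /=; split=> // [i j|j]; rewrite /wrc ffunE.
      by rewrite liftK e1.
    by rewrite unlift_none ffunE e2; case: ifP.
  - move=> X1 X2 e0 e1; split=> //= i; exact: e1.
  - move=> [[s h] tp] [[s2 h2] tp2] [/= _ _ e1 e2]; split=> [[i j]|[i j] /= /eqP->]; rewrite /amem /= ?e1 //.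
have [e1 e2 _ e3] := L D a (slexx D).
have H m : [/\ (run (asys flagm) z (add D m)).1.1 = Some (ah M),
     (run (asys flagm) z (add D m)).1.2 = (run (asys M) z D).1.2 - m &
     (run (asys M) z D).1.2 < m -> (run (asys flagm) z (add D m)).2 ord0 0].
  elim: m => [|m [IH1 IH2 IH3]].
    rewrite /= subn0 -e2; split=> //; by rewrite e1; move: b; rewrite /stt => ->.
  have zD : z <=! add D m by apply: sle_trans a (add_ge _ _).
  rewrite addS run_sc //; move: IH1 IH2 IH3.
  case: (run (asys flagm) z (add D m)) => [[s h] tp] /= -> -> IH3; rewrite /astep /= /astep1 /= eqxx /=.
  split=> //; first by rewrite subnS.
  rewrite ltnS leq_eqVlt /wrc => /orP[/eqP->|h']; rewrite ?subnn ?ffunE //=.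
  by case: eqP => //; rewrite IH3.
have tD x : D <=! x -> x <! t -> exists m, x = add D m.
  move=> Dx xt; have [n' h] := hx _ xt.
  have [] := blk_le_lt (m := n'.+1) eD hl Dx; first exact: sle_lt_trans h (sc_gt _).
  by move=> j -> /andP[nj _]; exists (j - n); rewrite eD add_add subnK.
have zt := sle_lt_trans zl lt.
split=> [u zu ut|u hu zu ut|].
- have [uD|Du] := slt_or u D.
    by have [e _ _ _] := L u zu (sltW uD); rewrite /stt e.
  by have [m ->] := tD _ Du ut; have [e _ _] := H m; rewrite /stt e.
- suff uD : u <=! D by have [_ _ _] := L u (sltW zu) uD; apply.
  have [ul|lu] := slt_or l u; last by rewrite eD; apply: sle_trans lu (add_ge _ _).
  have [n' h] := hx _ ut; have := @blk_lt _ l u n' hu ul.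
  by move=> h'; case: (sle_nlt h h').
- rewrite amem_lim //; apply: limsup1 => s st.
  have [n' h] := hx _ st.
  pose m := maxn n' ((run (asys M) z D).1.2).+1.
  exists (add D m); split; last split.
  + by apply: (sle_trans h); rewrite eD add_add; apply: add_le; rewrite (leq_trans (leq_maxl _ _) (leq_addr _ _)).
  + by rewrite eD add_add; apply: lz_add.
  + by have [_ _ h'] := H m; apply: h'; rewrite leq_max ltnSn orbT.
Qed.
End Flag.

Section Reach.
Variables (C : Type) (f : C -> C) (P : C -> Prop).
Definition reach x y := exists n, iter n f x = y /\ forall m, m < n -> P (iter m f x).
Lemma reach_refl x : reach x x. Proof. by exists 0. Qed.
Lemma reach_step x y : P x -> reach (f x) y -> reach x y.
Proof.
move=> Px [n [e H]]; exists n.+1; split; first by rewrite iterSr.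
by case=> // m hm; rewrite iterSr; apply: H.
Qed.
Lemma reach_trans y x z : reach x y -> reach y z -> reach x z.
Proof.
move=> [n [e H]] [n' [e' H']]; exists (n' + n); split; first by rewrite iterD e.
move=> m hm; case: (ltnP m n) => [|nm]; first exact: H.
by rewrite -(subnK nm) iterD e; apply: H'; rewrite ltn_subLR // addnC.
Qed.
Lemma reach_step_pos x y : P x -> reach (f x) y ->
  exists n, [/\ 0 < n, iter n f x = y & forall m, m < n -> P (iter m f x)].
Proof.
move=> Px [n [e H]]; exists n.+1; split=> //; first by rewrite iterSr.
by case=> // m hm; rewrite iterSr; apply: H.
Qed.
End Reach.
(* Column [j] of the simulated tapes is kept in cells [j * K, .., j * K + K - 1], and the
   physical head marks the simulated one, so a limit stage leaves no stale marker.  At a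
   limit the machine halts at once if [h] holds of cell 0. *)
Section Compress.
Variables (k : nat) (M : amach k.+1) (h : bool -> bool).
Notation K := k.+1.
(** One simulated step reads a column from left to right, collecting it in [v]; makes one step back
    ([StWrite] with [None]); writes the new column from right to left; and moves on by a whole
    column. *)
Definition onetape_st : finType :=
  (((ast M * col K * 'I_K) + (ast M * bool * col K * option 'I_K)) +
   ((ast M * bool * 'I_K) + option bool))%type.
Definition StRead s v i : onetape_st := inl (inl (s, v, i)).
Definition StWrite q mv w o : onetape_st := inl (inr (q, mv, w, o)).
Definition StMove q mv n : onetape_st := inr (inl (q, mv, n)).
Definition StHalt : onetape_st := inr (inr None).
Definition StStart : onetape_st := inr (inr (Some true)).
Definition StLim : onetape_st := inr (inr (Some false)).
Definition col0 : col K := [ffun=> false].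
Definition cbit (b : bool) : col 1 := [ffun=> b].
Definition st_of q := if q == ah M then StHalt else StRead q col0 ord0.
Definition st_move q mv n := if n == 0 then st_of q else StMove q mv (inord n).
Definition read_next s (v : col K) (i : 'I_K) b : col 1 * bool * onetape_st :=
  let v' := [ffun x => if x == i then b else v x] in
  if i.+1 < K then (cbit b, true, StRead s v' (inord i.+1))
  else let: (w, mv, q) := adl s v' in (cbit b, true, StWrite q mv w None).
Definition onetape_delta (s : onetape_st) (r : col 1) : col 1 * bool * onetape_st :=
  let b := r ord0 in
  match s with
  | inl (inl (s, v, i)) => read_next s v i b
  | inl (inr (q, mv, w, None)) => (cbit b, false, StWrite q mv w (Some ord_max))
  | inl (inr (q, mv, w, Some i)) =>
      if val i == 0 then (cbit (w i), mv, st_move q mv k)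
      else (cbit (w i), false, StWrite q mv w (Some (inord i.-1)))
  | inr (inl (q, mv, n)) => (cbit b, mv, st_move q mv n.-1)
  | inr (inr None) => (cbit b, false, StHalt)
  | inr (inr (Some true)) => read_next (a0 M) col0 ord0 b
  | inr (inr (Some false)) => if h b then (cbit b, false, StHalt) else read_next (al M) col0 ord0 b
  end.
Lemma cdist : [&& StStart != StHalt, StStart != StLim & StHalt != StLim]. Proof. by []. Qed.
Definition onetape : amach 1 := AMach cdist onetape_delta.
Notation cstep := (@astep 1 onetape).

Lemma cb_id (tp : 'I_1 -> nat -> bool) hd : wrc tp hd (cbit (tp ord0 hd)) = tp.
Proof.
apply: funext => i; apply: funext => j; rewrite /wrc (ord1 i); case: eqP => // ->; by rewrite ffunE.
Qed.

Lemma cstepE s hd tp : s != StHalt -> cstep (s, hd, tp) =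
  let: (w, mv, q) := onetape_delta s (rdc tp hd) in (q, mvh mv hd, wrc tp hd w).
Proof. by move=> /negbTE sh; rewrite /astep /= sh. Qed.

Lemma cstep_keep s hd tp mv q : s != StHalt ->
  onetape_delta s (rdc tp hd) = (cbit (tp ord0 hd), mv, q) -> cstep (s, hd, tp) = (q, mvh mv hd, tp).
Proof. by move=> sh e; rewrite cstepE // e cb_id. Qed.

Section Macro.
Variables (P : aconf onetape -> Prop) (j : nat).

Lemma rd_phase s tp i v w mv q :
  (forall st hd, st != StHalt -> P (st, hd, tp)) ->
  i < K -> v = [ffun x : 'I_K => (x < i) && tp ord0 (j * K + x)] ->
  adl s [ffun x : 'I_K => tp ord0 (j * K + x)] = (w, mv, q) ->
  reach cstep P (StRead s v (inord i), j * K + i, tp) (StWrite q mv w None, j * K + K, tp).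
Proof.
move=> HP; move e : (k - i) => d; elim: d i e v => [|d IH] i e v iK ev ea.
  have ei : i = k by move/eqP: e; rewrite subn_eq0 => ki; apply/eqP; rewrite eqn_leq ki -ltnS iK.
  apply: reach_step; first exact: HP.
  rewrite (@cstep_keep _ _ _ true (StWrite q mv w None)) //.
    by rewrite /mvh -addnS ei; apply: reach_refl.
  rewrite /= /read_next inordK //; have -> : (i.+1 < K) = false by rewrite ei ltnn.
  rewrite ffunE.
  suff -> : [ffun x => if x == inord i then tp ord0 (j * K + i) else v x] =
            [ffun x : 'I_K => tp ord0 (j * K + x)] by rewrite ea.
  apply/ffunP => x; rewrite ev !ffunE; case: eqP => [->|ne]; first by rewrite inordK.
  suff -> : x < i by [].
  have := ltn_ord x; rewrite ltnS leq_eqVlt => /orP[/eqP ex|]; last by rewrite ei.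
  by case: ne; apply: val_inj; rewrite /= inordK // ei.
have iK1 : i.+1 < K by rewrite ltnS -subn_gt0 e.
apply: reach_step; first exact: HP.
rewrite (@cstep_keep _ _ _ true (StRead s [ffun x : 'I_K => (x < i.+1) && tp ord0 (j * K + x)] (inord i.+1))) //.
  rewrite /mvh -addnS; apply: IH => //; by rewrite subnS e.
rewrite /= /read_next inordK // iK1 ffunE; congr (_, _, StRead _ _ _).
apply/ffunP => x; rewrite ev !ffunE; case: eqP => [->|ne]; first by rewrite inordK // ltnSn.
rewrite ltnS [X in _ = X && _]leq_eqVlt; case: eqP => //= ex.
by case: ne; apply: val_inj; rewrite /= inordK.
Qed.

Definition written (w : col K) (tp : 'I_1 -> nat -> bool) i : 'I_1 -> nat -> bool :=
  fun _ c => if (c %/ K == j) && (c %% K <= i) then w (inord (c %% K)) else tp ord0 c.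

(** Each cell of the column is overwritten once, so it passes directly from its old to its new
    value. That is the form in which [P] is required here. *)
Lemma wr_phase w mv q tp i : i < K ->
  (forall st hd tp', st != StHalt ->
     (forall c, tp' ord0 c = tp ord0 c \/ tp' ord0 c = written w tp i ord0 c) -> P (st, hd, tp')) ->
  reach cstep P (StWrite q mv w (Some (inord i)), j * K + i, tp)
    (st_move q mv k, mvh mv (j * K), written w tp i).
Proof.
elim: i tp => [|i IH] tp iK HP.
  apply: reach_step; first by apply: HP => // c; left.
  rewrite cstepE //= inordK //= addn0.
  suff -> : wrc tp (j * K) (cbit (w (inord 0))) = written w tp 0 by apply: reach_refl.
  apply: funext => x; apply: funext => c; rewrite (ord1 x) /wrc /written ffunE leqn0.
  have -> : (c == j * K) = (c %/ K == j) && (c %% K == 0).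
    apply/eqP/andP => [->|[/eqP e1 /eqP e2]]; first by rewrite mulnK // modnMl.
    by rewrite (divn_eq c K) e1 e2 addn0.
  by case: ifP => // /andP[_ /eqP->].
apply: reach_step; first by apply: HP => // c; left.
rewrite cstepE //= inordK //= addnS /mvh /=.
set tp1 := wrc tp _ _.
have E c : tp1 ord0 c = if (c %/ K == j) && (c %% K == i.+1) then w (inord (c %% K)) else tp ord0 c.
  rewrite /tp1 /wrc ffunE -addnS.
  have -> : (c == j * K + i.+1) = (c %/ K == j) && (c %% K == i.+1).
    apply/eqP/andP => [->|[/eqP e1 /eqP e2]]; last by rewrite {1}(divn_eq c K) e1 e2.
    by rewrite divnMDl // divn_small // addn0 modnMDl modn_small.
  by case: ifP => // /andP[_ /eqP->].
have E1 : written w tp i.+1 = written w tp1 i.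
  apply: funext => x; apply: funext => c; rewrite /written E; case: (c %/ K == j) => //=.
  by rewrite leq_eqVlt ltnS; case: eqP => [->|] //=; rewrite ltnn.
rewrite E1; apply: IH => [|st hd tp' sh H]; first exact: ltnW.
apply: HP => // c; rewrite E1; case: (H c) => ->; last by right.
case e0 : ((c %/ K == j) && (c %% K == i.+1)); last by left; rewrite E e0.
by right; rewrite /written; case/andP: e0 => -> /eqP->; rewrite ltnn.
Qed.

Lemma mv_phase q mv n hd tp : n <= k ->
  (forall st hd, st != StHalt -> P (st, hd, tp)) ->
  reach cstep P (st_move q mv n, hd, tp) (st_of q, iter n (mvh mv) hd, tp).
Proof.
move=> nk HP; elim: n hd nk => [|n IH] hd nk; first exact: reach_refl.
rewrite [st_move _ _ n.+1]/st_move /=; apply: reach_step; first exact: HP.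
rewrite (@cstep_keep _ _ _ mv (st_move q mv n)) //; last by rewrite /= inordK // ffunE.
by rewrite -iterS iterSr; apply: IH; apply: ltnW.
Qed.
End Macro.

Definition onetape_enc (tp : 'I_K -> nat -> bool) (tp1 : 'I_1 -> nat -> bool) :=
  forall (i : 'I_K) c, tp1 ord0 (c * K + i) = tp i c.

(** Of these [K] moves, the last write makes one and [st_move] the other [k]. At column 0 the left
    edge absorbs the moves in both machines, so the edge needs no test. *)
Lemma iter_mvh mv j : iter K (mvh mv) (j * K) = mvh mv j * K.
Proof.
case: mv => /=.
  have E n x : iter n (mvh true) x = x + n by elim: n => [|n /= ->]; rewrite ?addn0 ?addnS.
  by rewrite -/(iter K (mvh true) _) -iterS E mulSn addnC.
have E n x : iter n (mvh false) x = x - n by elim: n => [|n /= ->]; rewrite ?subn0 ?subnS.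
by rewrite -/(iter K (mvh false) _) -iterS E; case: j => [|j]; rewrite ?sub0n //= mulSn addKn.
Qed.

(** The first alternative holds between simulated steps, the others at the start and at a limit,
    where a single fixed state stands for the beginning of a read. The limit case excludes [h],
    which would halt the simulator. *)
Definition onetape_rel (c1 : aconf M) (c2 : aconf onetape) :=
  onetape_enc c1.2 c2.2 /\
  ((c2.1.2 = c1.1.2 * K /\ c2.1.1 = st_of c1.1.1) \/
   (c1.1.2 = 0 /\ c2.1.2 = 0 /\
    ((c1.1.1 = a0 M /\ c2.1.1 = StStart) \/
     (c1.1.1 = al M /\ c2.1.1 = StLim /\ ~~ h (c1.2 ord0 0))))).

(** The condition between two simulated steps: every encoded cell is old or new, and the simulator
    does not halt before [M] does. *)
Definition onetape_mid (c1 : aconf M) (c2 : aconf onetape) :=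
  (forall (i : 'I_K) c, c2.2 ord0 (c * K + i) = c1.2 i c \/ c2.2 ord0 (c * K + i) = (astep c1).2 i c) /\
  (c1.1.1 <> ah M -> c2.1.1 != StHalt).

(** The state [st] need only act like the beginning of a read, so that [StStart], [StLim] and
    ordinary states are treated together. *)
Lemma comp_macro s j tp tp1 st : s <> ah M -> onetape_enc tp tp1 -> st != StHalt ->
  cstep (st, j * K, tp1) = cstep (StRead s col0 ord0, j * K, tp1) ->
  exists n, [/\ 0 < n, onetape_rel (astep (s, j, tp)) (iter n cstep (st, j * K, tp1)) &
     forall m, m < n -> onetape_mid (s, j, tp) (iter m cstep (st, j * K, tp1))].
Proof.
move=> sh E sth e.
have sE : astep (s, j, tp) = astep1 (s, j, tp) by rewrite /astep /=; case: eqP.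
case ea : (adl s (rdc tp j)) => [[w mv] q].
have ea' : adl s [ffun x : 'I_K => tp1 ord0 (j * K + x)] = (w, mv, q).
  by rewrite -ea; congr adl; apply/ffunP => x; rewrite !ffunE E.
have E' : onetape_enc (wrc tp j w) (written j w tp1 k).
  move=> i c; rewrite /written divnMDl // divn_small // addn0 modnMDl modn_small // E /wrc.
  by case: eqP => //= _; rewrite -ltnS ltn_ord inord_val.
have HP st' hd tp' : st' != StHalt ->
   (forall c, tp' ord0 c = tp1 ord0 c \/ tp' ord0 c = written j w tp1 k ord0 c) -> onetape_mid (s, j, tp) (st', hd, tp').
  move=> h1 h2; split=> //= i c; rewrite sE /astep1 /= ea /= -E' -E; exact: h2.
have HP1 st' hd : st' != StHalt -> onetape_mid (s, j, tp) (st', hd, tp1) by move=> ?; apply: HP => // c; left.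
have HP2 st' hd : st' != StHalt -> onetape_mid (s, j, tp) (st', hd, written j w tp1 k) by move=> ?; apply: HP => // c; right.
have R : reach cstep (onetape_mid (s, j, tp)) (StWrite q mv w None, j * K + K, tp1) (st_of q, mvh mv j * K, written j w tp1 k).
  apply: reach_step; first exact: HP1.
  rewrite (@cstep_keep _ _ _ false (StWrite q mv w (Some ord_max))) //=; last by rewrite ffunE.
  rewrite addnS /=; have -> : ord_max = inord k :> 'I_K by apply: val_inj; rewrite /= inordK.
  apply: reach_trans; first by apply: wr_phase.
  by rewrite -iter_mvh iterSr; apply: mv_phase.
have Hst : onetape_mid (s, j, tp) (st, j * K, tp1) by apply: HP1.
have := (@rd_phase (onetape_mid (s, j, tp)) j s tp1 0 col0 w mv q HP1 isT); rewrite addn0.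
have -> : inord 0 = ord0 :> 'I_K by apply: val_inj; rewrite /= inordK.
case=> [|//|[|n] [//= R1 R2]]; first by apply/ffunP => x; rewrite !ffunE.
have := reach_step_pos (f := cstep) (P := onetape_mid (s, j, tp)) (y := (st_of q, mvh mv j * K, written j w tp1 k)) Hst.
case.
  rewrite e; apply: reach_trans R; exists n; rewrite -iterSr; split=> // m hm.
  by rewrite -iterSr; apply: R2.
move=> N [N0 e1 H]; exists N; split=> //; rewrite e1 sE /astep1 /= ea /=; split=> //=; by left.
Qed.

Lemma crel_step c1 c2 : onetape_rel c1 c2 -> exists n, [/\ 0 < n,
  onetape_rel (astep c1) (iter n cstep c2) & forall m, m < n -> onetape_mid c1 (iter m cstep c2)].
Proof.
case: c1 c2 => [[s j] tp] [[st hd] tp1] [/= E [[-> ->]|[-> [->]]]].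
  rewrite /st_of; case: eqP => [e|ne]; last by apply: comp_macro.
  exists 1; have eA : astep (s, j, tp) = (s, j, tp) by rewrite /astep /= e eqxx.
  have eC : cstep (StHalt, j * K, tp1) = (StHalt, j * K, tp1) by [].
  split=> //=; first by rewrite eA eC; split=> //=; left; rewrite /st_of e eqxx.
  by case=> // _; split=> //= i c; left.
case=> [[-> ->]|[-> [-> hh]]]; rewrite -[X in (_, X, _)](mul0n K); apply: comp_macro => //.
- by apply/eqP; rewrite ah0.
- by apply/eqP; rewrite ahl.
- rewrite !cstepE //= ffunE mul0n -(E ord0 0) mul0n addn0 in hh *.
  by rewrite (negbTE hh).
Qed.

Section Comp.
Variables (T : stages) (z : wcar T).
Hypothesis hz : lz z.
Notation r1 := (run (asys M) z).
Notation r2 := (run (asys onetape) z).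
Definition quiet (t : wcar T) := forall l, lz l -> z <! l -> l <! t -> ~~ h (amem (r1 l) (ord0, 0)).

Lemma comp_block l : lz l -> z <=! l -> onetape_rel (r1 l) (r2 l) ->
  (forall i c, bsim (fun n => amem (r1 (add l n)) (i, c)) (fun n => amem (r2 (add l n)) (ord0, c * K + i)) /\
     forall m, exists n, amem (r2 (add l m)) (ord0, c * K + i) = amem (r1 (add l n)) (i, c)) /\
  (forall m, (forall n, stt M z (add l n) <> ah M) -> stt onetape z (add l m) <> ah onetape) /\
  (forall n, stt M z (add l n) = ah M -> exists m, stt onetape z (add l m) = ah onetape).
Proof.
move=> hl zl Rl; have [tau [t1 t2 t3]] := iter_msim (f1 := @astep _ M) (f2 := cstep) crel_step Rl.
have A n : iter n (@astep _ M) (r1 l) = r1 (add l n) by rewrite run_add.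
have B n : iter n cstep (r2 l) = r2 (add l n) by rewrite run_add.
split; [|split].
- move=> i c; apply: (tau_bsim t1) => n.
    by have [h1 _] := t2 n; rewrite -A -B; apply: h1.
  have [n' hn [h1 _]] := t3 n; exists n' => //; rewrite -!A -!B /=; exact: h1.
- move=> m Hn; have [n _ [_ h1]] := t3 m; apply/eqP; rewrite /stt -B; apply: h1.
  by rewrite A; apply: Hn.
- move=> n e; exists (tau n); have [_] := t2 n; rewrite A B /stt.
  by move: e; rewrite /stt => -> [[_ ->]|[_ [_ [[e _]|[e _]]]]];
    rewrite /st_of ?eqxx //; move/eqP: e; rewrite eq_sym ?ah0 ?ahl.
Qed.

(** Induction over limits: agreement at the start of each earlier block gives [onetape_rel] there,
    hence [bsim] of all cells inside the block, and [limsup_sim] carries the agreement to [t]. *)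
Lemma comp_enc t : lz t -> z <=! t -> quiet t -> onetape_enc (r1 t).2 (r2 t).2.
Proof.
move=> ht zt; elim/(well_founded_ind (@wlt_wf T)): t ht zt => t IH ht [zt|<-] qt; last by rewrite !run_z.
move=> i c; rewrite -[LHS]/(amem (r2 t) (ord0, c * K + i)) -[RHS]/(amem (r1 t) (i, c)).
have C l : lz l -> z <=! l -> l <! t -> onetape_rel (r1 l) (r2 l).
  move=> hl zl lt; have E := IH l lt hl zl (fun l' a b d => qt l' a b (slt_trans d lt)).
  split=> //; right; case: zl => [zl|<-]; last by rewrite !run_z; split=> //; split=> //; left.
  have qh := qt l hl zl lt; move: qh; rewrite !run_lim // => qh; split=> //; split=> //; by right.
rewrite !amem_lim //; symmetry; apply: (limsup_sim hz ht zt) => [l hl zl lt|l m hl zl lt].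
  by have [/(_ i c)[]] := comp_block hl zl (C l hl zl lt).
have zl' : z <=! l by left.
by have [/(_ i c)[_ /(_ m)]] := comp_block hl zl' (C l hl zl' lt).
Qed.

Lemma comp_rel l : lz l -> z <=! l -> quiet (sc l) -> onetape_rel (r1 l) (r2 l).
Proof.
move=> hl zl ql.
have ql' : quiet l by move=> l' a b c; apply: ql => //; apply: slt_trans c (sc_gt _).
have E := comp_enc hl zl ql'.
split=> //; right; case: zl => [zl|<-]; last by rewrite !run_z; split=> //; split=> //; left.
have qh := ql l hl zl (sc_gt l); move: qh; rewrite !run_lim // => qh; split=> //; split=> //; by right.
Qed.

Lemma comp_nohalt u t : lz t -> z <=! u -> u <! t -> quiet t ->
  (forall s, z <=! s -> s <! t -> stt M z s <> ah M) -> stt onetape z u <> ah onetape.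
Proof.
move=> ht; have [l [n [hl ->]]] := decomp u => zu ut q H.
have zl : z <=! l by apply: (@blk_le _ _ _ n).
have lt : l <! t by apply: sle_lt_trans ut; apply: add_ge.
have ql : quiet (sc l) by move=> l' a b /sc_lt c; apply: q => //; apply: sle_lt_trans lt.
have [_ [B _]] := comp_block hl zl (comp_rel hl zl ql); apply: B => m.
by apply: H; [apply: sle_trans zl (add_ge _ _)|apply: lz_add].
Qed.

Lemma comp_flag t : lz t -> z <! t -> quiet t -> h (amem (r1 t) (ord0, 0)) ->
  (forall s, z <=! s -> s <! t -> stt M z s <> ah M) -> halts onetape z (sc t).
Proof.
move=> ht zt qt ht1 H; split; first by apply: sle_trans (sltW zt) (sltW (sc_gt t)).
split; last first.
  move=> s zs /sc_lt[st|->]; first exact: (comp_nohalt ht).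
  by rewrite /stt run_lim.
have E := comp_enc ht (sltW zt) qt.
rewrite /stt run_sc; last by left.
have e : (r2 t).1 = (StLim, 0) by rewrite run_lim.
move: E; rewrite [r2 t]surjective_pairing e => E; rewrite /= cstepE //= ffunE.
have -> : (r2 t).2 ord0 0 = amem (r1 t) (ord0, 0) by have := E ord0 0; rewrite mul0n.
by rewrite ht1.
Qed.

(** Halting moves from [n] to some [m] but stays in its block. This makes the presence of a
    clockable stage in a block independent of the number of tapes. *)
Lemma comp_halts l n : (forall b, ~~ h b) -> lz l -> halts M z (add l n) ->
  exists m, halts onetape z (add l m).
Proof.
move=> hh hl [a [b c]].
have zl : z <=! l by apply: (@blk_le _ _ _ n).
have q t : quiet t by move=> *; apply: hh.
have [_ [_ /(_ n b)[m0 e0]]] := comp_block hl zl (comp_rel hl zl (q _)).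
have ex : exists m, stt onetape z (add l m) == ah onetape by exists m0; apply/eqP.
case: (ex_minnP ex) => m /eqP e hm; exists m; split; first exact: sle_trans zl (add_ge _ _).
split=> // s zs sm; have [sl|ls] := slt_or s l.
  by apply: (comp_nohalt hl) => // s' zs' sl'; apply: c => //; apply: slt_le_trans sl' (add_ge _ _).
have [j ej /andP[_ jm]] := @blk_le_lt _ l l s 0 m erefl hl ls sm.
by rewrite ej => /eqP /hm; rewrite leqNgt jm.
Qed.
End Comp.
End Compress.

(** * Counter programs with a bit memory *)

(** Cantor pairing. Its inverse [unp] counts along the antidiagonals by [nnext], a form that a
    counter program can execute. *)
Definition npair a b := 'C((a + b).+1, 2) + b.
Definition nnext (x : nat * nat) := if x.1 is a.+1 then (a, x.2.+1) else (x.2.+1, 0).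
Definition unp n := iter n nnext (0, 0).
Definition nfst n := (unp n).1.
Definition nsnd n := (unp n).2.

Lemma npair_next x : npair (nnext x).1 (nnext x).2 = (npair x.1 x.2).+1.
Proof.
case: x => [[|a] b]; rewrite /npair /=; first by rewrite addn0 add0n binS bin1 addn0 addnS addnC.
by rewrite addnS addSn addnS.
Qed.
Lemma npair_unp n : npair (nfst n) (nsnd n) = n.
Proof. by elim: n => // n IH; rewrite /nfst /nsnd /= npair_next IH. Qed.
Lemma unp_npair a b : unp (npair a b) = (a, b).
Proof.
move e : (npair a b) => n; elim: n a b e => [|n IH] a b e.
  move: e; rewrite /npair => /eqP; rewrite addn_eq0 => /andP[h /eqP b0]; subst b.
  move: h; rewrite addn0; case: a => // a; by rewrite -leqn0 leqNgt bin_gt0.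
case: b e => [|b] e.
  case: a e => [//|a] e; rewrite /= (IH 0 a) //.
  by apply: succn_inj; rewrite -e -(npair_next (0, a)).
rewrite /= (IH a.+1 b) //; by apply: succn_inj; rewrite -e -(npair_next (a.+1, b)).
Qed.
Lemma nfstE a b : nfst (npair a b) = a. Proof. by rewrite /nfst unp_npair. Qed.
Lemma nsndE a b : nsnd (npair a b) = b. Proof. by rewrite /nsnd unp_npair. Qed.
Lemma npair_inj a b c d : npair a b = npair c d -> a = c /\ b = d.
Proof. by move=> e; have := unp_npair a b; rewrite e unp_npair => -[-> ->]. Qed.
Lemma npair_eq a b c d : (npair a b == npair c d) = (a == c) && (b == d).
Proof. by apply/eqP/andP => [/npair_inj[-> ->]|[/eqP-> /eqP->]]; rewrite ?eqxx. Qed.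
Lemma npair_ge a b : a <= npair a b /\ b <= npair a b.
Proof.
split; last exact: leq_addl.
rewrite /npair binS bin1; lia.
Qed.
Lemma nfst_le n : nfst n <= n.
Proof. by rewrite -{2}(npair_unp n); case: (npair_ge (nfst n) (nsnd n)). Qed.
Lemma nsnd_le n : nsnd n <= n.
Proof. by rewrite -{2}(npair_unp n); case: (npair_ge (nfst n) (nsnd n)). Qed.
(** By this and the next lemma the boot states at the start and at a limit have the codes 0 and 1,
    which a machine can put into a register in one step. *)
Lemma npair00 : npair 0 0 = 0. Proof. by []. Qed.
Lemma npair10 : npair 1 0 = 1. Proof. by []. Qed.
Lemma nfst0 : nfst 0 = 0. Proof. by []. Qed.
Lemma nsnd0 : nsnd 0 = 0. Proof. by []. Qed.

(** A language of total functions on codes. The transition function of the searcher is expressed in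
    it and compiled, rather than programmed with counters by hand. *)
Inductive fn := Fid | Fzero | Fsucc | Fpred | Ffst | Fsnd | Fpair of fn & fn
  | Fcomp of fn & fn | Fiter of fn | Fif of fn & fn & fn.

Fixpoint den (f : fn) (x : nat) : nat :=
  match f with
  | Fid => x | Fzero => 0 | Fsucc => x.+1 | Fpred => x.-1
  | Ffst => nfst x | Fsnd => nsnd x
  | Fpair f g => npair (den f x) (den g x)
  | Fcomp f g => den f (den g x)
  | Fiter f => iter (nfst x) (den f) (nsnd x)
  | Fif c f g => if den c x == 0 then den f x else den g x
  end.

(* [CLoop k] and the second branch of [CIf k] decrement register [k] first; [CRd k] and
   [CWr k] access the bit whose address is in register [k]. *)
Inductive cmd := CSkip | CInc of nat | CDec of nat | CWr of nat & bool
  | CSeq of cmd & cmd | CLoop of nat & cmd | CIf of nat & cmd & cmd | CRd of nat & cmd & cmd.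

Inductive action := AInc of nat | ADjz of nat | ARd of nat | AWr of nat & bool.

(* Control points of a command; [nxt] returns [None] on leaving the command. *)
Fixpoint nodes (c : cmd) : finType :=
  match c with
  | CSkip | CInc _ | CDec _ | CWr _ _ => unit
  | CSeq a b => (nodes a + nodes b)%type
  | CLoop _ a => option (nodes a)
  | CIf _ a b | CRd _ a b => option (nodes a + nodes b)
  end.

Fixpoint entry c : nodes c :=
  match c with
  | CSkip | CInc _ | CDec _ | CWr _ _ => tt
  | CSeq a b => inl (entry a)
  | CLoop _ a => None
  | CIf _ a b | CRd _ a b => None
  end.

Fixpoint act c : nodes c -> action :=
  match c with
  | CSkip => fun=> ARd 0
  | CInc k => fun=> AInc k
  | CDec k => fun=> ADjz k
  | CWr k b => fun=> AWr k b
  | CSeq a b => fun n => match n with inl n => act n | inr n => act n end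
  | CLoop k a => fun n => if n is Some n then act n else ADjz k
  | CIf k a b => fun n => match n with Some (inl n) => act n | Some (inr n) => act n | None => ADjz k end
  | CRd k a b => fun n => match n with Some (inl n) => act n | Some (inr n) => act n | None => ARd k end
  end.

Definition obnd A B (o : option A) (g : A -> B) (d : option B) : option B :=
  if o is Some x then Some (g x) else d.

Fixpoint nxt c : nodes c -> bool -> option (nodes c) :=
  match c with
  | CSkip | CInc _ | CDec _ | CWr _ _ => fun _ _ => None
  | CSeq a b => fun n t => match n with
      | inl n => obnd (nxt n t) inl (Some (inr (entry b)))
      | inr n => obnd (nxt n t) inr None end
  | CLoop k a => fun n t => match n with
      | Some n => obnd (nxt n t) Some (Some None)
      | None => if t then Some (Some (entry a)) else None end
  | CIf k a b => fun n t => match n with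
      | Some (inl n) => obnd (nxt n t) (fun x => Some (inl x)) None
      | Some (inr n) => obnd (nxt n t) (fun x => Some (inr x)) None
      | None => Some (Some (if t then inr (entry b) else inl (entry a))) end
  | CRd k a b => fun n t => match n with
      | Some (inl n) => obnd (nxt n t) (fun x => Some (inl x)) None
      | Some (inr n) => obnd (nxt n t) (fun x => Some (inr x)) None
      | None => Some (Some (if t then inr (entry b) else inl (entry a))) end
  end.

Definition upd A (f : nat -> A) k v : nat -> A := fun j => if j == k then v else f j.
Definition store := ((nat -> nat) * (nat -> bool))%type.
Definition doact (a : action) (s : store) : store * bool :=
  match a with
  | AInc k => ((upd s.1 k (s.1 k).+1, s.2), false)
  | ADjz k => ((upd s.1 k (s.1 k).-1, s.2), s.1 k != 0)
  | ARd k => (s, s.2 (s.1 k))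
  | AWr k b => ((s.1, upd s.2 (s.1 k) b), false)
  end.

Definition nstep c (x : option (nodes c) * store) :=
  if x.1 is Some n then
    let r := doact (act n) x.2 in (nxt n r.2, r.1)
  else x.

Lemma updE A (f : nat -> A) k v j : upd f k v j = if j == k then v else f j. Proof. by []. Qed.
Lemma upd_id A (f : nat -> A) k : upd f k (f k) = f.
Proof. by apply: funext => j; rewrite /upd; case: eqP => // ->. Qed.

Lemma upd_dec0 (s : store) k : s.1 k = 0 -> (upd s.1 k (s.1 k).-1, s.2) = s.
Proof. by case: s => s1 s2 /= e; rewrite e /= -[X in upd s1 k X]e upd_id. Qed.

Section Rules.
Variable P : (nat -> bool) -> Prop.
(** [P] constrains the bit memory during the run. It is later taken to say that each bit has its
    value before or after the abstract step. *)
Definition crun c s s' :=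
  reach (@nstep c) (fun x => P x.2.2) (Some (entry c), s) (None, s').

Lemma lift_run a c (g : nodes a -> nodes c) kk n s s' :
  (forall n, act (g n) = act n) ->
  (forall n t, nxt (g n) t = obnd (nxt n t) g kk) ->
  reach (@nstep a) (fun x => P x.2.2) (Some n, s) (None, s') ->
  reach (@nstep c) (fun x => P x.2.2) (Some (g n), s) (kk, s').
Proof.
move=> H1 H2 [N [e H]]; elim: N n s e H => [//|N IH] n s.
rewrite iterSr => e H; apply: reach_step; first exact: (H 0).
have E : nstep (Some (g n), s) = (obnd (nstep (Some n, s)).1 g kk, (nstep (Some n, s)).2).
  by rewrite /nstep /= H1 H2.
rewrite E; case e1 : (nstep (Some n, s)) => [[n'|] s1] /=.
  apply: IH; first by rewrite -e1.
  by move=> m hm; have := H m.+1 hm; rewrite iterSr e1.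
have F m x : iter m (@nstep a) (None, x) = (None, x) by elim: m => //= m ->.
by move: e; rewrite e1 F => -[->]; apply: reach_refl.
Qed.

Lemma run1 c s : P s.2 -> (nxt (entry c) (doact (act (entry c)) s).2 = None) ->
  crun c s (doact (act (entry c)) s).1.
Proof.
move=> h e; apply: reach_step => //; rewrite /nstep /= e; exact: reach_refl.
Qed.
Lemma run_seq a b s s1 s' : crun a s s1 -> crun b s1 s' -> crun (CSeq a b) s s'.
Proof.
move=> h1 h2; apply: reach_trans; first exact: (@lift_run a (CSeq a b) inl (Some (inr (entry b)))) h1.
exact: (@lift_run b (CSeq a b) inr None).
Qed.
Lemma run_loop0 k a s : P s.2 -> s.1 k = 0 -> crun (CLoop k a) s s.
Proof.
move=> h e; apply: reach_step => //; rewrite /nstep /= upd_dec0 // e; exact: reach_refl.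
Qed.
Lemma run_loopS k a s n s1 s' : P s.2 -> s.1 k = n.+1 -> crun a (upd s.1 k n, s.2) s1 ->
  crun (CLoop k a) s1 s' -> crun (CLoop k a) s s'.
Proof.
move=> h e h1 h2; apply: reach_step => //; rewrite /nstep /= e /=.
apply: reach_trans h2; exact: (@lift_run a (CLoop k a) Some (Some None)).
Qed.
Lemma run_if0 k a b s s' : P s.2 -> s.1 k = 0 -> crun a s s' -> crun (CIf k a b) s s'.
Proof.
move=> h e h1; apply: reach_step => //; rewrite /nstep /= upd_dec0 // e /=.
exact: (@lift_run a (CIf k a b) (fun x => Some (inl x)) None).
Qed.
Lemma run_ifS k a b s n s' : P s.2 -> s.1 k = n.+1 -> crun b (upd s.1 k n, s.2) s' ->
  crun (CIf k a b) s s'.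
Proof.
move=> h e h1; apply: reach_step => //; rewrite /nstep /= e /=.
exact: (@lift_run b (CIf k a b) (fun x => Some (inr x)) None).
Qed.
Lemma run_rd k a b s s' : P s.2 ->
  crun (if s.2 (s.1 k) then b else a) s s' -> crun (CRd k a b) s s'.
Proof.
move=> h h1; apply: reach_step => //; rewrite /nstep /=; move: h1; case: ifP => _ h1.
  exact: (@lift_run b (CRd k a b) (fun x => Some (inr x)) None).
exact: (@lift_run a (CRd k a b) (fun x => Some (inl x)) None).
Qed.
End Rules.

(** For commands on registers only: the memory never changes, so every [P] true of it persists. *)
Definition pure_exec c r r' := forall (P : (nat -> bool) -> Prop) M, P M -> crun P c (r, M) (r', M).

Lemma px_skip r : pure_exec CSkip r r. Proof. by move=> P M h; apply: (@run1 P CSkip (r, M)). Qed.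
Lemma px_inc k r : pure_exec (CInc k) r (upd r k (r k).+1).
Proof. by move=> P M h; apply: (@run1 P (CInc k) (r, M)). Qed.
Lemma px_dec k r : pure_exec (CDec k) r (upd r k (r k).-1).
Proof. by move=> P M h; apply: (@run1 P (CDec k) (r, M)). Qed.
Lemma px_seq a b r r1 r' : pure_exec a r r1 -> pure_exec b r1 r' -> pure_exec (CSeq a b) r r'.
Proof. by move=> h1 h2 P M h; apply: run_seq (h1 P M h) (h2 P M h). Qed.
Lemma px_if0 k a b r r' : r k = 0 -> pure_exec a r r' -> pure_exec (CIf k a b) r r'.
Proof. by move=> e h1 P M h; apply: run_if0 => //; apply: h1. Qed.
Lemma px_ifS k a b r n r' : r k = n.+1 -> pure_exec b (upd r k n) r' -> pure_exec (CIf k a b) r r'.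
Proof. by move=> e h1 P M h; apply: run_ifS => //; [exact: e|apply: h1]. Qed.
Lemma px_loop k a (F : nat -> nat -> nat) N :
  (forall n, n <= N -> F n k = n) ->
  (forall n, n < N -> pure_exec a (upd (F n.+1) k n) (F n)) -> pure_exec (CLoop k a) (F N) (F 0).
Proof.
move=> Fk Fs; elim: N Fk Fs => [|N IH] Fk Fs P M h.
  by apply: run_loop0 => //; apply: Fk.
apply: (run_loopS (n := N) (s1 := (F N, M))) => //; first exact: Fk.
  exact: Fs.
apply: IH => // n hn; [apply: Fk|apply: Fs]; exact: leqW.
Qed.

Ltac fx := apply: funext => ?; rewrite /upd; repeat (case: eqP => ?; subst => //=); try lia.

Definition clear_reg k := CLoop k CSkip.
Lemma px_clr k r : pure_exec (clear_reg k) r (upd r k 0).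
Proof.
have := @px_loop k CSkip (fun n => upd r k n) (r k); rewrite upd_id; apply=> n hn.
  by rewrite /upd eqxx.
have -> : upd (upd r k n.+1) k n = upd r k n by fx.
exact: px_skip.
Qed.

Definition move_reg x y := CSeq (clear_reg y) (CLoop x (CInc y)).
Lemma px_mov x y r : x != y -> pure_exec (move_reg x y) r (upd (upd r y (r x)) x 0).
Proof.
move=> xy; apply: px_seq; first exact: px_clr.
move/eqP: xy => xy; pose F n := upd (upd r y (r x - n)) x n.
have -> : upd r y 0 = F (r x) by rewrite /F; fx.
have -> : upd (upd r y (r x)) x 0 = F 0 by rewrite /F; fx.
apply: px_loop => n hn; first by rewrite /F /upd eqxx.
set r1 := upd _ x n; have -> : F n = upd r1 y (r1 y).+1 by rewrite /r1 /F; fx.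
exact: px_inc.
Qed.

Definition copy_reg x y t := CSeq (clear_reg y) (CSeq (clear_reg t)
  (CSeq (CLoop x (CSeq (CInc y) (CInc t))) (CLoop t (CInc x)))).
Lemma px_cpy x y t r : x != y -> x != t -> y != t ->
  pure_exec (copy_reg x y t) r (upd (upd r y (r x)) t 0).
Proof.
move=> /eqP xy /eqP xt /eqP yt; do 2![apply: px_seq; first exact: px_clr].
apply: (@px_seq _ _ _ (upd (upd (upd r x 0) y (r x)) t (r x))).
  pose F n := upd (upd (upd r x n) y (r x - n)) t (r x - n).
  have -> : upd (upd r y 0) t 0 = F (r x) by rewrite /F; fx.
  have -> : upd (upd (upd r x 0) y (r x)) t (r x) = F 0 by rewrite /F; fx.
  apply: px_loop => n hn; first by rewrite /F /upd; repeat case: eqP => //; lia.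
  apply: px_seq; first exact: px_inc.
  set r1 := upd _ y _; have -> : F n = upd r1 t (r1 t).+1 by rewrite /r1 /F; fx.
  exact: px_inc.
pose F n := upd (upd (upd r x (r x - n)) y (r x)) t n.
have -> : upd (upd (upd r x 0) y (r x)) t (r x) = F (r x) by rewrite /F; fx.
have -> : upd (upd r y (r x)) t 0 = F 0 by rewrite /F; fx.
apply: px_loop => n hn; first by rewrite /F /upd; repeat case: eqP => //; lia.
set r1 := upd _ t n; have -> : F n = upd r1 x (r1 x).+1 by rewrite /r1 /F; fx.
exact: px_inc.
Qed.

(** Counts [x] down and applies [nnext] to the pair in [u] and [v] each time. *)
Definition unpair_cmd x u v := CSeq (clear_reg u) (CSeq (clear_reg v)
  (CLoop x (CIf u (CSeq (CLoop v (CInc u)) (CInc u)) (CInc v)))).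
Lemma px_unpc x u v r : x != u -> x != v -> u != v ->
  pure_exec (unpair_cmd x u v) r (upd (upd (upd r x 0) u (nfst (r x))) v (nsnd (r x))).
Proof.
move=> /eqP xu /eqP xv /eqP uv; do 2![apply: px_seq; first exact: px_clr].
pose F n := upd (upd (upd r x n) u (nfst (r x - n))) v (nsnd (r x - n)).
have -> : upd (upd r u 0) v 0 = F (r x) by rewrite /F subnn; fx.
have -> : upd (upd (upd r x 0) u (nfst (r x))) v (nsnd (r x)) = F 0 by rewrite /F subn0.
apply: px_loop => n hn; first by rewrite /F /upd; repeat case: eqP => //; lia.
have e : r x - n = (r x - n.+1).+1 by lia.
have E1 : nfst (r x - n) = (nnext (nfst (r x - n.+1), nsnd (r x - n.+1))).1.
  by rewrite e /nfst /nsnd /= -surjective_pairing.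
have E2 : nsnd (r x - n) = (nnext (nfst (r x - n.+1), nsnd (r x - n.+1))).2.
  by rewrite e /nfst /nsnd /= -surjective_pairing.
rewrite /F E1 E2; set f := nfst _; set s := nsnd _.
case ef : f => [|f'] /=; last first.
  apply: (@px_ifS _ _ _ _ f'); first by rewrite /upd; repeat case: eqP => //; lia.
  set r1 := upd _ u f'; set r2 := upd _ v _.
  have -> : r2 = upd r1 v (r1 v).+1 by rewrite /r1 /r2; fx.
  exact: px_inc.
apply: px_if0; first by rewrite /upd; repeat case: eqP => //; lia.
apply: px_seq.
  pose G m := upd (upd (upd r x n) u (s - m)) v m.
  have -> : upd (upd (upd (upd r x n.+1) u 0) v s) x n = G s by rewrite /G; fx.
  apply: (@px_loop v _ G) => m hm; first by rewrite /G /upd eqxx.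
  set r1 := upd _ v m; have -> : G m = upd r1 u (r1 u).+1 by rewrite /r1 /G; fx.
  exact: px_inc.
set r1 := (X in pure_exec _ X _); set r2 := upd _ v _.
have -> : r2 = upd r1 u (r1 u).+1 by rewrite /r1 /r2; fx.
exact: px_inc.
Qed.

(** The first loop adds [v] to both [w] and [u]; the second adds the triangular number of the new
    [u], one summand per round, with [t] restoring [u] after each. *)
Definition pair_cmd u v w t := CSeq (clear_reg w) (CSeq (clear_reg t)
  (CSeq (CLoop v (CSeq (CInc w) (CInc u)))
    (CLoop u (CSeq (CInc w) (CSeq (CLoop u (CSeq (CInc w) (CInc t))) (CLoop t (CInc u))))))).
Lemma px_pairc u v w t r : uniq [:: u; v; w; t] ->
  pure_exec (pair_cmd u v w t) r (upd (upd (upd (upd r u 0) v 0) w (npair (r u) (r v))) t 0).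
Proof.
rewrite /= !inE !negb_or => /and4P[/and3P[/eqP uv /eqP uw /eqP ut] /andP[/eqP vw /eqP vt] /eqP wt _].
do 2![apply: px_seq; first exact: px_clr].
apply: px_seq.
  pose F n := upd (upd (upd (upd r v n) u (r u + (r v - n))) w (r v - n)) t 0.
  have -> : upd (upd r w 0) t 0 = F (r v) by rewrite /F; fx.
  apply: (@px_loop v _ F) => n hn; first by rewrite /F /upd; repeat case: eqP => //; lia.
  apply: px_seq; first exact: px_inc.
  set r1 := upd _ w _; have -> : F n = upd r1 u (r1 u).+1 by rewrite /r1 /F; fx.
  exact: px_inc.
(* The invariant [G] states the part of the sum computed so far by a subtraction, which by this
   bound is never truncated. *)
have B n : n <= r u + r v -> 'C((r u + r v).+1, 2) >= 'C(n.+1, 2).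
  by elim: (r u + r v) => [|m IH]; [rewrite leqn0 => /eqP->|
    rewrite leq_eqVlt ltnS => /orP[/eqP->//|/IH h]; apply: leq_trans h _; rewrite [X in _ <= X]binS leq_addr].
pose G n := upd (upd (upd (upd r u n) v 0) w (npair (r u) (r v) - 'C(n.+1, 2))) t 0.
set r1 := (X in pure_exec _ X _).
have -> : r1 = G (r u + r v) by rewrite /r1 /G /npair addKn; fx.
have -> : upd (upd (upd (upd r u 0) v 0) w (npair (r u) (r v))) t 0 = G 0 by rewrite /G subn0; fx.
apply: (@px_loop u _ G) => n hn; first by rewrite /G /upd; repeat case: eqP => //; lia.
apply: px_seq; first exact: px_inc.
pose W := npair (r u) (r v) - 'C(n.+2, 2).
have BW : npair (r u) (r v) - 'C(n.+1, 2) = W + n.+1.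
  have := B _ hn; rewrite /W /npair [in 'C(n.+2, 2)]binS bin1; lia.
apply: (@px_seq _ _ _ (upd (upd (upd (upd r u 0) v 0) w (W + n.+1)) t n)).
  pose H m := upd (upd (upd (upd r u m) v 0) w (W + (n.+1 - m))) t (n - m).
  set r2 := (X in pure_exec _ X _); have -> : r2 = H n by rewrite /r2 /G /H -/W; fx.
  have -> : upd (upd (upd (upd r u 0) v 0) w (W + n.+1)) t n = H 0 by rewrite /H !subn0.
  apply: px_loop => m hm; first by rewrite /H /upd; repeat case: eqP => //; lia.
  apply: px_seq; first exact: px_inc.
  set r3 := upd _ w _; have -> : H m = upd r3 t (r3 t).+1 by rewrite /r3 /H; fx.
  exact: px_inc.
pose H m := upd (upd (upd (upd r u (n - m)) v 0) w (W + n.+1)) t m.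
have -> : upd (upd (upd (upd r u 0) v 0) w (W + n.+1)) t n = H n by rewrite /H subnn.
have -> : G n = H 0 by rewrite /G /H BW subn0.
apply: px_loop => m hm; first by rewrite /H /upd; repeat case: eqP => //; lia.
set r3 := upd _ t m; have -> : H m = upd r3 u (r3 u).+1 by rewrite /r3 /H; fx.
exact: px_inc.
Qed.

(** Argument and result sit in register [b] and nothing below [b] is touched. A subterm can thus be
    evaluated at a higher base while the argument waits in [b]. *)
Fixpoint compile (f : fn) (b : nat) : cmd :=
  match f with
  | Fid => CSkip
  | Fzero => clear_reg b
  | Fsucc => CInc b
  | Fpred => CDec b
  | Ffst => CSeq (unpair_cmd b b.+1 b.+2) (move_reg b.+1 b)
  | Fsnd => CSeq (unpair_cmd b b.+1 b.+2) (move_reg b.+2 b)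
  | Fcomp f g => CSeq (compile g b) (compile f b)
  | Fpair f g => CSeq (copy_reg b b.+1 b.+2) (CSeq (compile g b.+1) (CSeq (copy_reg b b.+2 b.+3)
      (CSeq (compile f b.+2) (pair_cmd b.+2 b.+1 b b.+3))))
  | Fiter f => CSeq (unpair_cmd b b.+1 b.+2) (CSeq (CLoop b.+1 (compile f b.+2)) (move_reg b.+2 b))
  | Fif c f g => CSeq (copy_reg b b.+1 b.+2) (CSeq (compile c b.+1) (CIf b.+1 (compile f b) (compile g b)))
  end.

Lemma cf_spec f b r : exists r', [/\ pure_exec (compile f b) r r', r' b = den f (r b) &
  forall j, j < b -> r' j = r j].
Proof.
elim: f b r => [||||||f IHf g IHg|f IHf g IHg|f IHf|c IHc f IHf g IHg] b r /=.
- by exists r; split=> //; apply: px_skip.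
- exists (upd r b 0); split; [exact: px_clr|by rewrite /upd eqxx|].
  by move=> j jb; rewrite /upd; case: eqP => //; lia.
- exists (upd r b (r b).+1); split; [exact: px_inc|by rewrite /upd eqxx|].
  by move=> j jb; rewrite /upd; case: eqP => //; lia.
- exists (upd r b (r b).-1); split; [exact: px_dec|by rewrite /upd eqxx|].
  by move=> j jb; rewrite /upd; case: eqP => //; lia.
- eexists; split; first by apply: px_seq; [apply: px_unpc; lia|apply: px_mov; lia].
    by rewrite /upd; repeat (case: eqP => //; try lia).
  by move=> j jb; rewrite /upd; repeat (case: eqP => //; try lia).
- eexists; split; first by apply: px_seq; [apply: px_unpc; lia|apply: px_mov; lia].
    by rewrite /upd; repeat (case: eqP => //; try lia).
  by move=> j jb; rewrite /upd; repeat (case: eqP => //; try lia).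
- pose r1 := upd (upd r b.+1 (r b)) b.+2 0.
  have [r2 [h2 e2 f2]] := IHg b.+1 r1.
  pose r3 := upd (upd r2 b.+2 (r2 b)) b.+3 0.
  have [r4 [h4 e4 f4]] := IHf b.+2 r3.
  eexists; split.
  + apply: px_seq; first by apply: px_cpy; lia.
    apply: px_seq; first exact: h2.
    apply: px_seq; first by apply: px_cpy; lia.
    apply: px_seq; first exact: h4.
    by apply: px_pairc; rewrite /= !inE; lia.
  + have -> : r4 b.+2 = den f (r b).
      rewrite e4; congr den; rewrite /r3 /upd; repeat (case: eqP => //; try lia).
      by move=> *; rewrite f2 /r1 /upd; repeat (case: eqP => //; try lia).
    have -> : r4 b.+1 = den g (r b).
      rewrite f4 // /r3 /upd; repeat (case: eqP => //; try lia).
      by move=> *; rewrite e2; congr den; rewrite /r1 /upd; repeat (case: eqP => //; try lia).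
    by rewrite /upd; repeat (case: eqP => //; try lia).
  + move=> j jb; have -> : r j = r4 j.
      rewrite f4; last lia.
      rewrite /r3 /upd; repeat (case: eqP => //; try lia); move=> *.
      rewrite f2; last lia.
      by rewrite /r1 /upd; repeat (case: eqP => //; try lia).
    by rewrite /upd; repeat (case: eqP => //; try lia).
- have [r1 [h1 e1 f1]] := IHg b r; have [r2 [h2 e2 f2]] := IHf b r1.
  exists r2; split; [by apply: px_seq h1 h2|by rewrite e2 e1|by move=> j jb; rewrite f2 ?f1].
- pose r1 := upd (upd (upd r b 0) b.+1 (nfst (r b))) b.+2 (nsnd (r b)).
  have L n r2 : r2 b.+1 = n -> exists r3, [/\ pure_exec (CLoop b.+1 (compile f b.+2)) r2 r3,
     r3 b.+2 = iter n (den f) (r2 b.+2) & forall j, j < b.+1 -> r3 j = r2 j].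
    elim: n r2 => [|n IH] r2 e.
      by exists r2; split=> // P M h; apply: run_loop0.
    have [r3 [h3 e3 f3]] := IHf b.+2 (upd r2 b.+1 n).
    have [|r4 [h4 e4 f4]] := IH r3; first by rewrite f3 // /upd eqxx.
    exists r4; split.
    + by move=> P M h; apply: (run_loopS (n := n) (s1 := (r3, M))) => //; [apply: h3|apply: h4].
    + by rewrite e4 e3 iterSr; congr iter; congr den; rewrite /upd; case: eqP => //; lia.
    + by move=> j jb; rewrite f4 // f3; [rewrite /upd; case: eqP => //; lia|lia].
  have [|r2 [h2 e2 f2]] := L (nfst (r b)) r1; first by rewrite /r1 /upd; repeat (case: eqP => //; try lia).
  eexists; split; first by apply: px_seq; [apply: px_unpc; lia|apply: px_seq; [exact: h2|apply: px_mov; lia]].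
    have e3 : r1 b.+2 = nsnd (r b) by rewrite /r1 /upd eqxx.
    by rewrite -e3 -e2 /upd; repeat (case: eqP => //; try lia).
  move=> j jb; have -> : r j = r2 j.
    by rewrite f2; [rewrite /r1 /upd; repeat (case: eqP => //; try lia)|lia].
  by rewrite /upd; repeat (case: eqP => //; try lia).
- pose r1 := upd (upd r b.+1 (r b)) b.+2 0.
  have [r2 [h2 e2 f2]] := IHc b.+1 r1.
  have e3 : r2 b.+1 = den c (r b) by rewrite e2; congr den; rewrite /r1 /upd; repeat (case: eqP => //; try lia).
  have fr j : j < b.+1 -> r2 j = r j.
    by move=> jb; rewrite f2 // /r1 /upd; repeat (case: eqP => //; try lia).
  have H1 : pure_exec (copy_reg b b.+1 b.+2) r r1 by apply: px_cpy; lia.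
  rewrite -e3; case e4 : (r2 b.+1) => [|n] /=.
    have [r3 [h3 e5 f3]] := IHf b r2; exists r3; split; last 1 first.
    + by move=> j jb; rewrite f3 // fr //; lia.
    + by apply: px_seq H1 _; apply: px_seq h2 _; apply: px_if0.
    + by rewrite e5 fr.
  have [r3 [h3 e5 f3]] := IHg b (upd r2 b.+1 n); exists r3; split; last 1 first.
  + by move=> j jb; rewrite f3 // /upd; case: eqP => [|_]; [lia|rewrite fr //; lia].
  + by apply: px_seq H1 _; apply: px_seq h2 _; apply: px_ifS h3.
  + by rewrite e5 /upd; case: eqP => [|_]; [lia|rewrite fr].
Qed.

Definition writes (ws : seq (nat * bool)) (X : nat -> bool) :=
  foldl (fun X w => upd X w.1 w.2) X ws.
Fixpoint enc_writes (ws : seq (nat * bool)) : nat :=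
  if ws is w :: l then (npair (npair w.1 w.2) (enc_writes l)).+1 else 0.

Definition wloop := CLoop 2 (CSeq (unpair_cmd 2 3 5) (CSeq (move_reg 5 2)
  (CSeq (unpair_cmd 3 4 5) (CIf 5 (CWr 4 false) (CWr 4 true))))).
(** One abstract step. Register 1 holds the state code, 0 the address of the bit read, 2 that bit
    and finally the coded list of writes; the others are scratch. *)
Definition body fa fx := CSeq (copy_reg 1 2 3) (CSeq (compile fa 2) (CSeq (move_reg 2 0) (CSeq (clear_reg 2)
  (CSeq (CRd 0 CSkip (CInc 2)) (CSeq (pair_cmd 1 2 3 4) (CSeq (compile fx 3) (CSeq (unpair_cmd 3 2 1) wloop))))))).

Lemma wloop_spec (P : (nat -> bool) -> Prop) ws (r : nat -> nat) (M : nat -> bool) : r 2 = enc_writes ws ->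
  (forall i, i <= size ws -> P (writes (take i ws) M)) ->
  exists r', crun P wloop (r, M) (r', writes ws M) /\ r' 1 = r 1.
Proof.
elim: ws r M => [|[a v] l IH] r M e H.
  by exists r; split=> //; apply: run_loop0 => //; apply: (H 0).
have P0 : P M by apply: (H 0).
pose n := npair (npair a v) (enc_writes l).
pose r1 := upd r 2 n; pose r2 := upd (upd (upd r1 2 0) 3 (nfst (r1 2))) 5 (nsnd (r1 2)).
pose r3 := upd (upd r2 2 (r2 5)) 5 0.
pose r4 := upd (upd (upd r3 3 0) 4 (nfst (r3 3))) 5 (nsnd (r3 3)).
have e12 : r1 2 = n by [].
have e33 : r3 3 = npair a v by rewrite /r3 /r2 e12 /upd /= nfstE.
have e44 : r4 4 = a by rewrite /r4 e33 /upd /= nfstE.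
have e45 : r4 5 = v by rewrite /r4 e33 /upd /= nsndE.
have e42 : r4 2 = enc_writes l by rewrite /r4 /r3 /r2 e12 /upd /= nsndE.
have e41 : r4 1 = r 1 by [].
pose r5 := upd r4 5 0.
have [|i hi|r' [h' e']] := IH r5 (upd M a v); [by []|exact: (H i.+1)|].
exists r'; split; last by rewrite e'.
apply: (run_loopS (n := n) (s1 := (r5, upd M a v))) => //.
apply: run_seq; first by apply: px_unpc.
apply: run_seq; first by apply: px_mov.
apply: run_seq; first by apply: px_unpc.
rewrite -/r1 -/r2 -/r3 -/r4; case ev : v; rewrite ev /= in e45.
  apply: (@run_ifS _ _ _ _ _ 0) => //.
  have -> : upd M a true = (doact (AWr 4 true) (r5, M)).1.2 by rewrite /= /r5 [upd r4 5 0 4]/upd /= e44.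
  exact: (@run1 P (CWr 4 true) (r5, M)).
apply: run_if0 => //; have -> : r5 = r4 by rewrite /r5 -[X in upd r4 5 X]e45 upd_id.
have -> : upd M a false = (doact (AWr 4 false) (r4, M)).1.2 by rewrite /= e44.
exact: (@run1 P (CWr 4 false) (r4, M)).
Qed.

Lemma body_spec fa fx (P : (nat -> bool) -> Prop) ws s' (r : nat -> nat) (M : nat -> bool) :
  den fx (npair (r 1) (M (den fa (r 1)))) = npair (enc_writes ws) s' ->
  (forall i, i <= size ws -> P (writes (take i ws) M)) ->
  exists r', crun P (body fa fx) (r, M) (r', writes ws M) /\ r' 1 = s'.
Proof.
move=> e H; have P0 : P M by have := H 0 isT; rewrite take0.
pose r1 := upd (upd r 2 (r 1)) 3 0.
have [r2 [h2 e2 f2]] := cf_spec fa 2 r1.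
pose r3 := upd (upd r2 0 (r2 2)) 2 0.
pose r4 := upd r3 2 0.
pose b := M (den fa (r 1)).
have e40 : r4 0 = den fa (r 1) by rewrite /r4 /r3 /upd /= e2.
have e42 : r4 2 = 0 by [].
have e41 : r4 1 = r 1 by rewrite /r4 /r3 /upd /= f2.
pose r5 := upd r4 2 b.
pose r6 := upd (upd (upd (upd r5 1 0) 2 0) 3 (npair (r5 1) (r5 2))) 4 0.
have [r7 [h7 e7 f7]] := cf_spec fx 3 r6.
have e73 : r7 3 = npair (enc_writes ws) s'.
  by rewrite e7 -e; congr den; rewrite /r6 /upd /= /r5 /upd /= e41.
pose r8 := upd (upd (upd r7 3 0) 2 (nfst (r7 3))) 1 (nsnd (r7 3)).
have [||r' [h' e']] := @wloop_spec P ws r8 M; [by rewrite /r8 e73 /upd /= nfstE|done|].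
exists r'; split; last by rewrite e' /r8 e73 /upd /= nsndE.
apply: run_seq; first by apply: px_cpy.
apply: run_seq; first by apply: h2.
apply: run_seq; first by apply: px_mov.
apply: run_seq; first by apply: px_clr.
apply: (@run_seq _ _ _ _ (r5, M)).
  apply: run_rd => //=; rewrite -/r3 -/r4 e40 -/b /r5; case: (b).
    have -> : upd r4 2 true = upd r4 2 (r4 2).+1 by rewrite e42.
    exact: px_inc.
  by have -> : upd r4 2 false = r4; [rewrite -[X in upd r4 2 X]e42 upd_id|apply: px_skip].
apply: run_seq; first by apply: px_pairc.
apply: run_seq; first by apply: h7.
by apply: run_seq; first by apply: px_unpc.
Qed.

#[global] Opaque npair nfst nsnd.

(** * Counter programs on a multi-tape machine *)

Definition areg (a : action) : nat :=
  match a with AInc k | ADjz k | ARd k | AWr k _ => k end.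
Fixpoint rmax (c : cmd) : nat :=
  match c with
  | CSkip => 1
  | CInc k | CDec k | CWr k _ => k.+1
  | CSeq a b => maxn (rmax a) (rmax b)
  | CLoop k a => maxn k.+1 (rmax a)
  | CIf k a b | CRd k a b => maxn k.+1 (maxn (rmax a) (rmax b))
  end.
Lemma act_lt c (n : nodes c) : areg (act n) < rmax c.
Proof.
elim: c n => [|k|k|k b|a IHa b IHb|k a IHa|k a IHa b IHb|k a IHa b IHb] //=.
- by case=> n; rewrite leq_max ?IHa ?IHb ?orbT.
- by case=> [n|]; rewrite leq_max ?IHa ?orbT //= ltnSn.
- by case=> [[n|n]|]; rewrite !leq_max ?IHa ?IHb ?orbT //= ltnSn.
- by case=> [[n|n]|]; rewrite !leq_max ?IHa ?IHb ?orbT //= ltnSn.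
Qed.

Section Machine.
Variables (c : cmd) (m : nat).
Hypothesis (cm : rmax c <= m) (m2 : 1 < m).
Notation W := m.+3.
(* Tracks: memory, leftmost column, frontier, and the registers in unary.  A limit leaves
   garbage on the register tracks; only the columns up to the first frontier mark count,
   and a column is cleaned when the frontier moves onto it. *)
Definition trM : 'I_W := ord0.
Definition trL : 'I_W := inord 1.
Definition trF : 'I_W := inord 2.
Definition trC k : 'I_W := inord k.+3.
Lemma vL : val trL = 1. Proof. by rewrite /= inordK. Qed.
Lemma vF : val trF = 2. Proof. by rewrite /= inordK. Qed.
Lemma vc k : k < m -> val (trC k) = k.+3. Proof. by move=> h; rewrite /= inordK. Qed.

(** [None] halts, [Some None] starts and [Some (Some None)] is the limit state. In the other states
    the bits name a phase: find the frontier, push it one column, return, run to the end of a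
    register, decrement, return with the test bit. *)
Definition tape_st : finType := option (option (option (nodes c * (bool * bool * bool)))).
Definition node_st (n : nodes c) u : tape_st := Some (Some (Some (n, u))).
Definition mu_seek := (false, false, false).
Definition mu_new := (false, false, true).
Definition mu_home := (false, true, false).
Definition mu_find := (false, true, true).
Definition mu_dec := (true, false, false).
Definition mu_back (b : bool) := (true, true, b).

(** Track 4 belongs to register 1, which so receives the code [b] of the boot state. *)
Definition cinit b (r : col W) : col W :=
  [ffun i => if val i == 0 then r i else (val i == 1) || (val i == 2) || (b && (val i == 4))].
Definition cnew (r : col W) : col W := [ffun i => if val i <= 1 then r i else val i == 2].
Definition cset i0 b (r : col W) : col W := [ffun i => if i == i0 then b else r i].
Definition next_node n b : nodes c := odflt (entry c) (nxt n b).

Definition tape_delta (s : tape_st) (r : col W) : col W * bool * tape_st :=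
  match s with
  | None => (r, false, None)
  | Some None => (cinit false r, false, node_st (entry c) mu_seek)
  | Some (Some None) => (cinit true r, false, node_st (entry c) mu_seek)
  | Some (Some (Some (n, u))) => match u with
    | (false, false, false) => if r trF then (cset trF false r, true, node_st n mu_new) else (r, true, node_st n mu_seek)
    | (false, false, true) => (cnew r, false, node_st n mu_home)
    | (false, true, false) => if r trL then (r, false, node_st n mu_find) else (r, false, node_st n mu_home)
    | (false, true, true) => if r (trC (areg (act n))) then (r, true, node_st n mu_find) else
        match act n with
        | AInc k => (cset (trC k) true r, false, node_st n (mu_back false))
        | ADjz k => if r trL then (r, false, node_st n (mu_back false)) else (r, false, node_st n mu_dec)
        | ARd k => (r, false, node_st n (mu_back (r trM)))
        | AWr k b => (cset trM b r, false, node_st n (mu_back false))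
        end
    | (true, false, _) => (cset (trC (areg (act n))) false r, false, node_st n (mu_back true))
    | (true, true, b) => if r trL then (r, false, node_st (next_node n b) mu_seek) else (r, false, node_st n (mu_back b))
    end
  end.
Lemma tdist : [&& (Some None : tape_st) != None, (Some None : tape_st) != Some (Some None) & (None : tape_st) != Some (Some None)].
Proof. by []. Qed.
Definition tmach : amach W := @AMach W tape_st _ _ _ tdist tape_delta.
Notation tstep := (@astep W tmach).

Lemma tstepE n u hd tp : tstep (node_st n u, hd, tp) =
  let: (w, mv, q) := tape_delta (node_st n u) (rdc tp hd) in (q, mvh mv hd, wrc tp hd w).
Proof. by []. Qed.
Lemma tstep_keep n u hd tp mv q : tape_delta (node_st n u) (rdc tp hd) = (rdc tp hd, mv, q) ->
  tstep (node_st n u, hd, tp) = (q, mvh mv hd, tp).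
Proof. by move=> e; rewrite tstepE e wrc_id. Qed.

Section Walk.
Variable P : (nat -> bool) -> Prop.
Notation PP := (fun x : aconf tmach => P (x.2 trM)).
Notation reachP := (reach tstep PP).

Lemma walkR n u a b tp : P (tp trM) -> a <= b ->
  (forall j, a <= j < b -> tape_delta (node_st n u) (rdc tp j) = (rdc tp j, true, node_st n u)) ->
  reachP (node_st n u, a, tp) (node_st n u, b, tp).
Proof.
move=> hP; move e : (b - a) => d; elim: d a e => [|d IH] a e ab H.
  have -> : a = b by lia.
  exact: reach_refl.
apply: reach_step => //; rewrite (tstep_keep (mv := true) (q := node_st n u)); last by apply: H; lia.
by rewrite /mvh; apply: IH => [||j hj]; [lia|lia|apply: H; lia].
Qed.
Lemma walkL n u b tp : P (tp trM) ->
  (forall j, 0 < j <= b -> tape_delta (node_st n u) (rdc tp j) = (rdc tp j, false, node_st n u)) ->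
  reachP (node_st n u, b, tp) (node_st n u, 0, tp).
Proof.
move=> hP; elim: b => [|b IH] H; first exact: reach_refl.
apply: reach_step => //; rewrite (tstep_keep (mv := false) (q := node_st n u)); last by apply: H; lia.
by rewrite /mvh /=; apply: IH => j hj; apply: H; lia.
Qed.

Definition good (tp : 'I_W -> nat -> bool) f (r : nat -> nat) X :=
  [/\ tp trM = X, forall j, tp trL j = (j == 0), forall j, j <= f -> tp trF j = (j == f) &
      forall k j, k < m -> j <= f -> tp (trC k) j = (j < r k)].

Lemma back_home n b hd tp : P (tp trM) -> (forall j, tp trL j = (j == 0)) ->
  reachP (node_st n (mu_back b), hd, tp) (node_st (next_node n b) mu_seek, 0, tp).
Proof.
move=> hP hL; apply: reach_trans; first apply: walkL => // j hj.
  by rewrite /= ffunE hL; case: j hj.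
apply: reach_step => //; rewrite (tstep_keep (mv := false) (q := node_st (next_node n b) mu_seek)) /=; first exact: reach_refl.
by rewrite ffunE hL.
Qed.

(** The frontier advances before every action because an increment may lengthen a register by one.
    The bound on [r] says that the new, cleared column lies past the end of every register, so the
    first blank of each track is within the valid columns. *)
Lemma extend n tp f r X : P X -> good tp f r X -> (forall k, k < m -> r k <= f.+1) ->
  exists tp', reachP (node_st n mu_seek, 0, tp) (node_st n mu_find, 0, tp') /\ good tp' f.+1 r X.
Proof.
move=> hP [gM gL gF gc] hr.
pose tp1 := wrc tp f (cset trF false (rdc tp f)).
pose tp2 := wrc tp1 f.+1 (cnew (rdc tp1 f.+1)).
have e2 i j : tp2 i j = if j == f.+1 then (if val i <= 1 then tp i j else val i == 2)
   else if (j == f) && (i == trF) then false else tp i j.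
  rewrite /tp2 /tp1 /wrc !ffunE; case: eqP => [->|_]; last by case: eqP => [->|].
  by rewrite -[_ == f]/(f.+1 == f) (_ : (f.+1 == f) = false) //; lia.
have e1M : tp1 trM = X.
  by apply: funext => j; rewrite /tp1 /wrc !ffunE -val_eqE vF /= -gM; case: eqP => [->|].
have e2M : tp2 trM = X.
  by apply: funext => j; rewrite e2 -val_eqE vF /= andbF gM; case: ifP.
have e2L j : tp2 trL j = (j == 0).
  by rewrite e2 vL -val_eqE vF vL /= andbF gL; case: ifP.
exists tp2; split; last first.
  split=> // [j jf|k j km jf].
    rewrite e2 vF !eqxx andbT; case: eqP => [->|/eqP jn] //.
    case: eqP => // /eqP jnf; rewrite gF; lia.
  rewrite e2 vc // -val_eqE vF vc // andbF; have := hr k km; case: eqP => [->|/eqP jn] h.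
    by rewrite /=; lia.
  by rewrite gc //; lia.
apply: reach_trans.
  apply: (@walkR _ _ 0 f) => //; first by rewrite gM.
  by move=> j hj; rewrite /= ffunE gF; [case: eqP => // ?; lia|lia].
apply: reach_step; first by rewrite /= gM.
rewrite tstepE /= ffunE gF // eqxx /= -/tp1.
apply: reach_step; first by rewrite /= e1M.
rewrite tstepE /= -/tp2.
apply: reach_trans; first apply: walkL; first by rewrite e2M.
  by move=> j hj; rewrite /= ffunE e2L; case: j hj.
apply: reach_step; first by rewrite /= e2M.
rewrite (tstep_keep (mv := false) (q := node_st n mu_find)) /=; first exact: reach_refl.
by rewrite ffunE e2L.
Qed.

Lemma action_ok n tp f r X :
  P X -> P (doact (act n) (r, X)).1.2 -> good tp f r X -> (forall k, k < m -> r k <= f) ->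
  exists tp', reachP (node_st n mu_find, 0, tp) (node_st (next_node n (doact (act n) (r, X)).2) mu_seek, 0, tp') /\
    good tp' f (doact (act n) (r, X)).1.1 (doact (act n) (r, X)).1.2 /\
    forall k, k < m -> (doact (act n) (r, X)).1.1 k <= f.+1.
Proof.
move=> hP hP' [gM gL gF gc] hr.
set k := areg (act n); have km : k < m by apply: leq_trans (act_lt n) cm.
have R1 : reachP (node_st n mu_find, 0, tp) (node_st n mu_find, r k, tp).
  apply: walkR; [by rewrite gM|done|move=> j hj].
  have jf : j <= f by have := hr _ km; lia.
  rewrite /= ffunE -/k gc //.
  by have -> : j < r k by lia.
have Ek : tape_delta (node_st n mu_find) (rdc tp (r k)) = match act n with
        | AInc k0 => (cset (trC k0) true (rdc tp (r k)), false, node_st n (mu_back false))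
        | ADjz _ => if r k == 0 then (rdc tp (r k), false, node_st n (mu_back false)) else (rdc tp (r k), false, node_st n mu_dec)
        | ARd _ => (rdc tp (r k), false, node_st n (mu_back (X (r k))))
        | AWr _ b => (cset trM b (rdc tp (r k)), false, node_st n (mu_back false))
        end.
  by rewrite /= !ffunE -/k gc ?hr // ltnn gL gM.
have hr' k' : k' < m -> r k' <= f.+1 by move=> h; apply: leqW; apply: hr.
move: (Ek); case ea : (act n) => [k0|k0|k0|k0 b]; have ek : k = k0 by rewrite /k ea.
- subst k0 => E; pose tp1 := wrc tp (r k) (cset (trC k) true (rdc tp (r k))).
  have e1 i j : tp1 i j = if (j == r k) && (i == trC k) then true else tp i j.
    by rewrite /tp1 /wrc !ffunE; case: eqP => [->|].
  have e1M : tp1 trM = X by apply: funext => j; rewrite e1 -val_eqE vc //= andbF gM.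
  have e1L j : tp1 trL j = (j == 0) by rewrite e1 -val_eqE vc // vL andbF gL.
  exists tp1; split; last split=> /=.
  + apply: reach_trans R1 _; apply: reach_step; first by rewrite /= gM.
    by rewrite tstepE E /= -/tp1; apply: back_home; rewrite ?e1M.
  + split=> // [j jf|k' j k'm jf]; rewrite e1 -val_eqE vc //; first by rewrite vF andbF gF.
    rewrite vc // eqSS eqSS eqSS gc // updE; case: (eqVneq k' k) => [->|]; rewrite ?andbF ?andbT //.
    by case: eqP => [->|/eqP]; [rewrite ltnSn|lia].
  + by move=> k' k'm; rewrite updE; case: eqP => [_|_]; rewrite ?ltnS; apply: hr || apply: hr'.
- subst k0; case: eqP => [r0|/eqP r0] E.
    exists tp; rewrite /= r0 /=; split; last split=> //.
    + apply: reach_trans R1 _; apply: reach_step; first by rewrite /= gM.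
      by rewrite (tstep_keep E); apply: back_home; rewrite ?gM.
    + by rewrite -[X in upd r k X]r0 upd_id.
    + by rewrite -[X in upd r k X]r0 upd_id.
  pose p := (r k).-1; pose tp1 := wrc tp p (cset (trC k) false (rdc tp p)).
  have e1 i j : tp1 i j = if (j == p) && (i == trC k) then false else tp i j.
    by rewrite /tp1 /wrc !ffunE; case: eqP => [->|].
  have e1M : tp1 trM = X by apply: funext => j; rewrite e1 -val_eqE vc //= andbF gM.
  have e1L j : tp1 trL j = (j == 0) by rewrite e1 -val_eqE vc // vL andbF gL.
  exists tp1; split; last split=> /=.
  + apply: reach_trans R1 _; apply: reach_step; first by rewrite /= gM.
    rewrite (tstep_keep E); apply: reach_step; first by rewrite /= gM.
    by rewrite tstepE /= -/k -/p -/tp1 r0; apply: back_home; rewrite ?e1M. 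
  + split=> // [j jf|k' j k'm jf]; rewrite e1 -val_eqE vc //; first by rewrite vF andbF gF.
    rewrite vc // eqSS eqSS eqSS gc // updE; case: (eqVneq k' k) => [->|]; rewrite ?andbF ?andbT //.
    by rewrite -/p; case: eqP => [->|/eqP]; [rewrite ltnn|rewrite /p; lia].
  + by move=> k' k'm; rewrite updE; case: eqP => [_|_]; last exact: hr'; have := hr _ km; lia.
- subst k0 => E /=; exists tp; split; last by split.
  apply: reach_trans R1 _; apply: reach_step; first by rewrite /= gM.
  by rewrite (tstep_keep E); apply: back_home; rewrite ?gM.
- subst k0 => E /=; rewrite ea /= in hP'; pose tp1 := wrc tp (r k) (cset trM b (rdc tp (r k))).
  have e1 i j : tp1 i j = if (j == r k) && (i == trM) then b else tp i j.
    by rewrite /tp1 /wrc !ffunE; case: eqP => [->|].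
  have e1M : tp1 trM = upd X (r k) b by apply: funext => j; rewrite e1 eqxx andbT gM.
  have e1L j : tp1 trL j = (j == 0) by rewrite e1 -val_eqE vL andbF gL.
  exists tp1; split; last split=> //.
  + apply: reach_trans R1 _; apply: reach_step; first by rewrite /= gM.
    by rewrite tstepE E /= -/tp1; apply: back_home; rewrite ?e1M.
  + split=> // [j jf|k' j k'm jf]; rewrite e1 -val_eqE; first by rewrite vF andbF gF.
    by rewrite vc // andbF gc.
Qed.

Definition ready f n r X (x : aconf tmach) :=
  [/\ x.1 = (node_st n mu_seek, 0), good x.2 f r X & forall k, k < m -> r k <= f.+1].

Lemma run_ready f n r X r' X' x : ready f n r X x -> P X' ->
  reach (@nstep c) (fun x => P x.2.2) (Some n, (r, X)) (None, (r', X')) ->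
  exists f' x', [/\ f < f', reachP x x' & ready f' (entry c) r' X' x'].
Proof.
move=> Rx hP' [N [e H]]; elim: N f n r X x Rx e H => [//|N IH] f n r X x Rx; rewrite iterSr => e H.
case: x Rx => [[s hd] tp] [/= [-> ->] g hr].
have P0 : P X by apply: (H 0).
have [tp1 [R1 g1]] := extend n P0 g hr.
have hP1 : P (doact (act n) (r, X)).1.2.
  case: N e H {IH} => [|N] e H; last by have := H 1 isT.
  by move: e; rewrite /= /nstep /= => -[_ ->].
have [tp2 [R2 [g2 hr2]]] := action_ok P0 hP1 g1 hr.
have R3 := reach_trans R1 R2.
have Rd : ready f.+1 (next_node n (doact (act n) (r, X)).2) (doact (act n) (r, X)).1.1 (doact (act n) (r, X)).1.2
   (node_st (next_node n (doact (act n) (r, X)).2) mu_seek, 0, tp2) by [].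
move: R3 Rd; rewrite /next_node; case en : (nxt n _) => [n'|] /= R3 Rd.
  have [] := IH _ _ _ _ _ Rd.
  - by move: e; rewrite /nstep /= en -!surjective_pairing.
  - by move=> i hi; have := H i.+1 hi; rewrite iterSr /nstep /= en -!surjective_pairing.
  move=> f' [x' [ff R4 Rx']]; exists f', x'; split=> //; first exact: ltnW.
  exact: reach_trans R4.
exists f.+1, (node_st (entry c) mu_seek, 0, tp2); split=> //.
have F i y : iter i (@nstep c) (None, y) = (None, y) by elim: i => //= i ->.
move: e; rewrite {2}/nstep /= en F => -[e]; move: Rd; by rewrite e.
Qed.
End Walk.

(** Rewriting column 0 suffices: with the frontier at 0, garbage on the other frontier and register
    cells is out of range. Only the left-mark track has to come through limits intact. *)
Lemma boot b tp : (forall j, 0 < j -> tp trL j = false) ->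
  let x := (tstep (if b then Some (Some None) else Some None, 0, tp)) in
  x.2 trM = tp trM /\ exists r, ready 0 (entry c) r (tp trM) x /\ r 1 = b.
Proof.
move=> hL x.
have -> : x = (node_st (entry c) mu_seek, 0, wrc tp 0 (cinit b (rdc tp 0))) by rewrite /x; case: (b).
set tp1 := wrc _ _ _.
have e1 i j : tp1 i j = if j == 0 then (if val i == 0 then tp i 0 else (val i == 1) || (val i == 2) || (b && (val i == 4))) else tp i j.
  by rewrite /tp1 /wrc !ffunE.
have eM : tp1 trM = tp trM by apply: funext => j; rewrite e1 /=; case: eqP => // ->.
split=> //; exists (fun k => b && (k == 1)); split; last by rewrite eqxx andbT.
split=> //=; last by move=> k _; case: (_ && _).
split=> // [[|j]|[|j]|k [|j] km] //; rewrite ?e1 ?vL ?vF ?vc //=.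
- exact: hL.
- by rewrite !eqSS; case: (_ && _).
Qed.

(** An invariant of all stages: the left-mark track is blank away from cell 0 and marked there from
    the first step on, which a limsup preserves. *)
Definition sane (x : aconf tmach) :=
  [/\ (x.1.1 = Some None \/ x.1.1 = Some (Some None)) -> x.1.2 = 0,
      forall j, 0 < j -> x.2 trL j = false, (x.1.1 <> Some None -> x.2 trL 0) & x.1.1 <> None].
Lemma sane_step x : sane x -> sane (tstep x).
Proof.
case: x => [[s hd] tp] [/= h1 h2 h3 h4].
have K (w : col W) mv (q : tape_st) : (q <> None /\ q <> Some None /\ q <> Some (Some None)) ->
  (w trL = tp trL hd \/ (hd = 0 /\ w trL)) ->
  (tp trL 0 \/ (hd = 0 /\ w trL)) -> sane (q, mvh mv hd, wrc tp hd w).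
  move=> [q1 [q2 q3]] hw h0; split=> //=; first by case.
    move=> j j0; rewrite /wrc; case: eqP => [e|_]; last exact: h2.
    by case: hw => [->|[e']]; [rewrite -e h2|move: j0; rewrite e e'].
  move=> _; rewrite /wrc; case: eqP => [e|/eqP ne]; first by case: hw h0 => [->|[_ ->//]] []; rewrite -?e // => -[_ ->].
  by case: h0 => // -[e]; move: ne; rewrite e.
have KK (w : col W) mv (q : tape_st) : (q <> None /\ q <> Some None /\ q <> Some (Some None)) ->
  w trL = tp trL hd -> s <> Some None -> sane (q, mvh mv hd, wrc tp hd w).
  by move=> a b d; apply: K => //; left=> //; apply: h3.
have I b : hd = 0 -> cinit b (rdc tp hd) trL by rewrite !ffunE vL.
have eTF : (trL == trF) = false by rewrite -val_eqE vL vF.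
have eTM : (trL == trM) = false by rewrite -val_eqE vL.
have eTc (n : nodes c) : (trL == trC (areg (act n))) = false.
  rewrite -val_eqE vL vc //; apply: leq_trans (act_lt n) cm.
have -> : tstep (s, hd, tp) = let: (w, mv, q) := tape_delta s (rdc tp hd) in (q, mvh mv hd, wrc tp hd w).
  by rewrite /astep; case: eqP.
case: s h1 h3 h4 KK => [[[[n [[[] []] []]]|]|]|] // h1 h3 h4 KK; rewrite /tape_delta.
- by case: ifP => _; apply: KK => //; rewrite ffunE.
- by case: ifP => _; apply: KK => //; rewrite ffunE.
- by apply: KK => //; rewrite !ffunE eTc.
- by apply: KK => //; rewrite !ffunE eTc.
- case: ifP => _; first by apply: KK => //; rewrite ffunE.
  have := eTc n; case: (act n) => [k|k|k|k b] ec; rewrite [areg _]/= in ec.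
  + by apply: KK => //; rewrite !ffunE ec.
  + by case: ifP => _; apply: KK => //; rewrite ffunE.
  + by apply: KK => //; rewrite ffunE.
  + by apply: KK => //; rewrite !ffunE eTM.
- by case: ifP => _; apply: KK => //; rewrite ffunE.
- by apply: KK => //; rewrite !ffunE vL.
- by case: ifP => _; apply: KK => //; rewrite ?ffunE ?eTF ?ffunE.
- have e0 : hd = 0 by apply: h1; right.
  by apply: K => //; right; split=> //; apply: I.
- have e0 : hd = 0 by apply: h1; left.
  by apply: K => //; right; split=> //; apply: I.
Qed.
Lemma sane_run (T : stages) (z t : wcar T) : z <=! t -> sane (run (asys tmach) z t).
Proof.
move: t; apply: run_ind => [|t zt IH|t zt ht IH].
- by rewrite run_z; split.
- by rewrite run_sc //; apply: sane_step.
- have eL j : (run (asys tmach) z t).2 trL j = limsup (fun u => amem (run (asys tmach) z u)) t (trL, j).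
    by rewrite -amem_lim.
  split=> //.
  + by rewrite run_lim.
  + move=> j j0; rewrite eL; apply: (limsup0 zt) => u zu ut.
    by have [_ h _ _] := IH u zu ut; apply: h.
  + move=> _; rewrite eL; apply: limsup1 => s st.
    have [u [su [zu ut]]] : exists u, s <=! u /\ z <! u /\ u <! t.
      case: (slt_or z s) => [zs|sz]; first by exists s; split; [right|].
      exists (sc z); split; first exact: sle_trans sz (sltW (sc_gt _)).
      by split; [apply: sc_gt|apply: ht].
    exists u; split=> //; split=> //; have [_ _ h _] := IH u (sltW zu) ut; apply: h.
    have [hu|/nlz[w ew]] := pselect (lz u); first by rewrite run_lim.
    have zw : z <=! w by apply: sc_lt; rewrite -ew.
    have wt : w <! t by apply: slt_trans ut; rewrite ew; apply: sc_gt.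
    rewrite ew run_sc //; case: (run (asys tmach) z w) (IH w zw wt) => [[s' hd'] tp'] [_ _ _ /= h4].
    move: h4; rewrite /astep /= /astep1 /=.
    case: s' => [[[[n [[[] []] []]]|]|]|] //= _; repeat case: ifP => //=; by case: (act n) => //= *; case: ifP.
  + by rewrite run_lim.
Qed.
End Machine.

Lemma wrs_notin ws X a : a \notin unzip1 ws -> writes ws X a = X a.
Proof.
elim: ws X => //= w l IH X; rewrite inE negb_or => /andP[an al]; rewrite IH // updE.
by rewrite (negbTE an).
Qed.
(** With distinct addresses each bit is written at most once per abstract step, so partial execution
    shows no third value. *)
Lemma wrs_take ws X a i : uniq (unzip1 ws) ->
  writes (take i ws) X a = X a \/ writes (take i ws) X a = writes ws X a.
Proof.
elim: ws X i => [|w l IH] X i /=; first by left.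
case/andP=> wl ul; case: i => [|i] /=; first by left.
case: (IH (upd X w.1 w.2) i ul) => ->; last by right.
by rewrite updE; case: eqP => [->|]; [right; rewrite wrs_notin // updE eqxx|left].
Qed.

Section ISM.
Variables (V : Type) (encV : V -> nat) (vi vl : V) (adr : V -> nat)
  (nxv : V -> bool -> V * seq (nat * bool)) (fa fx : fn).
Hypotheses (Hi : encV vi = 0) (Hl : encV vl = 1)
  (Ha : forall v, den fa (encV v) = adr v)
  (Hx : forall v (b : bool), den fx (npair (encV v) b) = npair (enc_writes (nxv v b).2) (encV (nxv v b).1))
  (Hu : forall v b, uniq (unzip1 (nxv v b).2)).

(** An abstract machine with states in [V]: the state determines one address to read, the bit found
    there determines the new state and a list of writes. *)
Definition istep (x : V * (nat -> bool)) :=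
  let r := nxv x.1 (x.2 (adr x.1)) in (r.1, writes r.2 x.2).
Definition isys : tsys := @TSys (V * (nat -> bool)) nat (vi, fun=> false) istep
  (fun X => (vl, X)) (fun x a => x.2 a) (fun X a => erefl).

Notation c := (body fa fx).
Definition im := maxn (rmax c) 2.
Lemma im1 : rmax c <= im. Proof. exact: leq_maxl. Qed.
Lemma im2 : 1 < im. Proof. by rewrite /im leq_max orbT. Qed.
Definition imach : amach im.+3 := tmach c im.
Notation istp := (@astep _ imach).

Definition rdy (x : V * (nat -> bool)) (y : aconf imach) :=
  exists f r, ready (m := im) f (entry c) r x.2 y /\ r 1 = encV x.1.
(** The second alternative covers the beginning of a block, one boot step before [rdy]. *)
Definition irel x (y : aconf imach) := y.2 (trM _) = x.2 /\
  (rdy x y \/ rdy x (istp y)).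
Definition iph x (y : aconf imach) := forall a, y.2 (trM _) a = x.2 a \/ y.2 (trM _) a = (istep x).2 a.

Lemma rdy_step x y : rdy x y -> exists n, [/\ 0 < n, irel (istep x) (iter n istp y) &
  forall i, i < n -> iph x (iter i istp y)].
Proof.
case: x => v X [f [r [Rd e1]]] /=.
pose P X' := forall a, X' a = X a \/ X' a = (istep (v, X)).2 a.
set ws := (nxv v (X (adr v))).2; set v' := (nxv v (X (adr v))).1.
have [|i hi a|r' [R' e']] := @body_spec fa fx P ws (encV v') r X.
- by rewrite e1 /= Ha Hx.
- by apply: wrs_take; apply: Hu.
have PX' : P (writes ws X) by move=> a; right.
have [f' [y' [ff Ry Rd']]] := run_ready (P := P) im1 im2 Rd PX' R'.
case: Ry => -[[/= ey _]|n [ey Hy]]; last first.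
  exists n.+1; split=> //; rewrite ey; split; last by left; exists f', r'; split.
  by case: Rd' => _ [-> _ _ _] _.
(* A run of no steps would leave the frontier mark in place, but [f < f']. *)
exfalso; subst y'; case: Rd => _ [_ _ /(_ f (leqnn f)) g1 _] _.
by case: Rd' => _ [_ _ /(_ f (ltnW ff)) g2 _] _; move: g2; rewrite g1 eqxx; case: eqP => // ef; move: ff; rewrite ef ltnn.
Qed.

Lemma irel_step x y : irel x y -> exists n, [/\ 0 < n, irel (istep x) (iter n istp y) &
  forall i, i < n -> iph x (iter i istp y)].
Proof.
move=> [e [R|R]]; first exact: rdy_step.
have [n [n0 R' H]] := rdy_step R; exists n.+1; split=> // [|[|i] hi].
- by rewrite iterSr.
- by move=> a; left; rewrite /= e.
- by rewrite iterSr; apply: H.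
Qed.

Section Sim.
Variables (T : stages) (z : wcar T).
Hypothesis hz : lz z.
Notation r1 := (run isys z).
Notation r2 := (run (asys imach) z).

Lemma imach_nohalt t : z <=! t -> stt imach z t <> ah imach.
Proof. by move=> zt; have [_ _ _] := sane_run im1 zt. Qed.

Lemma imach_sim t : lz t -> z <=! t -> (r2 t).2 (trM _) = (r1 t).2.
Proof.
move=> ht zt; elim/(well_founded_ind (@wlt_wf T)): t ht zt => t IH ht [zt|<-]; last by rewrite !run_z.
have C l : lz l -> z <=! l -> l <! t -> irel (r1 l) (r2 l).
  move=> hl zl lt; have E := IH l lt hl zl; split=> //; right.
  have [_ hL _ _] := sane_run im1 zl.
  have [b [e2 e1]] : exists b, (r2 l).1 = (if b then Some (Some None) else Some None, 0) /\
    encV (r1 l).1 = nat_of_bool b.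
    case: zl => [zl|<-]; last by exists false; rewrite !run_z.
    by exists true; rewrite !run_lim.
  have [_ [r [R er]]] := boot c b hL.
  exists 0, r; rewrite e1; split=> //.
  by rewrite -E [r2 l]surjective_pairing e2.
apply: funext => a.
have -> : (r2 t).2 (trM _) a = amem (r2 t) (trM _, a) by [].
have -> : (r1 t).2 a = limsup (fun u => (r1 u).2) t a by rewrite {1}run_lim.
have it1 l n : z <=! l -> iter n istep (r1 l) = r1 (add l n) by move=> zl; rewrite run_add.
have it2 l n : z <=! l -> iter n istp (r2 l) = r2 (add l n) by move=> zl; rewrite run_add.
have D l : lz l -> z <=! l -> l <! t ->
  bsim (fun n => (r1 (add l n)).2 a) (fun n => amem (r2 (add l n)) (trM _, a)) /\
  forall m, exists n, amem (r2 (add l m)) (trM _, a) = (r1 (add l n)).2 a.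
  move=> hl zl lt; have [tau [t1 t2 t3]] := iter_msim irel_step (C l hl zl lt).
  apply: (tau_bsim t1) => n; first by have [h1 _] := t2 n; rewrite -it1 // -it2 // /amem /= h1.
  have [n' hn h1] := t3 n; exists n' => //; rewrite -!it1 // -it2 //; exact: h1.
rewrite amem_lim //; symmetry; apply: (limsup_sim hz ht zt) => [l hl zl lt|l m hl zl lt].
  by case: (D l hl zl lt).
by case: (D l hl (sltW zl) lt).
Qed.
End Sim.
End ISM.

(** * Codes of one-tape programs and the gap searcher *)

(* A code is a list of nested pairs; its entry for state [s] holds the transitions for
   the bits 0 and 1.  State 0 halts, 1 starts, 2 is the limit state. *)
Definition ent (c s : nat) (b : bool) :=
  let E := nfst (iter s nsnd c) in if b then nsnd E else nfst E.
Definition ew e := nfst (nfst e) != 0.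
Definition emv e := nsnd (nfst e) != 0.
Definition est e := nsnd e.

Lemma iter_nsnd_le c s : iter s nsnd c <= c.
Proof. by elim: s => //= s IH; apply: leq_trans IH; apply: nsnd_le. Qed.
(** Unpairing never increases, so the program with code [c] fits on [c + 3] states; the surplus
    provides the three distinguished states even for [c = 0]. *)
Lemma est_le c s b : est (ent c s b) <= c.
Proof.
apply: leq_trans (nsnd_le _) _; rewrite /ent.
have h := leq_trans (nfst_le _) (iter_nsnd_le c s).
by case: b; apply: leq_trans h; [apply: nsnd_le|apply: nfst_le].
Qed.

Definition rconf := (nat * nat * (nat -> bool))%type.
Definition rstep (c : nat) (x : rconf) : rconf :=
  if x.1.1 == 0 then x else
  let e := ent c x.1.1 (x.2 x.1.2) in
  (est e, mvh (emv e) x.1.2, upd x.2 x.1.2 (ew e)).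

Section Pr.
Variable c : nat.
Lemma Prdist : [&& (inord 1 : 'I_c.+3) != inord 0, (inord 1 : 'I_c.+3) != inord 2
  & (inord 0 : 'I_c.+3) != inord 2].
Proof. by rewrite -!val_eqE /= !inordK. Qed.
Definition Pr : amach 1 := AMach Prdist (fun s (r : col 1) =>
  let e := ent c s (r ord0) in ([ffun=> ew e] : col 1, emv e, inord (est e) : 'I_c.+3)).
Definition rproj (x : aconf Pr) : rconf := (val x.1.1, x.1.2, x.2 ord0).
Lemma rproj_step x : rproj (astep x) = rstep c (rproj x).
Proof.
case: x => [[s h] tp]; rewrite /astep /rstep /rproj /= -val_eqE /= inordK //; case: ifP => // _.
rewrite /astep1 /= ffunE inordK; last by rewrite ltnS; apply: leq_trans (est_le _ _ _) (leqW (leqnSn c)).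
congr (_, _, _); apply: funext => j; rewrite /wrc ffunE updE //.
Qed.
Lemma rproj_iter n x : rproj (iter n (@astep _ Pr) x) = iter n (rstep c) (rproj x).
Proof. by elim: n => //= n <-; rewrite rproj_step. Qed.
End Pr.

Section Encode.
Variable M : amach 1.
Definition ge (s : ast M) : nat :=
  if s == ah M then 0 else if s == a0 M then 1 else if s == al M then 2 else (enum_rank s).+3.
Lemma ge0 s : (ge s == 0) = (s == ah M).
Proof. by rewrite /ge; case: ifP => // _; case: ifP => // _; case: ifP. Qed.
Lemma ge_inj : injective ge.
Proof.
move=> s s'; rewrite /ge.
case: (eqVneq s (ah M)) => [->|_]; first by case: (eqVneq s' (ah M)) => // _; case: ifP => // _; case: ifP.
case: (eqVneq s (a0 M)) => [->|_].
  by case: ifP => // _; case: eqP => // _; case: ifP.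
case: (eqVneq s (al M)) => [->|_].
  by case: ifP => // _; case: ifP => // _; case: eqP.
case: ifP => // _; case: ifP => // _; case: ifP => // _ [/val_inj]; exact: enum_rank_inj.
Qed.
Lemma ge_lt s : ge s < #|ast M| + 3.
Proof.
rewrite /ge addn3; do 3![case: ifP => // _]; by rewrite !ltnS.
Qed.
Definition gent (s : ast M) (b : bool) : nat :=
  let: (w, mv, q) := adl s [ffun=> b] in npair (npair (w ord0) mv) (ge q).
Definition gtbl := mkseq (fun i => if [pick s | ge s == i] is Some s then
   npair (gent s false) (gent s true) else 0) (#|ast M| + 3).
Definition gcode := foldr npair 0 gtbl.
Lemma code_nth l s : nfst (iter s nsnd (foldr npair 0 l)) = nth 0 l s.
Proof.
elim: l s => [|x l IH] [|s] //=; last 1 first.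
- by rewrite -iterS iterSr /= nsndE IH.
- have -> : iter s nsnd 0 = 0 by elim: s => //= s ->; rewrite nsnd0.
  by rewrite nfst0.
- by rewrite nfstE.
Qed.
Lemma ent_gcode s b : ent gcode (ge s) b = gent s b.
Proof.
rewrite /ent code_nth nth_mkseq ?ge_lt //; case: pickP => [s' /eqP/ge_inj->|/(_ s)]; last by rewrite eqxx.
by case: b; rewrite ?nsndE ?nfstE.
Qed.
Lemma encode_halts (T : stages) (z t : wcar T) : halts M z t -> halts (Pr gcode) z t.
Proof.
pose Rl (c1 : aconf M) (c2 : aconf (Pr gcode)) :=
  [/\ val c2.1.1 = ge c1.1.1, c2.1.2 = c1.1.2 & c2.2 ord0 = c1.2 ord0].
have gz : ge (ah M) = 0 by rewrite /ge eqxx.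
have g1 : ge (a0 M) = 1 by rewrite /ge ah0 eqxx.
have g2 : ge (al M) = 2.
  by rewrite /ge ahl eqxx; case: eqP => // e; case/and3P: (adist M); rewrite e eqxx.
have L : forall t, z <=! t -> Rl (run (asys M) z t) (run (asys (Pr gcode)) z t).
  move=> t' zt'; apply: (lockstep (S1 := asys M) (S2 := asys (Pr gcode))
     id (fun=> False) (fun=> True) Rl z t') => //; last by right.
  - by split=> //=; rewrite inordK ?g1.
  - move=> [[s h] tp] [[s2 h2] tp2] _ [/= es -> et]; rewrite /Rl /= /astep /= -val_eqE /= inordK // es ge0.
    case: ifP => //= _; rewrite /astep1 /= ffunE es et.
    have -> : rdc tp h = [ffun=> tp ord0 h] by apply/ffunP => i; rewrite !ffunE (ord1 i).
    rewrite ent_gcode inordK; last first.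
      by rewrite -ent_gcode ltnS; apply: leq_trans (est_le _ _ _) (leqW (leqnSn _)).
    rewrite /gent; case: adl => [[w mv] q]; rewrite /est /emv /ew !nsndE !nfstE nsndE.
    split=> //; first by case: mv.
    by apply: funext => j; rewrite /wrc ffunE et /=; case: (w ord0).
  - move=> X1 X2 e _; split=> //=; first by rewrite inordK ?g2.
    by apply: funext => j; rewrite -(e (ord0, j)).
  - by move=> [[s h] tp] [[s2 h2] tp2] [_ _ /= et]; split=> // -[i j]; rewrite /amem /= (ord1 i) et.
have E t' : z <=! t' -> (stt (Pr gcode) z t' = ah (Pr gcode)) <-> (stt M z t' = ah M).
  move=> /L[e _ _]; rewrite /stt; split=> h.
    by move: e; rewrite h /= inordK // => /esym/eqP; rewrite ge0 => /eqP.
  by apply: val_inj; rewrite [LHS]e h gz /= inordK.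
case=> a [b c]; split=> //; split; first by apply/(E t a).
by move=> s zs st /(E s zs); apply: c.
Qed.
End Encode.

(* Row number 0 replays the beta-clock and is restarted by aR; row r+1 runs the
   one-tape program of code r from stage 0 on. *)
Definition qrow := (nat * nat * nat * nat)%type.
(** [Main] carries the rows still to serve in this round, those served, the round number, whether
    row 0 restarts, whether a program has halted in this block, and whether the block begins at a
    limit. The boot states read what the past left: [aR] and the mark of delta. *)
Inductive qst := Boot of bool | Boot2 of bool & bool
  | Main of seq qrow & seq qrow & nat & bool & bool & bool.

(* [aFlag] is inspected at the next limit; [aR] records a halting in the last block, or
   cofinally many at a limit of blocks; [aH k] records that row [k] has halted. *)
Definition aFlag := npair 0 0.
Definition aR := npair 0 1.
Definition aH k := npair 1 k.
Definition cell k j := npair k.+2 j.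

Section Q.
Variables (d cb : nat).

Definition encr (x : qrow) := let: (k, c, h, s) := x in npair (npair k c) (npair h s).
Fixpoint encl (l : seq qrow) := if l is x :: l then (npair (encr x) (encl l)).+1 else 0.
Definition encq (v : qst) : nat :=
  match v with
  | Boot lim => npair lim 0
  | Boot2 lim b => npair 2 (npair lim b)
  | Main td dn r rs any lim =>
      npair 3 (npair (encl td) (npair (encl dn) (npair r (npair rs (npair any lim)))))
  end.
Definition adrq (v : qst) : nat :=
  match v with
  | Boot _ => aR
  | Boot2 _ _ => aH d.+1
  | Main [::] dn r _ _ _ => aH r.+1
  | Main ((k, c, h, s) :: _) _ _ _ _ _ => cell k h
  end.
(** A round serves each queued row once, then admits row [r + 1] unless it is marked as halted. Rows
    resume in the limit state, head at 0, on their stored tapes, as the simulated programs do. Row 0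
    needs no mark of its own: if it halts and no program halts in that block, the flag falls;
    otherwise [aR] restarts it. *)
Definition nxq (v : qst) (b : bool) : qst * seq (nat * bool) :=
  match v with
  | Boot lim => (Boot2 lim b, [:: (aFlag, true); (aR, false)])
  | Boot2 lim rb => (Main [::] (if b then [:: (0, cb, 0, if rb then 1 else 2)] else [::]) 0 rb false lim, [::])
  | Main [::] dn r rs any lim =>
      (Main (if b then dn else (r.+1, r, 0, (nat_of_bool lim).+1) :: dn) [::] r.+1 rs any lim,
       if rs then [:: (cell 0 r, false)] else [::])
  | Main ((k, c, h, s) :: td) dn r rs any lim =>
      let e := ent c s b in
      if est e == 0 then
        (Main td dn r rs (any || (k != 0)) lim,
         (cell k h, ew e) ::
         if k == 0 then [:: (aFlag, any)] else [:: (aH k, true); (aR, true); (aFlag, true)])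
      else (Main td ((k, c, mvh (emv e) h, est e) :: dn) r rs any lim, [:: (cell k h, ew e)])
  end.

Notation "f 'o' g" := (Fcomp f g) (at level 40, left associativity).
Fixpoint Fc n := if n is n.+1 then Fsucc o (Fc n) else Fzero.
Lemma den_Fc n x : den (Fc n) x = n. Proof. by elim: n => //= n ->. Qed.
Lemma dP f g x : den (Fpair f g) x = npair (den f x) (den g x). Proof. by []. Qed.
Lemma dI c f g x : den (Fif c f g) x = if den c x == 0 then den f x else den g x. Proof. by []. Qed.
Lemma dS g x : den (Fsucc o g) x = (den g x).+1. Proof. by []. Qed.
Definition Fcons a l := Fsucc o (Fpair a l).
Definition Fw a v l := Fcons (Fpair a v) l.
Definition f3 g := Ffst o (Fsnd o (Fsnd o g)).

Section Fields.
Variable E : fn.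
Definition tag := Ffst o E.
Definition dat := Fsnd o E.
Definition ftd := Ffst o dat.
Definition fdn := Ffst o (Fsnd o dat).
Definition fr := Ffst o (Fsnd o (Fsnd o dat)).
Definition frs := Ffst o (Fsnd o (Fsnd o (Fsnd o dat))).
Definition fany := Ffst o (Fsnd o (Fsnd o (Fsnd o (Fsnd o dat)))).
Definition flim := Fsnd o (Fsnd o (Fsnd o (Fsnd o (Fsnd o dat)))).
Definition fhd := Ffst o (Fpred o ftd).
Definition ftl := Fsnd o (Fpred o ftd).
Definition fk := Ffst o (Ffst o fhd).
Definition fcode := Fsnd o (Ffst o fhd).
Definition fh := Ffst o (Fsnd o fhd).
Definition fs := Fsnd o (Fsnd o fhd).
Definition fcell := Fpair (Fsucc o (Fsucc o fk)) fh.
Definition fmain td dn r rs any lim :=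
  Fpair (Fc 3) (Fpair td (Fpair dn (Fpair r (Fpair rs (Fpair any lim))))).
End Fields.

(** Truncated predecessors discriminate the tags: 0 and 1 are [Boot], 2 is [Boot2], 3 is [Main]. *)
Definition faq : fn := Fif (Fpred o tag Fid) (Fc aR) (Fif (Fpred o (Fpred o tag Fid)) (Fc (aH d.+1))
  (Fif (ftd Fid) (Fpair (Fc 1) (Fsucc o fr Fid)) (fcell Fid))).

Definition fold_st := Ffst.
Definition fb := Fsnd.
Definition fE := Ffst o (Fiter Fsnd o (Fpair (fs fold_st) (fcode fold_st))).
Definition fe := Fif fb (Ffst o fE) (Fsnd o fE).
Definition fwb := Fif (Ffst o (Ffst o fe)) (Fc 0) (Fc 1).
Definition fhn := Fif (Fsnd o (Ffst o fe)) (Fpred o fh fold_st) (Fsucc o fh fold_st).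
Definition fsn := Fsnd o fe.
Definition fxrow : fn :=
  Fif fsn
    (Fpair (Fw (fcell fold_st) fwb (Fif (fk fold_st) (Fw (Fc aFlag) (fany fold_st) (Fc 0))
        (Fw (Fpair (Fc 1) (fk fold_st)) (Fc 1) (Fw (Fc aR) (Fc 1) (Fw (Fc aFlag) (Fc 1) (Fc 0))))))
      (fmain (ftl fold_st) (fdn fold_st) (fr fold_st) (frs fold_st) (Fif (fk fold_st) (fany fold_st) (Fc 1)) (flim fold_st)))
    (Fpair (Fw (fcell fold_st) fwb (Fc 0))
      (fmain (ftl fold_st) (Fcons (Fpair (Fpair (fk fold_st) (fcode fold_st)) (Fpair fhn fsn)) (fdn fold_st))
         (fr fold_st) (frs fold_st) (fany fold_st) (flim fold_st))).
Definition fxnew : fn :=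
  Fpair (Fif (frs fold_st) (Fc 0) (Fw (Fpair (Fc 2) (fr fold_st)) (Fc 0) (Fc 0)))
    (fmain (Fif fb (Fcons (Fpair (Fpair (Fsucc o fr fold_st) (fr fold_st)) (Fpair (Fc 0) (Fsucc o flim fold_st))) (fdn fold_st)) (fdn fold_st))
       (Fc 0) (Fsucc o fr fold_st) (frs fold_st) (fany fold_st) (flim fold_st)).
Definition fxb2 : fn :=
  Fpair (Fc 0) (fmain (Fc 0) (Fif fb (Fc 0)
      (Fcons (Fpair (Fc (npair 0 cb)) (Fpair (Fc 0) (Fif (Fsnd o dat fold_st) (Fc 2) (Fc 1)))) (Fc 0)))
      (Fc 0) (Fsnd o dat fold_st) (Fc 0) (Ffst o dat fold_st)).
Definition fxb : fn :=
  Fpair (Fw (Fc aFlag) (Fc 1) (Fw (Fc aR) (Fc 0) (Fc 0))) (Fpair (Fc 2) (Fpair (tag fold_st) fb)).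
Definition fxq : fn := Fif (Fpred o tag fold_st) fxb (Fif (Fpred o (Fpred o tag fold_st)) fxb2
  (Fif (ftd fold_st) fxnew fxrow)).

Lemma den_faq v : den faq (encq v) = adrq v.
Proof.
by case: v => [[]|lim b|[|[[[k c] h] s] td] dn r rs any lim];
  rewrite /faq /= !(nfstE, nsndE, den_Fc) //= !(nfstE, nsndE, den_Fc).
Qed.

Lemma den_fxq v (b : bool) :
  den fxq (npair (encq v) b) = npair (enc_writes (nxq v b).2) (encq (nxq v b).1).
Proof.
pose X := (nfstE, nsndE, den_Fc).
case: v => [lim|lim rb|[|[[[k c] h] s] td] dn r rs any lim].
- rewrite /fxq [LHS]/= !X.
  have -> : (nat_of_bool lim).-1 == 0 by case: lim.
  by [].
- by rewrite /fxq [LHS]/= !X; case: b; case: rb.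
- by rewrite /fxq [LHS]/= !X; case: b; case: rs.
- have e1 : den fE (npair (encq (Main ((k, c, h, s) :: td) dn r rs any lim)) b) = nfst (iter s nsnd c).
    by rewrite /= !X.
  have e2 : den fe (npair (encq (Main ((k, c, h, s) :: td) dn r rs any lim)) b) = ent c s b.
    rewrite /fe [LHS]/= -/(den fE _) /ent; move: e1; rewrite [den fE _]/= => ->; rewrite nsndE.
    by case: b.
  have -> : den fxq (npair (encq (Main ((k, c, h, s) :: td) dn r rs any lim)) b) =
    den fxrow (npair (encq (Main ((k, c, h, s) :: td) dn r rs any lim)) b).
    by rewrite /fxq /= !X.
  set x := npair _ b in e2 *.
  have ek : den (fk fold_st) x = k by rewrite /x /= !X.
  have ec : den (fcode fold_st) x = c by rewrite /x /= !X.
  have eh : den (fh fold_st) x = h by rewrite /x /= !X.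
  have etl : den (ftl fold_st) x = encl td by rewrite /x /= !X.
  have edn : den (fdn fold_st) x = encl dn by rewrite /x /= !X.
  have er : den (fr fold_st) x = r by rewrite /x /= !X.
  have ers : den (frs fold_st) x = rs by rewrite /x /= !X.
  have ean : den (fany fold_st) x = any by rewrite /x /= !X.
  have eli : den (flim fold_st) x = lim by rewrite /x /= !X.
  have ewb : den fwb x = nat_of_bool (ew (ent c s b)).
    have -> : den fwb x = if nfst (nfst (den fe x)) == 0 then 0 else 1 by [].
    by rewrite e2 /ew; case: eqP.
  have ehn : den fhn x = mvh (emv (ent c s b)) h.
    have -> : den fhn x = if nsnd (nfst (den fe x)) == 0 then (den (fh fold_st) x).-1 else (den (fh fold_st) x).+1 by [].
    by rewrite e2 eh /emv; case: eqP.
  have esn : den fsn x = est (ent c s b).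
    by have -> : den fsn x = nsnd (den fe x) by []; rewrite e2.
  clearbody x.
  rewrite /fxrow /fmain /Fw /Fcons /fcell.
  rewrite !(ewb, ehn, esn, ek, ec, eh, etl, edn, er, ers, ean, eli, dP, dI, dS, den_Fc).
  rewrite [nxq _ _]/=; case: ifP => _ /=; last by [].
  rewrite -[RHS]/(npair _ _); case: eqP => [->|/eqP k0] /=; first by rewrite orbF.
  by rewrite orbT.
Qed.
End Q.

(** * One block of the gap searcher *)

Lemma nxq_uniq cb v b : uniq (unzip1 (nxq cb v b).2).
Proof.
case: v => [lim|lim rb|[|[[[k c] h] s] td] dn r restart any lim] //=.
- by case: restart.
- case: ifP => // _; case: eqP => _ //=; by rewrite ?inE /aFlag /aR /cell /aH !npair_eq.
Qed.

Section Block.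
Variables (d cb : nat) (lim : bool) (X : nat -> bool).
Definition qstep := istep (adrq d) (nxq cb).
Definition qblock m := iter m qstep (Boot lim, X).
Definition beta_on := X (aH d.+1).
Definition restart := X aR.
Definition row_code k := if k == 0 then cb else k.-1.
Definition row_init k := if k == 0 then (if restart then 1 else 2) else (nat_of_bool lim).+1.
(** A restarting row 0 counts as having a blank tape at once, although the memory is cleared only
    gradually. *)
Definition row_tape0 k : nat -> bool := fun j => if (k == 0) && restart then false else X (cell k j).
Definition row_conf k n : rconf := iter n (rstep (row_code k)) (row_init k, 0, row_tape0 k).
Definition live k := if k == 0 then beta_on else ~~ X (aH k).
Definition qmain i := qblock i.+2.
Definition head_key (v : qst) : option nat :=
  if v is Main ((k, _, _, _) :: _) _ _ _ _ _ then Some k else None.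
Definition served k i := \sum_(i' < i) (head_key (qmain i').1 == Some k).
Definition row_key (x : qrow) := x.1.1.1.
Definition row_keys := map row_key.
Definition row_fin k n := (row_conf k n).1.1 == 0.

Lemma cntS k i : served k i.+1 = served k i + (head_key (qmain i).1 == Some k).
Proof. by rewrite /served big_ord_recr. Qed.
Lemma cnt0 k : served k 0 = 0. Proof. by rewrite /served big_ord0. Qed.
Lemma cnt_le k i : served k i <= i.
Proof. by elim: i => [|i IH]; rewrite ?cnt0 // cntS; case: eqP; lia. Qed.
Lemma cnt_mono k i j : i <= j -> served k i <= served k j.
Proof. by elim: j => [|j IH]; [rewrite leqn0 => /eqP->|rewrite leq_eqVlt ltnS => /orP[/eqP->//|/IH]; rewrite cntS; lia]. Qed.
Lemma CS i : qmain i.+1 = qstep (qmain i). Proof. by []. Qed.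

Lemma rcS k n : row_conf k n.+1 = rstep (row_code k) (row_conf k n). Proof. by []. Qed.
Lemma rc_head k n : (row_conf k n).1.2 <= n.
Proof.
elim: n => // n; rewrite rcS /rstep; case: ifP => _ /=; first lia.
by rewrite /mvh; case: ifP => _ h; lia.
Qed.
Lemma rc_far k n j : n <= j -> (row_conf k n).2 j = row_tape0 k j.
Proof.
elim: n => // n IH nj; rewrite rcS /rstep; case: ifP => _; first by apply: IH; lia.
rewrite /= updE; case: eqP => [e|_]; last by apply: IH; lia.
by have := rc_head k n; lia.
Qed.
Lemma fin_mono k n m : row_fin k n -> n <= m -> row_conf k m = row_conf k n.
Proof.
move=> f /subnKC <-; elim: (m - n) => [|p IH]; rewrite ?addn0 // addnS rcS IH /rstep.
by move: f; rewrite /row_fin => ->.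
Qed.

(* In a block that restarts row 0, its cell [r] is cleared in round [r]; until then the
   simulated head has not reached it. *)
Record block_inv i td dn r any Y : Prop := Inv {
  inv_conf : qmain i = (Main td dn r restart any lim, Y);
  inv_uniq : uniq (row_keys (td ++ dn));
  inv_rows : forall x, x \in td ++ dn -> [/\ live (row_key x), row_key x <= r,
     x = (row_key x, row_code (row_key x), (row_conf (row_key x) (served (row_key x) i)).1.2, (row_conf (row_key x) (served (row_key x) i)).1.1) &
     ~~ row_fin (row_key x) (served (row_key x) i)];
  inv_gone : forall k, live k -> k <= r -> k \notin row_keys (td ++ dn) -> row_fin k (served k i);
  inv_tape : forall k j, live k -> ((k == 0) && restart && (r <= j)) \/ Y (cell k j) = (row_conf k (served k i)).2 j;
  inv_new : forall k, r < k -> served k i = 0;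
  inv_H : forall k, 0 < k -> live k -> Y (aH k) = row_fin k (served k i);
  inv_Hold : forall k, 0 < k -> ~~ live k -> Y (aH k);
  inv_any : any <-> exists k, [/\ 0 < k, live k & row_fin k (served k i)];
  inv_R : Y aR = any;
  inv_flag : Y aFlag = any || ~~ (beta_on && row_fin 0 (served 0 i));
  inv_beta : served 0 i <= r /\ (0 \in row_keys td -> served 0 i < r) }.

Definition Y0 := upd (upd X aFlag true) aR false.
Lemma B2 : qmain 0 = (Main [::] (if beta_on then [:: (0, cb, 0, row_init 0)] else [::]) 0 restart false lim, Y0).
Proof.
rewrite /qmain /qblock /= /qstep /istep /= -/Y0.
have -> : Y0 (aH d.+1) = beta_on by rewrite /Y0 !updE !npair_eq.
by rewrite /row_init /=; case: beta_on.
Qed.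

Lemma fin_ini k : row_fin k 0 = false.
Proof. by rewrite /row_fin /row_conf /= /row_init; case: ifP => // _; case: restart. Qed.

Lemma block_inv0 : block_inv 0 [::] (if beta_on then [:: (0, cb, 0, row_init 0)] else [::]) 0 false Y0.
Proof.
split.
- exact: B2.
- by case: beta_on.
- move=> x; rewrite /= -/(beta_on); case eK : beta_on => //; rewrite inE => /eqP->; rewrite /row_key /= cnt0 fin_ini.
  by split=> //; rewrite /live /= eK.
- move=> k; rewrite leqn0 => a /eqP k0; subst k; move: a; rewrite /live /= => ->; by [].
- move=> k j _; rewrite cnt0 /row_conf /= /row_tape0 /Y0 !updE !npair_eq /=.
  by case: (boolP (k == 0)) => _ /=; last (by right); case: restart => /=; [left|right].
- by move=> k _; rewrite cnt0.
- move=> k k0; rewrite /live; case: k k0 => // k _ /= /negbTE a.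
  by rewrite cnt0 fin_ini /Y0 !updE !npair_eq.
- by move=> k k0; rewrite /live; case: k k0 => // k _; rewrite negbK /Y0 !updE !npair_eq.
- by split=> // -[k [_ _]]; rewrite cnt0 fin_ini.
- by rewrite /Y0 updE eqxx.
- by rewrite cnt0 fin_ini andbF /Y0 !updE npair_eq eqxx.
- by rewrite cnt0.
Qed.

Definition advance td dn r any Y : seq qrow * seq qrow * nat * bool * (nat -> bool) :=
  match td with
  | [::] => (if Y (aH r.+1) then dn else (r.+1, r, 0, (nat_of_bool lim).+1) :: dn, [::], r.+1, any,
             if restart then upd Y (cell 0 r) false else Y)
  | (k, c, h, s) :: td =>
      let e := ent c s (Y (cell k h)) in
      if est e == 0 then (td, dn, r, any || (k != 0),
        writes ((cell k h, ew e) :: if k == 0 then [:: (aFlag, any)] else [:: (aH k, true); (aR, true); (aFlag, true)]) Y)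
      else (td, (k, c, mvh (emv e) h, est e) :: dn, r, any, upd Y (cell k h) (ew e))
  end.

Lemma block_invS i td dn r any Y : block_inv i td dn r any Y ->
  let: (td', dn', r', any', Y') := advance td dn r any Y in block_inv i.+1 td' dn' r' any' Y'.
Proof.
case: td => [|[[[k c] h] s] td] I.
  rewrite /=; set td' := if Y (aH r.+1) then _ else _; set Y' := if restart then _ else _.
  have cE k : served k i.+1 = served k i by rewrite cntS (inv_conf I) addn0.
  have nr : r.+1 \notin row_keys dn.
    by apply/negP => /mapP[x xd e]; have [_ h _ _] := inv_rows I xd; move: h; rewrite -e ltnn.
  have tE : td' = if live r.+1 then (r.+1, r, 0, (nat_of_bool lim).+1) :: dn else dn.
    rewrite /td'; case: (boolP (live r.+1)) => a; last by rewrite (inv_Hold I).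
    by rewrite (inv_H I) // (inv_new I) // fin_ini.
  have YE a : a != cell 0 r -> Y' a = Y a.
    by rewrite /Y'; case: restart => //; rewrite updE => /negbTE->.
  have Yc k j : k != 0 -> Y' (cell k j) = Y (cell k j) by move=> k0; apply: YE; rewrite npair_eq eqSS eqSS (negbTE k0).
  have Yh k : Y' (aH k) = Y (aH k) by apply: YE; rewrite npair_eq.
  split.
  - rewrite CS (inv_conf I) /qstep /istep /= -/td' /Y'; congr (_, _); by case: restart.
  - rewrite cats0 tE; case: ifP => _; last exact: (inv_uniq I).
    by rewrite /= nr (inv_uniq I).
  - move=> x; rewrite cats0 tE => xt.
    have [xd|[xe xa]] : x \in dn \/ (x = (r.+1, r, 0, (nat_of_bool lim).+1) /\ live r.+1).
      move: xt; case: (boolP (live r.+1)) => a; last by left.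
      by rewrite inE => /orP[/eqP|]; [right|left].
      have [a b e f] := inv_rows I xd; rewrite cE; split=> //; exact: leqW.
    by rewrite xe /row_key /= cE (inv_new I) // fin_ini; split.
  - move=> k ak; rewrite cats0 cE tE leq_eqVlt ltnS => /orP[/eqP e|kr] kn.
      by move: kn; rewrite -e ak /= inE eqxx.
    apply: (inv_gone I) => //; apply: contra kn => kd; case: ifP => // _; by rewrite /= inE kd orbT.
  - move=> k j ak; rewrite cE; case: (boolP (k == 0)) => [/eqP k0|k0] /=; last first.
      by right; rewrite Yc //; have := inv_tape I j ak; rewrite (negbTE k0) => -[].
    subst k; case: (boolP (restart && (r < j))) => [|h]; [by left|right].
    have := inv_tape I j ak; rewrite eqxx /=; move: h; rewrite /Y'; case ers : restart => //= h; last by case.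
    (* Row 0 has been served at most [r] times, so it has not yet written to its cell [r], and
       clearing that cell agrees with its simulated tape. *)
    rewrite updE npair_eq eqxx /=; case: eqP => [->|ne].
      by move=> _; rewrite rc_far ?(proj1 (inv_beta I)) // /row_tape0 ers.
    by case=> // h'; lia.
  - by move=> k rk; rewrite cE (inv_new I) //; lia.
  - by move=> k k0 ak; rewrite Yh cE (inv_H I).
  - by move=> k k0 ak; rewrite Yh (inv_Hold I).
  - by rewrite (inv_any I); split=> -[k]; rewrite ?cE => h; exists k; rewrite ?cE.
  - by rewrite YE ?(inv_R I) // npair_eq.
  - by rewrite YE ?(inv_flag I) ?cE // npair_eq.
  - by rewrite cE; have [h _] := inv_beta I; split; lia.
have xin : (k, c, h, s) \in ((k, c, h, s) :: td) ++ dn by rewrite mem_head.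
have [ak kr [ec eh es] nf] := inv_rows I xin.
have kE : row_key (k, c, h, s) = k by [].
rewrite kE in ak kr ec eh es nf.
have cE k' : served k' i.+1 = served k' i + (k == k') by rewrite cntS (inv_conf I) /= -[Some _ == _]/(k == k').
have cN k' : k' != k -> served k' i.+1 = served k' i by rewrite cE eq_sym => /negbTE->; rewrite addn0.
have cK : served k i.+1 = (served k i).+1 by rewrite cE eqxx addn1.
(* The only doubtful case is a restarting row 0; waiting for its turn, it has been served fewer than
   [r] times, so its head is on a cell already cleared. *)
have bE : Y (cell k h) = (row_conf k (served k i)).2 h.
  case: (inv_tape I h ak) => // /andP[/andP[/eqP k0 _] rh].
  have k0td : 0 \in row_keys ((k, c, h, s) :: td) by rewrite k0 mem_head.
  have := proj2 (inv_beta I) k0td; have := rc_head k (served k i); rewrite -eh k0; lia.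
set e := ent c s (Y (cell k h)).
have rE : row_conf k (served k i.+1) = (est e, mvh (emv e) h, upd (row_conf k (served k i)).2 h (ew e)).
  rewrite cK rcS /rstep -eh -es -ec -bE -/e.
  by case: eqP => // s0; move: nf; rewrite /row_fin -es s0.
have fE : row_fin k (served k i.+1) = (est e == 0) by rewrite /row_fin rE.
have uq := inv_uniq I.
have ntd : k \notin row_keys (td ++ dn) by move: uq; rewrite /= => /andP[].
have iN x : x \in td ++ dn -> row_key x != k.
  by move=> xt; apply: contra ntd => /eqP <-; apply: map_f.
have xsub x : x \in td ++ dn -> x \in ((k, c, h, s) :: td) ++ dn.
  by rewrite inE => ->; rewrite orbT.
rewrite /advance -/e; case e0 : (est e == 0).
  set Y' := writes _ _.
  have Yc k' j : Y' (cell k' j) = if (k' == k) && (j == h) then ew e else Y (cell k' j).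
    by rewrite /Y' /=; case: eqP => _ /=; rewrite !updE !npair_eq /= !eqSS.
  have Yh k' : 0 < k' -> Y' (aH k') = (k' == k) || Y (aH k').
    move=> k'0; rewrite /Y' /=; case: eqP => k0 /=; rewrite !updE !npair_eq /=.
      by rewrite k0 (gtn_eqF k'0).
    by case: ifP.
  have any8 : (any || (k != 0)) <-> exists k', [/\ 0 < k', live k' & row_fin k' (served k' i.+1)].
    split.
      move=> /orP[/(inv_any I)[k' [a b f]]|k0]; last by exists k; rewrite fE e0 lt0n.
      exists k'; split=> //; case: (eqVneq k' k) => [->|ne]; first by rewrite fE.
      by rewrite cN.
    move=> [k' [a b]]; case: (eqVneq k' k) => [<-|ne]; first by rewrite -lt0n a orbT.
    rewrite cN // => f; apply/orP; left; apply/(inv_any I); by exists k'.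
  split.
  - by rewrite CS (inv_conf I) /qstep /istep /= -/e e0.
  - by move: uq => /= /andP[].
  - by move=> x xt; rewrite cN ?iN //; apply: (inv_rows I); apply: xsub.
  - move=> k' ak' kr' kn; case: (eqVneq k' k) => [->|ne]; first by rewrite fE.
    by rewrite cN //; apply: (inv_gone I) => //; rewrite /= inE negb_or ne.
  - move=> k' j ak'; case: (eqVneq k' k) => [->|ne]; last by rewrite Yc (negbTE ne) cN //; apply: (inv_tape I).
    rewrite rE Yc eqxx /= updE; case: (eqVneq j h) => [->|_]; [by right|exact: (inv_tape I)].
  - move=> k' rk'; rewrite cN; [exact: (inv_new I)|lia].
  - move=> k' k'0 ak'; rewrite Yh //; case: (eqVneq k' k) => [->|ne]; first by rewrite fE.
    by rewrite cN // (inv_H I).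
  - by move=> k' k'0 nak; rewrite Yh // (inv_Hold I) ?orbT.
  - exact: any8.
  - rewrite /Y' /=; case: eqP => k0 /=; rewrite !updE !npair_eq /= ?orbT //.
    by rewrite (inv_R I) orbF.
  - rewrite /Y' /=; case: (eqVneq k 0) => [k0|k0] /=; rewrite updE eqxx ?orbT //.
    by move: fE; rewrite k0 => ->; rewrite e0; move: ak; rewrite k0 /live /= => ->; rewrite /= !orbF.
  - have [a b] := inv_beta I; rewrite cE; case: eqP => [k0|k0] /=.
      have k0td : 0 \in row_keys ((k, c, h, s) :: td) by rewrite k0 mem_head.
      have := b k0td; split; first lia.
      by move=> h0; move: ntd; rewrite k0 /row_keys map_cat mem_cat h0.
    rewrite addn0; split=> // h0; apply: b; by rewrite /= inE h0 orbT.
set Y' := upd _ _ _.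
have Yc k' j : Y' (cell k' j) = if (k' == k) && (j == h) then ew e else Y (cell k' j).
  by rewrite /Y' !updE !npair_eq /= !eqSS.
have YE a : (forall j, a != cell k j) -> Y' a = Y a by rewrite /Y' updE => /(_ h)/negbTE->.
have Yh k' : Y' (aH k') = Y (aH k') by apply: YE => j; rewrite npair_eq.
split.
- by rewrite CS (inv_conf I) /qstep /istep /= -/e e0.
- rewrite /row_keys map_cat /=; have := uniq_catCA (map row_key td) [:: k] (map row_key dn).
  by rewrite /= => ->; move: uq; rewrite /row_keys map_cat.
- move=> x; rewrite mem_cat inE orbCA => /orP[/eqP->|].
    by rewrite /row_key /= rE fE e0 -ec.
  rewrite -mem_cat => xt; rewrite cN ?iN //; apply: (inv_rows I); exact: xsub.
- move=> k' ak' kr' kn; have ne : k' != k.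
    by apply: contra kn => /eqP->; rewrite /row_keys map_cat mem_cat /= inE eqxx orbT.
  rewrite cN //; apply: (inv_gone I) => //; rewrite /= inE negb_or ne /=; apply: contra kn.
  by rewrite /row_keys !map_cat !mem_cat /= inE => /orP[->//|->]; rewrite !orbT.
- move=> k' j ak'; case: (eqVneq k' k) => [->|ne]; last by rewrite Yc (negbTE ne) cN //; apply: (inv_tape I).
  rewrite rE Yc eqxx /= updE; case: (eqVneq j h) => [->|_]; [by right|exact: (inv_tape I)].
- move=> k' rk'; rewrite cN; [exact: (inv_new I)|lia].
- move=> k' k'0 ak'; rewrite Yh (inv_H I) //; case: (eqVneq k' k) => [->|ne]; last by rewrite cN.
  by rewrite fE e0 (negbTE nf).
- by move=> k' k'0 nak; rewrite Yh (inv_Hold I).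
- rewrite (inv_any I); split=> -[k' [a b]]; case: (eqVneq k' k) => [->|ne]; rewrite ?fE ?e0 ?(negbTE nf) // ?cN // => f;
  by exists k'; rewrite ?cN.
- by rewrite YE ?(inv_R I) // => j; rewrite npair_eq.
- rewrite YE ?(inv_flag I) // => [|j]; last by rewrite npair_eq.
  by case: (eqVneq k 0) => [k0|k0]; [rewrite -k0 fE e0 (negbTE nf)|rewrite cN // eq_sym].
- have [a b] := inv_beta I; rewrite cE; case: eqP => [k0|k0] /=.
    have k0td : 0 \in row_keys ((k, c, h, s) :: td) by rewrite k0 mem_head.
    have := b k0td; split; first lia.
    by move=> h0; move: ntd; rewrite k0 /row_keys map_cat mem_cat h0.
  rewrite addn0; split=> // h0; apply: b; by rewrite /= inE h0 orbT.
Qed.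

Lemma block_inv_ex i : exists td dn r any Y, block_inv i td dn r any Y.
Proof.
elim: i => [|i [td [dn [r [any [Y /block_invS]]]]]]; first by do 5!eexists; apply: block_inv0.
by case: advance => [[[[td' dn'] r'] any'] Y'] I; exists td', dn', r', any', Y'.
Qed.

Lemma hd_td i td dn r any Y : block_inv i td dn r any Y -> head_key (qmain i).1 = ohead (row_keys td).
Proof. by move=> I; rewrite (inv_conf I); case: td I => [|[[[k c] h] s] td]. Qed.

Lemma row_turn mu i td dn r any Y k : block_inv i td dn r any Y -> k \in row_keys (td ++ dn) ->
  (if k \in row_keys td then index k (row_keys td) else (size td).*2 + size dn + 2) <= mu ->
  exists i', [/\ i <= i', served k i' = served k i & head_key (qmain i').1 = Some k].
Proof.
elim: mu i td dn r any Y => [|mu IH] i td dn r any Y I kt.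
  case: ifP => [ktd|_]; last by rewrite addn2.
  rewrite leqn0 => /eqP e; exists i; split=> //; rewrite (hd_td I).
  by case: (td) ktd e => //= x l; rewrite inE eq_sym; case: eqP => [->|].
case: td I kt => [|x td] I kt.
  rewrite /= => hm; have := block_invS I; rewrite /advance.
  set td' := if Y _ then _ else _; move=> I'.
  have kt' : k \in row_keys td' by rewrite /td'; case: ifP => _ //; rewrite /= inE kt orbT.
  have hm' : index k (row_keys td') <= mu.
    have : index k (row_keys td') < size td' by rewrite -(size_map row_key) index_mem.
    have : size td' <= (size dn).+1 by rewrite /td'; case: ifP.
    by move: hm; rewrite double0; lia.
  have [||i' [a b e]] := IH _ _ _ _ _ _ I'; [by rewrite cats0|by rewrite kt'|].
  by exists i'; split; [lia|rewrite b cntS (hd_td I) addn0|].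
case: (eqVneq (row_key x) k) => [e _|ne].
  by exists i; split=> //; rewrite (hd_td I) /= e.
have ne' : (row_key x == k) = false by apply/negbTE.
have cS : served k i.+1 = served k i by rewrite cntS (hd_td I) /= -[Some _ == _]/(row_key x == k) ne' addn0.
have kt1 : k \in row_keys (td ++ dn) by move: kt; rewrite /= inE eq_sym ne'.
rewrite /= inE eq_sym ne' /= => hm.
have := block_invS I; case aE : (advance (x :: td) dn r any Y) => [[[[td' dn'] r'] any'] Y'] I'.
have [e1 e2] : td' = td /\ (dn' = dn \/ exists2 y, dn' = y :: dn & row_key y = row_key x).
  move: aE; case: (x) => [[[k1 c1] h1] s1] /=; case: ifP => _ [<- <- _ _ _]; split=> //; first by left.
  by right; eexists; first reflexivity.
subst td'.
have [||i' [a b e]] := IH _ _ _ _ _ _ I'.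
- case: e2 => [->//|[y -> ey]]; move: kt1; rewrite /row_keys !map_cat !mem_cat /= inE => /orP[->//|->]; by rewrite !orbT.
- have : size dn' <= (size dn).+1 by case: e2 => [->|[y -> _]].
  move: hm; case: ifP => _; rewrite ?doubleS; lia.
- by exists i'; split; [lia|rewrite b cS|].
Qed.

Lemma to_round i td dn r any Y : block_inv i td dn r any Y ->
  exists i' dn' any' Y', block_inv i' [::] dn' r any' Y'.
Proof.
move e : (size td) => n; elim: n i td dn any Y e => [|n IH] i [|x td] dn any Y //= e I.
  by exists i, dn, any, Y.
have := block_invS I; case aE : (advance (x :: td) dn r any Y) => [[[[td' dn'] r'] any'] Y'] I'.
have [e1 e2] : td' = td /\ r' = r.
  by move: aE; case: (x) => [[[k1 c1] h1] s1] /=; case: ifP => _ [<- _ <- _ _].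
subst td' r'; apply: IH I'; by case: e.
Qed.

Lemma round p : exists i dn any Y, block_inv i [::] dn p any Y.
Proof.
elim: p => [|p [i [dn [any [Y /block_invS]]]]]; first by do 4!eexists; apply: block_inv0.
exact: to_round.
Qed.

Lemma cnt_reach k n : live k -> (forall n', n' < n -> ~~ row_fin k n') -> exists i, served k i = n.
Proof.
move=> ak; elim: n => [|n IH] H; first by exists 0; rewrite cnt0.
have [i [td [dn [r [any [Y [I ci kr]]]]]]] : exists i td dn r any Y, [/\ block_inv i td dn r any Y, served k i = n & k <= r].
  case: n IH H => [|n] IH H.
    case: (posnP k) => [->|k0].
      by have [td [dn [r [any [Y I]]]]] := block_inv_ex 0; do 6!eexists; split; [apply: I|rewrite cnt0|].
    have [i [dn [any [Y I]]]] := round k.-1; have := block_invS I; rewrite /advance => I'.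
    do 6!eexists; split; [apply: I'| |by rewrite prednK].
    by rewrite cntS (hd_td I) addn0; apply: (inv_new I); rewrite prednK.
  have [|i ei] := IH; first by move=> n' hn'; apply: H; lia.
  have [td [dn [r [any [Y I]]]]] := block_inv_ex i; exists i, td, dn, r, any, Y; split=> //.
  by rewrite leqNgt; apply/negP => /(inv_new I); rewrite ei.
have kin : k \in row_keys (td ++ dn).
  apply: contraT => /(inv_gone I ak kr); rewrite ci; by rewrite (negbTE (H n (ltnSn n))).
have [i' [_ e1 e2]] := row_turn I kin (leqnn _).
by exists i'.+1; rewrite cntS e1 ci e2 eqxx addn1.
Qed.

Lemma CE i : qblock i.+2 = qmain i. Proof. by []. Qed.
Lemma Bmem m : m <= 2 -> exists f r, (qblock m).2 = upd (upd X aFlag f) aR r.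
Proof.
case: m => [|[|[|//]]] _; last 1 first.
- by exists true, false; have -> : qblock 2 = qmain 0 by []; rewrite B2.
- by exists (X aFlag), (X aR); rewrite !upd_id.
- by exists true, false.
Qed.

Lemma bk_H1 k m : 0 < k -> ~~ live k -> (qblock m).2 (aH k).
Proof.
move=> k0 nak; case: (leqP m 2) => [/Bmem[f [r ->]]|].
  by rewrite !updE !npair_eq /=; move: nak; rewrite /live; case: k k0 => //= k _; rewrite negbK.
case: m => [|[|m]] // _; have [td [dn [r [any [Y I]]]]] := block_inv_ex m.
by rewrite CE (inv_conf I) /= (inv_Hold I).
Qed.
Lemma bk_H0 k m : 0 < k -> live k -> (forall n, ~~ row_fin k n) -> (qblock m).2 (aH k) = false.
Proof.
move=> k0 ak nf; case: (leqP m 2) => [/Bmem[f [r ->]]|].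
  by rewrite !updE !npair_eq /=; move: ak; rewrite /live; case: k k0 {nf} => //= k _ /negbTE.
case: m => [|[|m]] // _; have [td [dn [r [any [Y I]]]]] := block_inv_ex m.
by rewrite CE (inv_conf I) /= (inv_H I) // (negbTE (nf _)).
Qed.
Lemma bk_cell2 k j m : live k -> ~~ ((k == 0) && restart) ->
  exists n, (qblock m).2 (cell k j) = (row_conf k n).2 j.
Proof.
move=> ak nr; case: (leqP m 2) => [/Bmem[f [r ->]]|].
  by exists 0; rewrite !updE !npair_eq /= /row_conf /= /row_tape0 (negbTE nr).
case: m => [|[|m]] // _; have [td [dn [r [any [Y I]]]]] := block_inv_ex m.
exists (served k m); rewrite CE (inv_conf I) /=; case: (inv_tape I j ak) => //.
by rewrite (negbTE nr).
Qed.
(** By fairness the row makes infinitely many steps. In a restarting block the stored cell [j] of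
    row 0 is reliable only after round [j], but up to then the row has not written to it, so no
    value is missed. *)
Lemma bk_cell k j : live k -> (forall n, ~~ row_fin k n) ->
  bsim (fun n => (row_conf k n).2 j) (fun m => (qblock m).2 (cell k j)).
Proof.
move=> ak nf.
have rmono i td dn r any Y i' td' dn' r' any' Y' :
   block_inv i td dn r any Y -> block_inv i' td' dn' r' any' Y' -> i <= i' -> r <= r'.
  move=> I I' /subnKC; move: (i' - i) => p e; subst i'; elim: p td' dn' r' any' Y' I' => [|p IH] td' dn' r' any' Y' I'.
    by move: (inv_conf I'); rewrite addn0 (inv_conf I) => -[_ _ -> _ _].
  have [td2 [dn2 [r2 [any2 [Y2 I2]]]]] := block_inv_ex (i + p).
  apply: leq_trans (IH _ _ _ _ _ I2) _.
  have := block_invS I2; case aE : advance => [[[[td3 dn3] r3] any3] Y3] I3.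
  have -> : r' = r3 by move: (inv_conf I'); rewrite addnS (inv_conf I3) => -[_ _ -> _ _].
  move: aE; case: (td2) => [|[[[k1 c1] h1] s1] td4] /=; first by case=> _ _ <-.
  by case: ifP => _ [_ _ <-].
have [i0' [V W]] : exists i0', (forall i, i0' <= i -> (qmain i).2 (cell k j) = (row_conf k (served k i)).2 j) /\
    forall n, n <= served k i0' -> (row_conf k n).2 j = (row_conf k (served k i0')).2 j.
  case: (boolP ((k == 0) && restart)) => [/andP[/eqP k0 _]|nm]; last first.
    exists 0; split=> [i _|n]; last by rewrite cnt0 leqn0 => /eqP->.
    have [td [dn [r [any [Y I]]]]] := block_inv_ex i; rewrite (inv_conf I).
    by case: (inv_tape I j ak) => //; rewrite (negbTE nm).
  have [i [dn [any [Y I]]]] := round j; have := block_invS I; rewrite /advance => I0.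
  have cj : served k i.+1 <= j by rewrite cntS (hd_td I) addn0 k0; case: (inv_beta I).
  exists i.+1; split=> [i' hi|n hn]; last by rewrite !rc_far //; lia.
  have [td' [dn' [r' [any' [Y' I']]]]] := block_inv_ex i'; rewrite (inv_conf I').
  by case: (inv_tape I' j ak) => // /andP[_ rj]; have := rmono _ _ _ _ _ _ _ _ _ _ _ _ I0 I' hi; lia.
have rch n : exists i, served k i = n by apply: cnt_reach => // n' _; apply: nf.
split=> n; have [i ei] := rch n.
  case: (leqP i0' i) => hi.
    exists i.+2; first by rewrite -ei; have := cnt_le k i; lia.
    by rewrite CE V // ei.
  exists i0'.+2; first by rewrite -ei; have := cnt_le k i; lia.
  by rewrite CE V // (W n) // -ei; apply: cnt_mono; lia.
exists (maxn i i0').+2 => -[|[|m]] // hm.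
exists (served k m); last by rewrite CE V //; lia.
by rewrite -ei; apply: cnt_mono; lia.
Qed.

Lemma fin_hit k n : live k -> row_fin k n -> exists i, forall i', i <= i' -> row_fin k (served k i').
Proof.
move=> ak fn; have ex : exists n, row_fin k n by exists n.
case: (ex_minnP ex) => n0 f0 h0; have [i1 e1] : exists i, served k i = n0.
  by apply: cnt_reach => // n' hn'; apply/negP => /h0; lia.
exists i1 => i' /(cnt_mono k); rewrite e1 => /(fin_mono f0); by rewrite /row_fin => ->.
Qed.
Lemma bk_halt k n : 0 < k -> live k -> row_fin k n ->
  exists M, forall m, M <= m -> [/\ (qblock m).2 (aH k), (qblock m).2 aR & (qblock m).2 aFlag].
Proof.
move=> k0 ak fn; have [i hi] := fin_hit ak fn; exists i.+2 => -[|[|m]] // hm.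
have [td [dn [r [any [Y I]]]]] := block_inv_ex m; rewrite CE (inv_conf I) /=.
have f := hi m hm; have a : any by apply/(inv_any I); exists k.
by rewrite (inv_H I) // (inv_R I) (inv_flag I) a.
Qed.
Lemma bk_R0 m : (forall k n, 0 < k -> live k -> ~~ row_fin k n) -> 0 < m -> (qblock m).2 aR = false.
Proof.
move=> nf; case: m => [//|[|m]] _; first by rewrite /qblock /= updE eqxx.
have [td [dn [r [any [Y I]]]]] := block_inv_ex m; rewrite CE (inv_conf I) /= (inv_R I).
by apply/negP => /(inv_any I)[k [a b]]; apply/negP; apply: nf.
Qed.
(** Since every block raises the flag, it reads 1 at each limit of blocks; a 0 can appear only at a
    stage [v + omega]. *)
Lemma bk_flag1 : (qblock 1).2 aFlag.
Proof. by rewrite /qblock /= !updE npair_eq. Qed.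
Lemma bk_flag0 m : 0 < m -> (qblock m).2 aFlag = false -> beta_on /\ exists n, row_fin 0 n.
Proof.
case: m => [//|[|m]] _; first by rewrite bk_flag1.
have [td [dn [r [any [Y I]]]]] := block_inv_ex m; rewrite CE (inv_conf I) /= (inv_flag I).
by move/negbT; rewrite negb_or negbK => /andP[_ /andP[? ?]]; split=> //; exists (served 0 m).
Qed.
Lemma bk_flagE n : beta_on -> row_fin 0 n -> (forall k n, 0 < k -> live k -> ~~ row_fin k n) ->
  exists M, forall m, M <= m -> (qblock m).2 aFlag = false.
Proof.
move=> eK fn nf; have [i hi] := @fin_hit 0 n eK fn; exists i.+2 => -[|[|m]] // hm.
have [td [dn [r [any [Y I]]]]] := block_inv_ex m; rewrite CE (inv_conf I) /= (inv_flag I) eK hi // orbF.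
by apply/negP => /(inv_any I)[k [a b]]; apply/negP; apply: nf.
Qed.
End Block.

(** * The gap searcher along the stages *)

Section NLim.
Variable T : stages.
(** The relation [w = l + omega]. *)
Definition nlim (l w : wcar T) :=
  [/\ lz w, l <! w, forall n, add l n <! w & forall x, x <! w -> exists n, x <=! add l n].
Lemma nlim_ex l t : lz t -> l <! t -> exists2 w, nlim l w & w <=! t.
Proof.
move=> ht lt; have [w hw [a [b [c e]]]] := nxt_lim_ex lt (fun n => lz_add n ht lt).
by exists w.
Qed.
Lemma nlim_ev A (f : wcar T -> A -> bool) l w a b M : lz l -> nlim l w ->
  (forall m, M <= m -> f (add l m) a = b) -> limsup f w a = b.
Proof.
move=> hl [hw lw h1 h2] H; case: b H => H.
  apply: limsup1 => s /h2[n hn]; exists (add l (maxn n M)); split.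
    by apply: (sle_trans hn); apply: add_le; apply: leq_maxl.
  by split=> //; apply: H; apply: leq_maxr.
apply: (@limsup0 _ _ _ _ _ (add l M)) => // u su /h2[n hn].
have [] := @blk_le_lt _ l (add l M) u M n.+1 erefl hl su.
  by apply: sle_lt_trans hn _; rewrite addS; apply: sc_gt.
by move=> j -> /andP[hj _]; apply: H.
Qed.
End NLim.

Section Global.
Variables (T : stages) (z : wcar T) (d cb : nat).
Hypothesis z0 : forall x : wcar T, z <=! x.
Lemma hz : lz z. Proof. by move=> y /(sle_nlt (z0 y)). Qed.
Definition QS := isys (Boot false) (Boot true) (adrq d) (nxq cb).
Notation rq := (run QS z).
Definition qmem (t : wcar T) (a : nat) : bool := (rq t).2 a.
Definition is_lim (l : wcar T) : bool := `[< z <! l >].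
(* Row [k > 0] runs the program of code [k.-1]. *)
Definition row_stop k t := stt (Pr k.-1) z t = ah (Pr k.-1).
Definition halted k t := exists2 u, u <! t & row_stop k u.
(** By [nh_clk] and [clk_nh], for [l] zero or a limit: the block of [l] contains a clockable
    stage. *)
Definition new_stop l := exists k n, [/\ 0 < k, ~ halted k l & row_stop k (add l n)].

Lemma rq_lz l : lz l -> rq l = (Boot (is_lim l), qmem l).
Proof.
rewrite /qmem => hl; case: (z0 l) => [zl|<-]; last by rewrite run_z /is_lim; case: asboolP => // /slt_irr.
by rewrite {1}run_lim // [in RHS]run_lim // /is_lim; case: asboolP.
Qed.
Lemma rq_blk l m : lz l -> rq (add l m) = qblock d cb (is_lim l) (qmem l) m.
Proof. by move=> hl; rewrite run_add ?rq_lz. Qed.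
Lemma qm_blk l m a : lz l -> qmem (add l m) a = (qblock d cb (is_lim l) (qmem l) m).2 a.
Proof. by move=> hl; rewrite /qmem rq_blk. Qed.
Lemma qm_lim t a : lz t -> z <! t -> qmem t a = limsup qmem t a.
Proof. by move=> ht zt; apply: (@mem_lim _ QS). Qed.

Lemma rproj_lz c w (l : wcar T) : lz l -> w <=! l -> rproj (run (asys (Pr c)) w l) =
  (if `[< w <! l >] then 2 else 1, 0, (run (asys (Pr c)) w l).2 ord0).
Proof.
move=> hl [wl|<-]; first by rewrite run_lim // /rproj /= inordK //; case: asboolP.
by rewrite run_z /rproj /= inordK //; case: asboolP => // /slt_irr.
Qed.
Lemma rproj_blk c w (l : wcar T) n : w <=! l ->
  rproj (run (asys (Pr c)) w (add l n)) = iter n (rstep c) (rproj (run (asys (Pr c)) w l)).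
Proof. by move=> wl; rewrite run_add // -rproj_iter. Qed.
Lemma rproj_fin c w (t : wcar T) : ((rproj (run (asys (Pr c)) w t)).1.1 == 0) <-> stt (Pr c) w t = ah (Pr c).
Proof.
rewrite /rproj /stt /=; split=> [/eqP e|->]; last by rewrite inordK.
by apply: val_inj; rewrite /= inordK.
Qed.

Lemma row_sync k l : lz l -> 0 < k ->
  (forall j, qmem l (cell k j) = (run (asys (Pr k.-1)) z l).2 ord0 j) ->
  forall n, row_conf cb (is_lim l) (qmem l) k n = rproj (run (asys (Pr k.-1)) z (add l n)).
Proof.
move=> hl k0 H n; rewrite rproj_blk // rproj_lz // /row_conf /row_code /row_init -/(is_lim l) (gtn_eqF k0).
rewrite (_ : row_tape0 (qmem l) k = (run (asys (Pr k.-1)) z l).2 ord0); first by case: (is_lim l).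
by apply: funext => j; rewrite /row_tape0 (gtn_eqF k0) /= H.
Qed.

Lemma hal_mono k s t : s <=! t -> halted k s -> halted k t.
Proof. by move=> st [u us pu]; exists u => //; apply: slt_le_trans st. Qed.

(** The claims are proved together because marks decide which rows a block serves and stored tapes
    decide when these halt. A mark is 1 on a final segment of the block of halting and throughout
    all later blocks; before that, [bk_cell] and [limsup_sim] keep the tape correct. *)
Lemma rq_H t k : lz t -> 0 < k -> (qmem t (aH k) <-> halted k t) /\
  (~ halted k t -> forall j, qmem t (cell k j) = (run (asys (Pr k.-1)) z t).2 ord0 j).
Proof.
move=> ht k0; elim/(well_founded_ind (@wlt_wf T)): t ht => t IH ht.
case: (z0 t) => [zt|<-]; last first.
  rewrite /qmem !run_z; split=> //; split=> // -[u /(sle_nlt (z0 u))] //.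
have actE l : lz l -> l <! t -> live d (qmem l) k <-> ~ halted k l.
  move=> hl lt; rewrite /live (gtn_eqF k0); have [<- _] := IH l lt hl.
  by split=> [/negP|/negP].
have [[u ut pu]|nhal] := pselect (halted k t).
  split; last by case; exists u.
  split=> [_|_]; first by exists u.
  rewrite qm_lim //; apply: limsup1 => s st.
  have [s' [ss' us' s't]] : exists s', [/\ s <=! s', u <=! s' & s' <! t].
    by case: (slt_or s u) => h; [exists u; split; [left|right|]|exists s; split; [right| |]].
  have [l' [n' [hl' es']]] := decomp s'.
  have l't : l' <! t by apply: sle_lt_trans s't; rewrite es'; apply: add_ge.
  have [hk|nk] := pselect (halted k l').
    exists s'; split=> //; split=> //; rewrite es' qm_blk //; apply: bk_H1 => //.
    by apply/negP => /(actE _ hl' l't).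
  have lu : l' <=! u by apply: nlt_sle => ul; apply: nk; exists u.
  have [n e _] := @blk_le_lt _ l' l' u 0 n'.+1 erefl hl' lu (ltac:(apply: sle_lt_trans us' _; rewrite es' addS; apply: sc_gt)).
  have fn : row_fin cb (is_lim l') (qmem l') k n.
    rewrite /row_fin row_sync //; last by have [_] := IH l' l't hl'; apply.
    by apply/rproj_fin; rewrite -e.
  have [M HM] := bk_halt k0 ((actE _ hl' l't).2 nk) fn.
  exists (add l' (maxn n' M)); split; last split.
  - by apply: (sle_trans ss'); rewrite es'; apply: add_le; apply: leq_maxl.
  - exact: lz_add.
  - by rewrite qm_blk //; have [] := HM _ (leq_maxr n' M).
have nl l : l <! t -> ~ halted k l by move=> lt h; apply: nhal; apply: hal_mono h; left.
have sync l : lz l -> l <! t -> forall n, row_conf cb (is_lim l) (qmem l) k n = rproj (run (asys (Pr k.-1)) z (add l n)).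
  by move=> hl lt; apply: row_sync => //; have [_] := IH l lt hl; apply; apply: nl.
have nf l n : lz l -> l <! t -> ~~ row_fin cb (is_lim l) (qmem l) k n.
  move=> hl lt; rewrite /row_fin sync //; apply/negP => /rproj_fin h; apply: nhal.
  by exists (add l n) => //; apply: lz_add.
split.
  split=> // h; exfalso; move: h; rewrite qm_lim // (@limsup0 _ _ _ _ _ z) // => u _.
  have [l [n [hl ->]]] := decomp u => ut; have lt : l <! t by apply: sle_lt_trans ut; apply: add_ge.
  by rewrite qm_blk // bk_H0 //; [apply/actE => //; apply: nl|move=> n'; apply: nf].
move=> _ j; have -> : (run (asys (Pr k.-1)) z t).2 ord0 j = amem (run (asys (Pr k.-1)) z t) (ord0, j) by [].
rewrite qm_lim // amem_lim //; symmetry; apply: (limsup_sim hz ht zt) => [l hl zl lt|l m hl zl lt].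
  have := bk_cell (cb := cb) (lim := is_lim l) j ((actE _ hl lt).2 (nl l lt)) (fun n => nf l n hl lt).
  have -> : (fun n => (row_conf cb (is_lim l) (qmem l) k n).2 j) = (fun n => amem (run (asys (Pr k.-1)) z (add l n)) (ord0, j)).
    by apply: funext => n; rewrite sync.
  by have -> : (fun m => (qblock d cb (is_lim l) (qmem l) m).2 (cell k j)) = (fun n => qmem (add l n) (cell k j));
    [apply: funext => m; rewrite qm_blk|].
have nr : ~~ ((k == 0) && restart (qmem l)) by rewrite (gtn_eqF k0).
have [n e] := bk_cell2 cb (is_lim l) j m ((actE _ hl lt).2 (nl l lt)) nr.
by exists n; rewrite qm_blk // e sync.
Qed.

Lemma act_hal l k : lz l -> 0 < k -> live d (qmem l) k <-> ~ halted k l.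
Proof.
move=> hl k0; rewrite /live (gtn_eqF k0); have [<- _] := rq_H hl k0.
by split=> /negP.
Qed.
Lemma fin_pc l k n : lz l -> 0 < k -> ~ halted k l -> row_fin cb (is_lim l) (qmem l) k n <-> row_stop k (add l n).
Proof.
move=> hl k0 nk; rewrite /row_fin row_sync //; last by have [_] := rq_H hl k0; apply.
exact: rproj_fin.
Qed.
Lemma nh_fin l : lz l -> ~ new_stop l -> forall k n, 0 < k -> live d (qmem l) k -> ~~ row_fin cb (is_lim l) (qmem l) k n.
Proof.
move=> hl nn k n k0 /(act_hal hl k0) nk; apply/negP => /(fin_pc _ hl k0 nk) h.
by apply: nn; exists k, n.
Qed.
Lemma nh_ev l : lz l -> new_stop l -> exists M, forall m, M <= m -> qmem (add l m) aR /\ qmem (add l m) aFlag.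
Proof.
move=> hl [k [n [k0 nk h]]].
have [M HM] := bk_halt k0 ((act_hal hl k0).2 nk) ((fin_pc _ hl k0 nk).2 h).
by exists M => m hm; rewrite !qm_blk //; have [] := HM m hm.
Qed.
Lemma nh_R l w : lz l -> new_stop l -> nlim l w -> qmem w aR.
Proof.
move=> hl hn hw; have [M HM] := nh_ev hl hn; have [lw1 lw2 _ _] := hw.
rewrite qm_lim //; last exact: sle_lt_trans lw2.
by apply: (nlim_ev hl hw (M := M)) => m hm; case: (HM m hm).
Qed.
Lemma nnh_R0 l m : lz l -> ~ new_stop l -> 0 < m -> qmem (add l m) aR = false.
Proof. by move=> hl hn m0; rewrite qm_blk // bk_R0 //; apply: nh_fin. Qed.
Lemma R0_after w t : lz w -> lz t -> w <! t ->
  (forall l, lz l -> w <=! l -> l <! t -> ~ new_stop l) -> qmem t aR = false.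
Proof.
move=> hw; elim/(well_founded_ind (@wlt_wf T)): t => t IH ht wt H.
rewrite qm_lim //; last exact: sle_lt_trans wt.
(* At [w] itself the bit may be 1; the first boot step clears it. *)
apply: (@limsup0 _ _ _ _ _ (sc w)); first exact: ht.
move=> u wu ut; have [l [[|m] [hl eu]]] := decomp u; subst u.
  have wl : w <! l by apply: slt_le_trans (sc_gt w) wu.
  by apply: IH => // l' hl' wl' l'l; apply: H => //; apply: slt_trans ut.
have wl : w <=! l by apply: (@blk_le _ _ _ m.+1) => //; apply: sle_trans wu; left; apply: sc_gt.
by apply: nnh_R0 => //; apply: H => //; apply: sle_lt_trans ut; apply: add_ge.
Qed.

Section Beta.
Variable w : wcar T.
Hypotheses (hw : lz w) (Kw : halted d.+1 w) (Rw : qmem w aR).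
Notation rb := (run (asys (Pr cb)) w).

Lemma K_after l : lz l -> w <=! l -> beta_on d (qmem l).
Proof. by move=> hl wl; apply/(rq_H hl (ltn0Sn d)).1; apply: hal_mono Kw. Qed.

Lemma beta_sync l : lz l -> w <=! l -> (w <! l -> qmem l aR = false) ->
  (w <! l -> forall j, qmem l (cell 0 j) = (rb l).2 ord0 j) ->
  forall n, row_conf cb (is_lim l) (qmem l) 0 n = rproj (rb (add l n)).
Proof.
move=> hl wl Rl H n; rewrite rproj_blk // rproj_lz // /row_conf /row_code /row_init /=.
case: (wl) => [wl'|e].
  have rsE : restart (qmem l) = false := Rl wl'.
  rewrite rsE; case: asboolP => // _; congr (iter _ _ (_, _, _)).
  by apply: funext => j; rewrite /row_tape0 rsE H.
have rsE : restart (qmem l) by rewrite /restart -e.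
rewrite rsE; case: asboolP => [|_]; first by rewrite e => /slt_irr.
by congr (iter _ _ (_, _, _)); apply: funext => j; rewrite /row_tape0 rsE /= -e run_z.
Qed.

(** The analogue of the tape part of [rq_H] for a run started at [w]. Stale cells in the block of
    [w] do no harm, since [limsup_sim] asks only for [bsim] there. *)
Lemma beta_cells t : lz t -> w <! t -> (forall l, lz l -> w <! l -> l <! t -> qmem l aR = false) ->
  (forall u, w <=! u -> u <! t -> stt (Pr cb) w u <> ah (Pr cb)) ->
  forall j, qmem t (cell 0 j) = (rb t).2 ord0 j.
Proof.
elim/(well_founded_ind (@wlt_wf T)): t => t IH ht wt HR HH j.
have sync l : lz l -> w <=! l -> l <! t -> forall n, row_conf cb (is_lim l) (qmem l) 0 n = rproj (rb (add l n)).
  move=> hl wl lt; apply: beta_sync => // [wl'|wl']; first exact: HR.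
  apply: IH => // [l' hl' wl'' l'l|u wu ul]; [apply: HR => //|apply: HH => //]; exact: slt_trans lt.
have nf l n : lz l -> w <=! l -> l <! t -> ~~ row_fin cb (is_lim l) (qmem l) 0 n.
  move=> hl wl lt; rewrite /row_fin sync //; apply/negP => /rproj_fin; apply: HH.
    exact: sle_trans wl (add_ge _ _).
  exact: lz_add.
have -> : (rb t).2 ord0 j = amem (rb t) (ord0, j) by [].
have act l : lz l -> w <=! l -> live d (qmem l) 0 by exact: K_after.
rewrite qm_lim //; last exact: sle_lt_trans wt.
rewrite amem_lim //; symmetry; apply: (limsup_sim hw ht wt) => [l hl wl lt|l m hl wl lt].
  have := bk_cell (cb := cb) (lim := is_lim l) j (act l hl wl) (fun n => nf l n hl wl lt).
  have -> : (fun n => (row_conf cb (is_lim l) (qmem l) 0 n).2 j) = (fun n => amem (rb (add l n)) (ord0, j)).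
    by apply: funext => n; rewrite sync.
  by have -> : (fun m => (qblock d cb (is_lim l) (qmem l) m).2 (cell 0 j)) = (fun n => qmem (add l n) (cell 0 j));
    [apply: funext => m; rewrite qm_blk|].
have nr : ~~ ((0 == 0) && restart (qmem l)) by rewrite /= /restart HR.
have [n e] := bk_cell2 cb (is_lim l) j m (act l hl (sltW wl)) nr.
by exists n; rewrite qm_blk // e sync //; left.
Qed.

Lemma beta_fin l n : lz l -> w <=! l -> (forall l', lz l' -> w <! l' -> l' <=! l -> qmem l' aR = false) ->
  (forall u, w <=! u -> u <! l -> stt (Pr cb) w u <> ah (Pr cb)) ->
  row_fin cb (is_lim l) (qmem l) 0 n <-> stt (Pr cb) w (add l n) = ah (Pr cb).
Proof.
move=> hl wl HR HH; rewrite /row_fin beta_sync ?rproj_fin //.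
  by move=> wl'; apply: HR => //; right.
by move=> wl' j; apply: beta_cells => // l' hl' wl'' ll'; apply: HR => //; left.
Qed.

Lemma beta_flag l n t : lz l -> w <=! l -> (forall l', lz l' -> w <! l' -> l' <=! l -> qmem l' aR = false) ->
  halts (Pr cb) w (add l n) -> ~ new_stop l -> nlim l t -> qmem t aFlag = false.
Proof.
move=> hl wl HR [_ [h1 h2]] nn hn.
have fn : row_fin cb (is_lim l) (qmem l) 0 n.
  by apply/beta_fin => // u wu ul; apply: h2 => //; apply: slt_le_trans ul (add_ge _ _).
have [M HM] := bk_flagE (K_after hl wl) fn (nh_fin hl nn).
have [ht lt _ _] := hn; rewrite qm_lim //; last exact: sle_lt_trans lt.
by apply: (nlim_ev hl hn (M := M)) => m hm; rewrite qm_blk // HM.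
Qed.
End Beta.

Lemma Qfire w v n t : lz w -> halted d.+1 w -> qmem w aR -> lz v -> w <=! v ->
  (forall l, lz l -> w <=! l -> l <=! v -> ~ new_stop l) -> halts (Pr cb) w (add v n) -> nlim v t ->
  qmem t aFlag = false.
Proof.
move=> hw Kw Rw hv wv Hn Hh ht; apply: (@beta_flag w hw Kw Rw v n) => //; last by apply: Hn => //; right.
move=> l hl wl lv; apply: (R0_after hw hl wl) => l' hl' wl' l'l; apply: Hn => //.
by left; apply: slt_le_trans l'l lv.
Qed.

Lemma R1_of w : lz w -> z <! w ->
  (forall s, s <! w -> exists l n, [/\ lz l, l <! w, new_stop l & s <=! add l n]) -> qmem w aR.
Proof.
move=> hw zw H; rewrite qm_lim //; apply: limsup1 => s sw.
have [l [n [hl lw hn sl]]] := H s sw.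
have [M HM] := nh_ev hl hn.
exists (add l (maxn n M)); split; last split.
- by apply: sle_trans sl _; apply: add_le; apply: leq_maxl.
- exact: lz_add.
- by case: (HM _ (leq_maxr n M)).
Qed.

Lemma hal_nh k t : lz t -> 0 < k -> halted k t -> exists l, [/\ lz l, l <! t, new_stop l & forall w, lz w -> ~ halted k w -> w <=! l].
Proof.
move=> ht k0 [u0 ut pu].
have [u pu' mu] := wmin (ex_intro (fun u => row_stop k u) u0 pu).
have [l [n [hl eu]]] := decomp u.
have nl : ~ halted k l.
  by move=> [x xl /mu ux]; apply: (sle_nlt ux); apply: slt_le_trans xl _; rewrite eu; apply: add_ge.
exists l; split=> //.
- by apply: sle_lt_trans ut; apply: sle_trans (mu _ pu); rewrite eu; apply: add_ge.
- by exists k, n; rewrite -eu.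
- move=> w hw nw; apply: (@blk_le _ _ _ n) => //; rewrite -eu; apply: nlt_sle => uw; apply: nw; by exists u.
Qed.

(** The converse of [Qfire]: from the first limit with the flag down, recover the block [v] that
    lowered it and the stage [w] of the last restart, and show that the interval between them is
    free of haltings. *)
Lemma Qfired t : lz t -> z <! t -> qmem t aFlag = false ->
  (forall l, lz l -> z <! l -> l <! t -> qmem l aFlag) ->
  exists v w n, [/\ nlim v t, lz v /\ lz w, w <=! v, halted d.+1 w &
    (forall l, lz l -> w <=! l -> l <=! v -> ~ new_stop l) /\ halts (Pr cb) w (add v n)].
Proof.
move=> ht zt; rewrite qm_lim // => hf hfirst; have [s st s0] := limsup0_ex hf.
have [v [n0 [hv es]]] := decomp s.
have vt : v <! t by apply: sle_lt_trans st; rewrite es; apply: add_ge.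
(* A further block starting between [v] and [t] would raise the flag again. *)
have hvt : nlim v t.
  split=> // [n|x xt]; first exact: lz_add.
  have [l [n [hl ex]]] := decomp x; exists n; rewrite ex.
  case: (slt_or v l) => [vl|[lv|->]]; [exfalso|by left; apply: slt_le_trans (lz_add n hv lv) (add_ge _ _)|by right].
  have lt : l <! t by apply: sle_lt_trans xt; rewrite ex; apply: add_ge.
  have e : qmem (add l 1) aFlag = false.
    apply: s0; last exact: lz_add.
    by left; rewrite es; apply: slt_trans (lz_add n0 hl vl) (sc_gt _).
  by move: e; rewrite qm_blk // bk_flag1.
have f0 m : maxn n0 1 <= m -> qmem (add v m) aFlag = false.
  move=> hm; apply: s0; last exact: lz_add.
  by rewrite es; apply: add_le; lia.
have [Kv [nv fv]] : beta_on d (qmem v) /\ exists n, row_fin cb (is_lim v) (qmem v) 0 n.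
  by apply: (@bk_flag0 d cb (is_lim v) (qmem v) (maxn n0 1)); [lia|rewrite -qm_blk // f0].
have nnv : ~ new_stop v.
  move=> /(nh_ev hv)[M HM]; have [_] := HM (maxn M (maxn n0 1)) (leq_maxl _ _).
  by rewrite f0 // leq_maxr.
have halv : halted d.+1 v by apply/(rq_H hv (ltn0Sn d)).1.
have next l : lz l -> new_stop l -> l <! v -> exists w, [/\ lz w, l <! w, w <=! v & qmem w aR].
  move=> hl hn lv; have [w hw wv] := nlim_ex hv lv; have [a b _ _] := hw.
  by exists w; split=> //; apply: nh_R hw.
(* The last restart is the least limit after which [aR] stays 0 up to [v]; [v] itself qualifies
   vacuously. *)
have [w [hw [wv SR]] mw] := wmin (ex_intro (fun l => lz l /\ l <=! v /\ forall l', lz l' -> l <! l' -> l' <=! v -> qmem l' aR = false)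
   v (conj hv (conj (slexx v) (fun l' _ a b => False_ind _ (sle_nlt b a))))).
have [l1 [hl1 l1v nh1 H1]] := hal_nh hv (ltn0Sn d) halv.
have nnw l : lz l -> w <=! l -> l <=! v -> ~ new_stop l.
  move=> hl wl [lv|->//] hn; have [w2 [a b c e]] := next l hl hn lv.
  by move: e; rewrite SR //; apply: sle_lt_trans b.
have halw : halted d.+1 w.
  by apply: contrapT => nw; apply: (nnw l1) => //; [apply: H1|left].
(* If [aR] were 0 at [w], it would be 0 on a final segment below [w], and a smaller stage would
   qualify. *)
have Rw : qmem w aR.
  apply/negP => /negP/negbTE R0; case: (z0 w) => [zw|ez]; last first.
    by case: halw => u; rewrite -ez => /(sle_nlt (z0 u)).
  move: (R0); rewrite qm_lim // => hf1; have [s1 s1w s10] := limsup0_ex hf1.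
  have [l [n [hl es1]]] := decomp s1.
  have lw : l <! w by apply: sle_lt_trans s1w; rewrite es1; apply: add_ge.
  have /sle_nlt : w <=! l.
    apply: mw; split=> //; split; first by left; apply: slt_le_trans wv.
    move=> l' hl' ll' l'v; case: (slt_or w l') => [|[l'w|->//]]; first by move=> ?; apply: SR.
    by apply: s10 => //; left; rewrite es1; apply: lz_add.
  exact.
(* A halt of the replay in an earlier block would have lowered the flag at a limit before [t]. *)
have nhalt u : w <=! u -> u <! v -> stt (Pr cb) w u <> ah (Pr cb).
  move=> wu uv pu.
  have [u1 [wu1 pu1] mu] := wmin (ex_intro (fun u => w <=! u /\ stt (Pr cb) w u = ah (Pr cb)) u (conj wu pu)).
  have u1v : u1 <! v by apply: sle_lt_trans uv; apply: mu.
  have [l [n [hl eu]]] := decomp u1.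
  have wl : w <=! l by apply: (@blk_le _ _ _ n) => //; rewrite -eu.
  have lv : l <! v by apply: sle_lt_trans u1v; rewrite eu; apply: add_ge.
  have [t2 ht2 t2v] := nlim_ex hv lv; have [a b _ _] := ht2.
  have : qmem t2 aFlag.
    by apply: hfirst => //; [apply: sle_lt_trans b|apply: sle_lt_trans vt].
  rewrite (@beta_flag w hw halw Rw l n) //.
  - by move=> l' hl' wl' l'l; apply: SR => //; left; apply: sle_lt_trans l'l lv.
  - rewrite -eu; split=> //; split=> // x wx xu pure_exec.
    by apply: (sle_nlt (mu x (conj wx pure_exec)) xu).
  - by apply: nnw => //; left.
have ex : exists n, stt (Pr cb) w (add v n) == ah (Pr cb).
  by exists nv; apply/eqP; apply/beta_fin.
case: (ex_minnP ex) => n /eqP en mn; exists v, w, n; split=> //; split=> //.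
split; first exact: sle_trans wv (add_ge _ _).
split=> // x wx xv; case: (slt_or x v) => [|vx]; first exact: nhalt.
have [j -> /andP[_ jn]] := @blk_le_lt _ v v x 0 n erefl hv vx xv.
by move/eqP/mn; rewrite leqNgt jn.
Qed.
End Global.

(** * Order types of intervals of stages *)

Lemma nat_lt_wf : well_founded nat_lt.
Proof.
move=> n; elim/ltn_ind: n => n IH; constructor => m; exact: IH.
Qed.
Lemma nat_lt_total m n : nat_lt m n \/ m = n \/ nat_lt n m.
Proof. by rewrite /nat_lt; case: (ltngtP m n); [left|right; right|right; left]. Qed.
Lemma nat_lt_irr n : ~ nat_lt n n. Proof. by rewrite /nat_lt ltnn. Qed.
Lemma nat_lt_trans x y z : nat_lt x y -> nat_lt y z -> nat_lt x z.
Proof. exact: ltn_trans. Qed.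
Definition natwo := Defs.WO nat_lt_irr nat_lt_trans nat_lt_total nat_lt_wf.

Section SumWo.
Variables a b : wo.
Notation R := (sum_rel (@wlt a) (@wlt b)).
Lemma sum_irr x : ~ R x x. Proof. by case: x => x /wlt_irrefl. Qed.
Lemma sum_trans x y z : R x y -> R y z -> R x z.
Proof. by case: x y z => x [] y [] z //=; apply: wlt_trans. Qed.
Lemma sum_total x y : R x y \/ x = y \/ R y x.
Proof.
case: x y => x [] y /=; [|by left|by right; right|];
  by case: (wlt_total x y) => [|[->|]]; [left|right; left|right; right].
Qed.
Lemma sum_wf : well_founded R.
Proof.
have L x : Acc R (inl x).
  apply: (well_founded_ind (@wlt_wf a) (fun x => Acc R (inl x))) => {}x IH.
  by constructor => -[y yx|y []]; apply: IH.
case=> x; first exact: L.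
apply: (well_founded_ind (@wlt_wf b) (fun x => Acc R (inr x))) => {}x IH.
by constructor => -[y _|y yx]; [apply: L|apply: IH].
Qed.
Definition sumwo := Defs.WO sum_irr sum_trans sum_total sum_wf.
End SumWo.

Section Rep.
Variable T : stages.
Section Seg.
Variables w t : wcar T.
Definition segT := {x : wcar T | w <=! x /\ x <! t}.
Definition seglt (x y : segT) := sval x <! sval y.
Lemma seg_irr x : ~ seglt x x. Proof. exact: slt_irr. Qed.
Lemma seg_trans x y u : seglt x y -> seglt y u -> seglt x u. Proof. exact: slt_trans. Qed.
Lemma seg_total x y : seglt x y \/ x = y \/ seglt y x.
Proof.
case: (wlt_total (sval x) (sval y)) => [|[e|]]; [by left|right; left|by right; right].
by case: x y e => [x hx] [y hy] /= e; subst y; congr exist; apply: Prop_irrelevance.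
Qed.
Lemma seg_wf : well_founded seglt.
Proof. by apply: wf_inverse_image; apply: wlt_wf. Qed.
Definition seg := Defs.WO seg_irr seg_trans seg_total seg_wf.
End Seg.

(* The interval [[w, t)] has order type [b]. *)
Definition rep (b : wo) (w t : wcar T) := w <=! t /\ exists f : wcar b -> wcar T,
  order_emb (@wlt b) (@wlt T) f /\ forall x, (w <=! x /\ x <! t) <-> exists y, f y = x.

Lemma rep_seg w t : w <=! t -> rep (seg w t) w t.
Proof.
move=> wt; split=> //; exists (fun x => sval x); split=> [//|x]; split=> [h|[[y h] <-] //].
by exists (exist _ x h).
Qed.

(** The enumeration of an interval is the slowest strictly increasing map into the stages from [w]
    on. *)
Lemma rep_incr (b : wo) w t (f h : wcar b -> wcar T) :
  order_emb (@wlt b) (@wlt T) f -> (forall x, (w <=! x /\ x <! t) <-> exists y, f y = x) ->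
  (forall x y, wlt x y -> h x <! h y) -> (forall x, w <=! h x) -> forall x, f x <=! h x.
Proof.
move=> fe fi hm hw; apply: (well_founded_ind (@wlt_wf b)) => x IH; apply: nlt_sle => hx.
have [_ ft] := (fi (f x)).2 (ex_intro _ x erefl).
have [y e] := (fi (h x)).1 (conj (hw x) (slt_trans hx ft)).
have yx : wlt y x by apply/fe; rewrite e.
by apply: (sle_nlt (IH y yx)); rewrite e; apply: hm.
Qed.

(** Collapse of [h] onto an interval: [f y] is the least stage from [w] on above all earlier values.
    By induction it is at most [h y], so such a stage always exists and the default of [F] is never
    taken. *)
Lemma rep_of_incr (b : wo) w u (h : wcar b -> wcar T) : w <=! u ->
  (forall x y, wlt x y -> h x <! h y) -> (forall x, w <=! h x /\ h x <! u) ->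
  exists2 t, t <=! u & rep b w t.
Proof.
move=> wu hm hw.
pose Q (y : wcar b) (g : wcar b -> wcar T) (x : wcar T) := w <=! x /\ forall y', wlt y' y -> g y' <! x.
pose F y (g : wcar b -> wcar T) : wcar T :=
  if pselect (exists2 x, Q y g x & forall x', Q y g x' -> x <=! x') is left e then projT1 (cid2 e) else w.
pose f := Fix (@wlt_wf b) (fun=> wcar T) (fun y rec =>
    F y (fun y' => if pselect (wlt y' y) is left h then rec y' h else w)).
have FQ y g g' : (forall y', wlt y' y -> g y' = g' y') -> F y g = F y g'.
  move=> gg; have E : Q y g = Q y g'.
    apply: funext => x; apply: propext; split=> -[a H]; split=> // y' yy; have := H y' yy; by rewrite gg.
  by rewrite /F E.
have fE y : f y = F y f.
  rewrite /f Fix_eq; last first.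
    by move=> x g g' gg; apply: FQ => y' yy; case: pselect => // ?; apply: gg.
  by rewrite -/f; apply: FQ => y' yy; case: pselect.
have fP y : [/\ Q y f (f y), forall x, Q y f x -> f y <=! x & f y <=! h y].
  elim/(well_founded_ind (@wlt_wf b)): y => y IH.
  have Qh : Q y f (h y).
    split; first by case: (hw y).
    move=> y' yy; have [_ _ le] := IH y' yy; apply: sle_lt_trans le _; exact: hm.
  have [x Qx mx] := wmin (ex_intro _ _ Qh).
  have [Qf mf] : Q y f (f y) /\ forall x, Q y f x -> f y <=! x.
    have : exists2 x, Q y f x & forall x', Q y f x' -> x <=! x' by exists x.
    rewrite fE /F; case: pselect => // e _; by case: (cid2 e).
  by split=> //; apply: mf.
have fm x y : wlt x y -> f x <! f y by move=> xy; have [[_ H] _ _] := fP y; apply: H.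
have fe : order_emb (@wlt b) (@wlt T) f.
  move=> x y; split=> [|h']; first exact: fm.
  by case: (wlt_total x y) => [//|[e|/fm h2]]; [case: (@slt_irr T (f x)); rewrite {2}e|case: (@slt_irr T (f x)); apply: slt_trans h' h2].
have ex : exists x, w <=! x /\ forall y, f y <! x.
  by exists u; split=> // y; have [_ _ le] := fP y; apply: sle_lt_trans le _; case: (hw y).
have [t [wt ft] mt] := wmin ex.
exists t.
  by apply: mt; split=> // y; have [_ _ le] := fP y; apply: sle_lt_trans le _; case: (hw y).
split=> //; exists f; split=> // x; split=> [[wx xt]|[y <-]]; last first.
  by split=> //; have [[? _] _ _] := fP y.
have [y0 xy0] : exists y, x <=! f y.
  apply: contrapT => hn; apply: (sle_nlt (mt x (conj wx _)) xt) => y.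
  by case: (slt_or (f y) x) => // h'; case: hn; exists y.
elim/(well_founded_ind (@wlt_wf b)): y0 xy0 => y IH [xy|->]; last by exists y.
have [[y' [yy xy']]|hn] := pselect (exists y', wlt y' y /\ x <=! f y'); first exact: IH y' yy xy'.
have [_ mf _] := fP y; case: (@slt_irr T x); apply: slt_le_trans xy _; apply: mf; split=> // y' yy.
by case: (slt_or (f y') x) => // h'; case: hn; exists y'.
Qed.

Lemma rep_init (b : wo) w u (f : wcar b -> wcar T) : w <=! u ->
  order_emb (@wlt b) (@wlt T) f -> (forall y, w <=! f y /\ f y <! u) ->
  (forall x y, w <=! x -> x <! f y -> exists y', f y' = x) ->
  exists t, [/\ t <=! u, w <=! t & forall x, (w <=! x /\ x <! t) <-> exists y, f y = x].
Proof.
move=> wu fe fu fd.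
have [t [wt ft] mt] := wmin (ex_intro (fun x => w <=! x /\ forall y, f y <! x) u (conj wu (fun y => (fu y).2))).
exists t; split=> // [|x]; first by apply: mt; split=> // y; case: (fu y).
split=> [[wx xt]|[y <-]]; last by split=> //; case: (fu y).
have [y xy0] : exists y, x <=! f y.
  apply: contrapT => hn; apply: (sle_nlt (mt x (conj wx _)) xt) => y.
  by case: (slt_or (f y) x) => // h'; case: hn; exists y.
by case: xy0 => [xy|->]; [apply: fd xy|exists y].
Qed.

Lemma rep_lt (a b : wo) w s t : rep a w s -> rep b w t -> s <! t -> wltO a b.
Proof.
move=> [ws [f [fe fi]]] [wt [g [ge gi]]] st.
have [b0 eb0] := (gi s).1 (conj ws st).
have H x : exists y, g y = f x.
  by have [h1 h2] := (fi (f x)).2 (ex_intro _ x erefl); apply/(gi (f x)); split=> //; apply: slt_trans h2 st.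
pose k x := projT1 (cid (H x)); have kE x : g (k x) = f x by rewrite /k; case: cid.
exists b0, k; split=> [x y|y].
  by split=> h; [apply/ge; rewrite !kE; apply/fe|apply/fe; rewrite -!kE; apply/ge].
split=> [/ge|[x <-]].
  rewrite eb0 => ys; have [h1 _] := (gi (g y)).2 (ex_intro _ y erefl).
  have [x ex] := (fi (g y)).1 (conj h1 ys); exists x.
  have e : g (k x) = g y by rewrite kE.
  by case: (wlt_total (k x) y) => [/ge|[//|/ge]]; rewrite e => /slt_irr.
by apply/ge; rewrite kE eb0; case: ((fi (f x)).2 (ex_intro _ x erefl)).
Qed.
Lemma rep_le (a b : wo) w s t : rep a w s -> rep b w t -> s <=! t -> wle a b.
Proof.
move=> [ws [f [fe fi]]] [wt [g [ge gi]]] st.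
have H x : exists y, g y = f x.
  by have [h1 h2] := (fi (f x)).2 (ex_intro _ x erefl); apply/(gi (f x)); split=> //; apply: slt_le_trans h2 st.
pose k x := projT1 (cid (H x)); have kE x : g (k x) = f x by rewrite /k; case: cid.
exists k; split=> [x y|x y /ge].
  by split=> h; [apply/ge; rewrite !kE; apply/fe|apply/fe; rewrite -!kE; apply/ge].
rewrite kE => yx; have [h1 h2] := (fi (f x)).2 (ex_intro _ x erefl).
have [h3 _] := (gi (g y)).2 (ex_intro _ y erefl).
have [x' ex] := (fi (g y)).1 (conj h3 (slt_trans yx h2)); exists x'.
have e : g (k x') = g y by rewrite kE.
by case: (wlt_total (k x') y) => [/ge|[//|/ge]]; rewrite e => /slt_irr.
Qed.
Lemma rep_wle (a b : wo) w s t : rep a w s -> rep b w t -> wle a b -> s <=! t.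
Proof.
move=> [ws [f [fe fi]]] [wt [g [ge gi]]] [k [ke _]]; apply: nlt_sle => ts.
have [x ex] := (fi t).1 (conj wt ts).
have G y := (gi (g y)).2 (ex_intro _ y erefl).
have := @rep_incr a w s f (g \o k) fe fi.
case/(_ _ _ x)=> [y y' yy|y||e] /=; first by apply/ge; apply/ke.
- by case: (G (k y)).
- by rewrite ex; apply: sle_nlt; left; case: (G (k x)).
- by have := (G (k x)).2; rewrite -/(comp g k x) /= -[g (k x)]e ex => /slt_irr.
Qed.
Lemma rep_wlt (a b : wo) w t : rep b w t -> wltO a b -> exists2 s, s <! t & rep a w s.
Proof.
move=> [wt [g [ge gi]]] [b0 [f [fe fi]]]; exists (g b0).
  by case: ((gi (g b0)).2 (ex_intro _ b0 erefl)).
have G y := (gi (g y)).2 (ex_intro _ y erefl).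
split; first by case: (G b0).
exists (g \o f); split=> [x y|x]; first by split=> [/fe/ge|/ge/fe].
split=> [[wx xb]|[y <-]] /=.
  have [y ey] := (gi x).1 (conj wx (slt_trans xb (G b0).2)).
  have [|a' ea] := (fi y).1; first by apply/ge; rewrite ey.
  by exists a'; rewrite /= ea.
by split; [case: (G (f y))|apply/ge; apply/fi; exists y].
Qed.
Lemma rep_uniq a w s t : rep a w s -> rep a w t -> s = t.
Proof.
by move=> h1 h2; apply: sle_anti; apply: (@rep_wle a a w) => //; exists id; split=> // x y _; exists y.
Qed.

Variable z : wcar T.
Hypothesis z0 : forall x : wcar T, z <=! x.

Lemma rep_clocks k (p : program k) b w t : rep b w t -> (clocks p (@wlt b) <-> halts (am_of p) w t).
Proof. by move=> [wt [f [fe fi]]]; apply: (clocks_halts p wt fe fi). Qed.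
Definition clk k t := exists M : amach k, halts M z t.
Lemma rep_clk k b t : rep b z t -> (clockable_k k b <-> clk k t).
Proof.
move=> h; split=> [[p /(rep_clocks p h) hp]|[M hM]]; first by exists (am_of p).
by exists (prog_of M); apply/(rep_clocks _ h)/prog_of_halts.
Qed.
Lemma clk13 t : clk 1 t -> clk 3 t.
Proof. by move=> [M h]; exists (lift_mach 2 M); apply: lift_halts. Qed.
Lemma clk_sc k t : clk k t -> clk k (sc t).
Proof. by move=> [M h]; exists (delay M); apply: delay_halts. Qed.
Lemma clk_nlz k t : clk k t -> ~ lz t.
Proof. by move=> [M /halts_sc[u _ ->]]; apply: lz_sc. Qed.

Definition no_clk s t := forall u, s <=! u -> u <! t -> ~ clk 3 u.
Lemma rep_gapfree b a s t : rep b z s -> rep a z t -> (gap_free b a <-> no_clk s t).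
Proof.
move=> hb ha; split=> H.
  move=> u su ut cu; have hu := rep_seg (z0 u).
  apply: (H (seg z u)); [exact: rep_le hb hu su|exact: rep_lt hu ha ut|exact/(rep_clk _ hu)].
move=> x bx xa; have [u ut hu] := rep_wlt ha xa => /(rep_clk _ hu).
by apply: H => //; apply: rep_wle hb hu bx.
Qed.
Lemma rep_ends a t : rep a z t -> (ends_gap a <-> clk 3 t /\ exists2 s, s <! t & no_clk s t).
Proof.
move=> ha; split=> [[ca [b [ba gb]]]|[ct [s st H]]].
  split; first exact/(rep_clk _ ha).
  by have [s st hb] := rep_wlt ha ba; exists s => //; apply/(rep_gapfree hb ha).
split; first exact/(rep_clk _ ha).
have hs := rep_seg (z0 s); exists (seg z s); split; first exact: rep_lt hs ha st.
exact/(rep_gapfree hs ha).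
Qed.

(** Here [s] is the start of the gap and [t] is [s + beta]; the final omega of the length becomes
    [add t n <! A] for all [n]. *)
Lemma rep_len_fwd (a b : wo) A : rep a z A -> ends_gap_len_ge a (sum_rel (@wlt b) nat_lt) ->
  [/\ clk 3 A & exists s t, [/\ s <! A, no_clk s A, forall s', s' <! A -> no_clk s' A -> s <=! s',
     rep b s t & forall n, add t n <! A]].
Proof.
move=> ha [/(rep_ends ha)[cA _] [g [[b' [[b'a gf mb'] [phi [pe ps]]] [psi [se si]]]]]]; split=> //.
have [s sA hb'] := rep_wlt ha b'a.
have [_ [fa [fae fai]]] := ha.
have FA y := (fai (fa y)).2 (ex_intro _ y erefl).
have f0e : order_emb (@wlt b') (@wlt T) (fun x => fa (phi (inl x))).
  by move=> x y; split=> [h|/fae/pe //]; apply/fae; apply/(pe (inl x) (inl y)).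
have [s0 [s0A zs0 f0i]] := rep_init (z0 A) f0e (fun y => FA _) (ltac:(
  move=> x y zx xf; have [a' ea'] := (fai x).1 (conj zx (slt_trans xf (FA _).2));
  have [[y'|y'] ey'] := ps a'; [by exists y'; rewrite ey'|exfalso];
  by move: xf; rewrite -ea' -ey' => /fae/(pe (inr y') (inl y)))).
have es : s0 = s by apply: (@rep_uniq b' z) hb'; split=> //; exists (fun x => fa (phi (inl x))).
subst s0.
have inlS y : fa (phi (inl y)) <! s by case: ((f0i _).2 (ex_intro _ y erefl)).
have inrS y : s <=! fa (phi (inr y)).
  apply: nlt_sle => h; have [x ex] := (f0i _).1 (conj (z0 _) h).
  have : fa (phi (inl x)) <! fa (phi (inr y)) by apply/fae; apply/(pe (inl x) (inr y)).
  by rewrite ex => /slt_irr.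
pose F y := fa (phi (inr (psi y))).
have FE x y : sum_rel (@wlt b) nat_lt x y <-> F x <! F y.
  split=> [h|/fae/(pe (inr (psi x)) (inr (psi y)))/se //].
  by apply/fae; apply/(pe (inr (psi x)) (inr (psi y))); apply/se.
have Fd x y : s <=! x -> x <! F y -> exists y', F y' = x.
  move=> sx xF; have [a' ea'] := (fai x).1 (conj (z0 _) (slt_trans xF (FA _).2)).
  have [[y'|y'] ey'] := ps a'.
    by case: (sle_nlt sx); rewrite -ea' -ey'.
  have [|y2 e2] := si y y'; last by exists y2; rewrite /F e2 ey'.
  by move: xF; rewrite -ea' -ey' => /fae/(pe (inr y') (inr (psi y))).
have [t [tF st ti]] := @rep_init b s (F (inr 0)) (fun y => F (inl y)) (inrS _)
  (fun x y => FE (inl x) (inl y)) (fun y => conj (inrS _) ((FE (inl y) (inr 0)).1 I)) (ltac:(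
  move=> x y sx xF; have [[y'|y'] e] := Fd x _ sx xF; [by exists y'|exfalso];
  by move: xF; rewrite -e => /FE)).
exists s, t; split=> //.
- exact/(rep_gapfree hb' ha).
- move=> s' s'A ns; have hs' := rep_seg (z0 s').
  apply: (rep_wle hb' hs'); apply: mb'; first exact: rep_lt hs' ha s'A.
  exact/(rep_gapfree hs' ha).
- by split=> //; exists (fun y => F (inl y)); split=> // x y; apply: (FE (inl x) (inl y)).
move=> n; apply: sle_lt_trans (FA (phi (inr (psi (inr n))))).2.
elim: n => [//|n IH]; rewrite addS; apply: sc_min; apply: (sle_lt_trans IH).
by apply/(FE (inr n) (inr n.+1)); apply: ltnSn.
Qed.

(** The gap may start before [w], so [beta + omega] is given only as an increasing map into the gap,
    not as an initial segment of it; [rep_of_incr] collapses it. *)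
Lemma rep_len_bwd (a b : wo) A s0 w t : rep a z A -> clk 3 A -> s0 <! A -> no_clk s0 A ->
  s0 <=! w -> rep b w t -> (forall n, add t n <! A) ->
  ends_gap_len_ge a (sum_rel (@wlt b) nat_lt).
Proof.
move=> ha cA s0A ns0 s0w [wt [f [fe fi]]] tA; split; first by apply/(rep_ends ha); split=> //; exists s0.
have [s [sA ns] ms] := wmin (ex_intro (fun s => s <! A /\ no_clk s A) s0 (conj s0A ns0)).
have hs := rep_seg (z0 s).
have sw : s <=! w by apply: sle_trans (ms _ (conj s0A ns0)) s0w.
exists (seg s A); split.
  exists (seg z s); split.
    split; first exact: rep_lt hs ha sA.
      exact/(rep_gapfree hs ha).
    move=> b'' b''a gf; have [s'' s''A h''] := rep_wlt ha b''a.
    by apply: (rep_le hs h''); apply: ms; split=> //; apply/(rep_gapfree h'' ha).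
  have [_ [fa [fae fai]]] := ha.
  have H (x : segT z s + segT s A) : exists y, fa y = (match x with inl x => sval x | inr x => sval x end).
    apply/(fai _); split=> //; case: x => [[x [zx xs]]|[x [sx xA]]] //=; exact: slt_trans xs sA.
  pose k x := projT1 (cid (H x)); have kE x : fa (k x) = _ := projT2 (cid (H x)).
  exists k; split.
    move=> x y; split=> h.
      apply/fae; rewrite !kE; case: x y h => [x|x] [y|y] //= _.
      by case: x y => [x [zx xs]] [y [sy yA]] /=; apply: slt_le_trans xs sy.
    have {}h : fa (k x) <! fa (k y) by apply/fae.
    move: h; rewrite !kE; case: x y => [x|x] [y|y] //=.
    case: x y => [x [sx xA]] [y [zy ys]] /= xy.
    by apply: (sle_nlt sx); apply: slt_trans xy ys.
  move=> y; have [_ yA] := (fai (fa y)).2 (ex_intro _ y erefl).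
  have [x ex] : exists x : segT z s + segT s A, fa y = match x with inl x => sval x | inr x => sval x end.
    case: (slt_or (fa y) s) => h; first by exists (inl (exist _ (fa y) (conj (z0 _) h))).
    by exists (inr (exist _ (fa y) (conj h yA))).
  exists x; have e : fa (k x) = fa y by rewrite kE.
  by case: (wlt_total (k x) y) => [/fae|[//|/fae]]; rewrite e => /slt_irr.
have FA y := (fi (f y)).2 (ex_intro _ y erefl).
have [||t' t'A ht'] := @rep_of_incr (sumwo b natwo) s A (fun x => match x with inl y => f y | inr n => add t n end) (sltW sA).
- move=> [x|x] [y|y] //=; first by move/fe.
    by move=> _; apply: slt_le_trans (FA x).2 (add_ge _ _).
  exact: add_lt.
- move=> [y|n]; split=> //.
  + by apply: sle_trans sw (FA y).1.
  + by apply: slt_trans (FA y).2 (tA 0).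
  + by apply: sle_trans sw (sle_trans wt (add_ge _ _)).
by apply: (rep_le ht' _ t'A); apply: rep_seg; left.
Qed.
End Rep.

(** * The two parts of the theorem *)

Section QMach.
Variables (T : stages) (z : wcar T) (d cb : nat).
Hypothesis z0 : forall x : wcar T, z <=! x.
(** The searcher fires on a 0, hence [negb]. The code of [aFlag] is 0 and the memory is track 0, so
    the flag is physical cell 0. *)
Definition qmach : amach 1 := onetape (imach (faq d) (fxq cb)) negb.
Lemma qmach_halts t : lz t -> z <! t -> qmem z d cb t aFlag = false ->
  (forall l, lz l -> z <! l -> l <! t -> qmem z d cb l aFlag) -> halts qmach z (sc t).
Proof.
move=> ht zt t0 hl.
have E l : lz l -> amem (run (asys (imach (faq d) (fxq cb))) z l) (ord0, 0) = qmem z d cb l aFlag.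
  move=> ll; rewrite /aFlag npair00 /qmem.
  by rewrite -(@imach_sim _ encq (Boot false) (Boot true) (adrq d) (nxq cb) (faq d) (fxq cb)
    npair00 npair10 (den_faq d) (den_fxq cb) (@nxq_uniq cb) T z (hz z0) l ll (z0 l)).
apply: comp_flag => //; first exact: hz.
- by move=> l ll zl lt; rewrite E // negbK; apply: hl.
- by rewrite E // t0.
- by move=> s zs _; apply: imach_nohalt.
Qed.
End QMach.

Section Stages.
Variables a b : wo.
(** The order [a + b + omega]: [b] fits in after any stage below the end of [a], and the last
    summand removes the maximum. *)
Definition Two : wo := sumwo (sumwo a b) natwo.
Lemma Two_nomax (x : wcar Two) : exists y, wlt x y.
Proof. by case: x => [x|n]; [exists (inr 0)|exists (inr n.+1); apply: ltnSn]. Qed.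
Definition TT : stages := @Stages Two (inr 0) Two_nomax.
Lemma TT_rep : exists (z : wcar TT) (A : wcar TT), [/\ forall x, z <=! x, rep a z A &
   forall w, w <! A -> exists t, rep b w t].
Proof.
have [z _ mz] := wmin (ex_intro (fun=> True) (st_zero TT) I).
have z0 x : z <=! x by apply: mz.
pose i (y : wcar a) : wcar TT := inl (inl y).
have [A [_ zA iA]] := @rep_init TT a z (inr 0) i (z0 _) (fun x y => iff_refl _) (fun y => conj (z0 _) I)
   (ltac:(by move=> [[x|x]|x] y _ //=; exists x)).
exists z, A; split=> //; first by split=> //; exists i.
move=> w wA; have [x ex] := (iA w).1 (conj (z0 w) wA).
have wi y : w <! (inl (inr y) : wcar TT) by rewrite -ex.
have w0 : w <=! (inr 0 : wcar TT) by left; rewrite -ex.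
have [t _ ht] := @rep_of_incr TT b w (inr 0) (fun y => inl (inr y)) w0
   (fun x y h => h) (fun y => conj (sltW (wi y)) I).
by exists t.
Qed.
End Stages.

Section Final.
Variables (T : stages) (z A : wcar T) (alpha : wo).
Hypotheses (z0 : forall x : wcar T, z <=! x) (rA : rep alpha z A).
Notation clk3 := (clk z 3).

Lemma clk_add l n m : clk3 (add l n) -> n <= m -> clk3 (add l m).
Proof. by move=> h /subnK <-; elim: (m - n) => // j IH; rewrite addSn addS; apply: clk_sc. Qed.

(** The code is chosen before the stages, so one code serves every restart. *)
Lemma comp_code (M : amach 3) : exists c, forall w l n, lz w -> lz l -> halts M w (add l n) ->
  exists m, halts (Pr c) w (add l m : wcar T).
Proof.
exists (gcode (onetape M xpred0)) => w l n hw hl h.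
by have [m hm] := comp_halts hw (h := xpred0) (fun b => isT) hl h; exists m; apply: encode_halts.
Qed.

Lemma nh_clk l n : lz l -> clk3 (add l n) -> new_stop z l.
Proof.
move=> hl [M hM]; have [c Hc] := comp_code M; have [m [a [b e]]] := Hc z l n (hz z0) hl hM.
by exists c.+1, m; split=> // -[u ul]; apply: e => //; apply: slt_le_trans ul (add_ge _ _).
Qed.
Lemma clk_nh l : lz l -> new_stop z l -> exists n, clk3 (add l n).
Proof.
move=> hl [k [n [k0 nk pk]]].
have ex : exists n, stt (Pr k.-1) z (add l n) == ah (Pr k.-1) by exists n; apply/eqP.
case: (ex_minnP ex) => m /eqP em mm; exists m; apply: clk13 => //; exists (Pr k.-1).
split=> //; split=> // x _ xm pure_exec; case: (slt_or x l) => [xl|lx]; first by apply: nk; exists x.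
have [j e /andP[_ jm]] := @blk_le_lt _ l l x 0 m erefl hl lx xm.
by move: pure_exec; rewrite e => /eqP/mm; rewrite leqNgt jm.
Qed.

Lemma one_tape_next_gap delta : clockable delta -> wltO delta alpha -> ends_gap alpha ->
  (forall alpha', wltO delta alpha' -> ends_gap alpha' -> wle alpha alpha') ->
  one_tape_clockable alpha.
Proof.
move=> [p cp] da /(rep_ends z0 rA)[cA [s sA ns]] mn.
have [D DA rD] := rep_wlt rA da.
have hD := (rep_clocks p rD).1 cp.
have [l [n [hl eD]]] := decomp D.
(* From [D] on the stages of its block are clockable, by closure under successor, so none of them
   can end a gap. *)
have Al m : add l m <! A.
  elim: m => [|m IH]; first by apply: sle_lt_trans DA; rewrite eD; apply: add_ge.
  case: (sc_min IH) => // eA; exfalso; apply: (ns (add l m)) IH _.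
    by apply: sc_lt; rewrite -[sc _]/(add l m.+1) addS eA.
  have nm : n <= m by move: DA; rewrite eD -eA -addS => /add_lt_inv.
  by apply: clk_add nm; rewrite -eD; exists (am_of p).
have lA : l <! A := Al 0.
have [t ht [lt [lnt [tA tx]]]] := nxt_lim_ex lA Al.
have tA' : t <! A by case: tA => // e; case: (clk_nlz cA); rewrite -e.
have h1 : halts (onetape (flagm (am_of p)) id) z (sc t).
  have [f1 f2 f3] := flagm_halts (hz z0) hD hl (z0 l) eD ht lt tx.
  apply: comp_flag => //; [exact: hz|exact: sle_lt_trans lt|].
  by move=> u hu zu ut; rewrite f2.
have rt := rep_seg (z0 (sc t)).
(* The limit [t] alone is a gap, and [sc t] ends it. *)
have le : wle alpha (seg z (sc t)).
  apply: mn.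
    apply: (rep_lt rD rt); rewrite eD; apply: slt_trans (lnt n) (sc_gt _).
  apply/(rep_ends z0 rt); split; first by apply: clk13; exists (onetape (flagm (am_of p)) id).
  exists t; first exact: sc_gt.
  move=> u tu /sc_lt ut /clk_nlz; apply; by rewrite -(sle_anti tu ut).
have eA : A = sc t by apply: sle_anti (rep_wle rA rt le) (sc_min tA').
by apply/(rep_clk _ rA); rewrite eA; exists (onetape (flagm (am_of p)) id).
Qed.

Lemma one_tape_next_long_gap delta beta : (forall w, w <! A -> exists t, rep beta w t) ->
  clockable delta -> clockable beta -> wltO delta alpha ->
  ends_gap_len_ge alpha (sum_rel (@wlt beta) nat_lt) ->
  (forall alpha', wltO delta alpha' -> ends_gap_len_ge alpha' (sum_rel (@wlt beta) nat_lt) -> wle alpha alpha') ->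
  one_tape_clockable alpha.
Proof.
move=> hb [p cp] [pb cpb] da /(rep_len_fwd z0 rA)[cA [s [t1 [sA ns ms rb tA]]]] mn.
have [D DA rD] := rep_wlt rA da.
have hD := (rep_clocks p rD).1 cp.
have [l [n [hl eD]]] := decomp D.
have [d Hd] := comp_code (am_of p); have [cb Hb] := comp_code (am_of pb).
have [m hd] : exists m, halts (Pr d) z (add l m) by apply: (Hd z l n) => //; [exact: hz|rewrite -eD].
have Ds : D <! s.
  by case: (slt_or D s) => // sD; case: (ns D sD DA); exists (am_of p).
(* As [s] is the least start, clockable stages are cofinal below it. Hence [s] is a limit, and the
   haltings in those blocks make the restart bit 1 at [s]. *)
have bel s' : s' <! s -> exists u, [/\ s' <=! u, u <! s & clk3 u].
  move=> s's; apply: contrapT => hn; apply: (sle_nlt (ms s' (slt_trans s's sA) _) s's).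
  move=> u su uA cu; case: (slt_or u s) => us; last exact: (ns u).
  by apply: hn; exists u.
have hs : lz s.
  apply: contrapT => /nlz[u eu]; have us : u <! s by rewrite eu; apply: sc_gt.
  have [v [uv vs cv]] := bel u us.
  have ev : v = u by apply: sle_anti => //; apply: sc_lt; rewrite -eu.
  by apply: (ns s (slexx s) sA); rewrite eu -ev; apply: clk_sc.
have zs : z <! s by apply: sle_lt_trans Ds.
have ls : l <! s by apply: sle_lt_trans Ds; rewrite eD; apply: add_ge.
have hals : halted z d.+1 s.
  by exists (add l m); [apply: lz_add|case: hd => _ []].
have Rs : qmem z d cb s aR.
  apply: R1_of => // s' /bel[u [su us cu]]; have [l' [j [hl' eu]]] := decomp u.
  exists l', j; split=> //; rewrite -?eu //; last by apply: (@nh_clk _ j) => //; rewrite -eu.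
  by apply: sle_lt_trans us; rewrite eu; apply: add_ge.
(* The stage [s + beta] lies in the block of [v], and so does the halt of the one-tape replay. The
   extra omega keeps that whole block inside the gap. *)
have [v [j [hv et1]]] := decomp t1.
have sv : s <=! v by apply: (@blk_le _ _ _ j) => //; rewrite -et1; case: rb.
have [j' hj'] : exists j', halts (Pr cb) s (add v j').
  by apply: (Hb s v j) => //; rewrite -et1; apply/(rep_clocks pb rb).
have nnh l' : lz l' -> s <=! l' -> l' <=! v -> ~ new_stop z l'.
  move=> hl' sl' lv' /(clk_nh hl')[i]; apply: ns; first exact: sle_trans sl' (add_ge _ _).
  case: lv' => [lv'|->].
    by apply: slt_trans (lz_add i hv lv') _; apply: sle_lt_trans (tA 0); rewrite et1; apply: add_ge.
  apply: sle_lt_trans (tA i); rewrite et1 add_add; apply: add_le; lia.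
have vA i : add v i <! A.
  apply: sle_lt_trans (tA i); rewrite et1 add_add; apply: add_le; lia.
have [t ht [vt [lnt [tA2 tx]]]] := nxt_lim_ex (vA 0) vA.
have tA' : t <! A by case: tA2 => // e; case: (clk_nlz cA); rewrite -e.
have ft : qmem z d cb t aFlag = false.
  by apply: (Qfire z0 hs hals Rs hv sv nnh hj'); split.
have zt : z <! t by apply: sle_lt_trans vt.
have [t0 [ht0 zt0 ft0] mt0] := wmin (ex_intro (fun t => [/\ lz t, z <! t & qmem z d cb t aFlag = false]) t (And3 ht zt ft)).
have fst0 l' : lz l' -> z <! l' -> l' <! t0 -> qmem z d cb l' aFlag.
  move=> hl' zl' lt'; apply/negP => /negP/negbTE f; apply: (sle_nlt (mt0 l' _) lt'); by split.
have hq : halts (qmach d cb) z (sc t0) by apply: qmach_halts.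
have [v0 [w0 [n0 [nv [hv0 hw0] wv hal0 [nnh0 hb0]]]]] := Qfired z0 ht0 zt0 ft0 fst0.
have rt := rep_seg (z0 (sc t0)).
have t0A : sc t0 <=! A.
  by apply: sle_trans (sc_min tA'); case: (mt0 t (And3 ht zt ft)) => [/sc_mono|->]; [left|right].
have cq : clk3 (sc t0) by apply: clk13; exists (qmach d cb).
have [_ v0t0 nv0 nvx] := nv.
have w0t0 : w0 <! t0 by apply: sle_lt_trans v0t0.
have nc0 : no_clk z w0 (sc t0).
  move=> u wu /sc_lt[ut|->] cu; last exact: (clk_nlz cu).
  have [l' [i [hl' eu]]] := decomp u; have [i' ui'] := nvx u ut.
  apply: (nnh0 l') => //.
  - by apply: (@blk_le _ _ _ i) => //; rewrite -eu.
  - by apply: (@blk_le _ _ _ i') => //; apply: sle_trans ui'; rewrite eu; apply: add_ge.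
  - by apply: (@nh_clk _ i) => //; rewrite -eu.
have le : wle alpha (seg z (sc t0)).
  apply: mn.
    apply: (rep_lt rD rt); apply: slt_trans (slt_trans _ w0t0) (sc_gt _).
    rewrite eD; apply: lz_add => //; case: hal0 => u uw pu.
    apply: sle_lt_trans uw; apply: sle_trans (add_ge l m) _; apply: nlt_sle => um.
    by case: hd => _ [_ /(_ u (z0 u) um)]; apply.
  (* The replay from [w0] halts in the block of [v0], so [w0 + beta] lies in that block, and the gap
     from [w0] up to [sc t0] has room for a further omega. *)
  have [t2 r2] : exists t2, rep beta w0 t2.
    by apply: hb; apply: slt_trans w0t0 _; apply: slt_le_trans (sc_gt _) t0A.
  have [v2 [i2 [hv2 e2]]] := decomp t2.
  have [i3 h3] : exists i, halts (Pr cb) w0 (add v2 i).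
    by apply: (Hb w0 v2 i2) => //; rewrite -e2; apply/(rep_clocks pb r2).
  have [ev _] := blk_uniq hv2 hv0 (halts_uniq h3 hb0).
  apply: (rep_len_bwd z0 rt cq (s0 := w0) (w := w0) (t := t2)) => //.
  - exact: slt_trans w0t0 (sc_gt _).
  - exact: slexx.
  - by move=> i; apply: slt_trans (sc_gt _); rewrite e2 ev add_add.
have eA : A = sc t0 by apply: sle_anti (rep_wle rA rt le) t0A.
by apply/(rep_clk _ rA); rewrite eA; exists (qmach d cb).
Qed.
End Final.

Theorem mainTheorem17 :
  (* (1) *)
  (forall delta alpha : wo,
     clockable delta -> wltO delta alpha -> ends_gap alpha ->
     (forall alpha' : wo, wltO delta alpha' -> ends_gap alpha' -> wle alpha alpha') ->
     one_tape_clockable alpha)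
  /\
  (* (2): gaps of length at least beta + omega *)
  (forall delta beta alpha : wo,
     clockable delta -> clockable beta -> wltO delta alpha ->
     ends_gap_len_ge alpha (sum_rel (@wlt beta) nat_lt) ->
     (forall alpha' : wo, wltO delta alpha' ->
        ends_gap_len_ge alpha' (sum_rel (@wlt beta) nat_lt) -> wle alpha alpha') ->
     one_tape_clockable alpha).
Proof.
split=> [delta alpha|delta beta alpha].
  have [z [A [z0 rA _]]] := TT_rep alpha alpha; exact: (one_tape_next_gap z0 rA).
have [z [A [z0 rA hb]]] := TT_rep alpha beta; exact: (one_tape_next_long_gap z0 rA hb).
Qed.
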